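(* Let $\epsilon>0$ be fixed. Let $q$ be a large integer and let $N = q^\theta$ with $\theta < 1-\epsilon$ and $4\sqrt{\log q \log\log q}\, \log\log\log q < \log N$. Then \[\Delta(N,q) \geq \sqrt{N}\exp\left((1 + o(1)) \sqrt{\frac{(1-\theta)\log q}{\log\log q}}\right).\] If in addition $q$ is prime, then \[\Delta\!\left(\frac{q}{N}, q\right) \geq \sqrt{\frac{q}{N}} \exp\left((1 + o(1))\sqrt{\frac{(1-\theta)\log q}{2\log\log q}}\right).\] Here $o(1)$ denotes quantities tending to $0$ as $q\to\infty$.
   Context: For a positive integer $q$ and real $N\ge 1$, $\Delta(N,q) = \sup_{\chi \neq \chi_0 \bmod q} \left| \sum_{n \leq N}\chi(n)\right|$, the supremum over non-principal Dirichlet characters $\chi$ modulo $q$. *)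

(* Defs.v *)
From HB Require Import structures.
From mathcomp Require Import all_boot all_order all_algebra.
From mathcomp Require Import all_classical all_reals.
From mathcomp Require Import all_analysis.
From mathcomp Require Import complex.

Set Implicit Arguments.
Unset Strict Implicit.
Unset Printing Implicit Defensive.

Import Order.TTheory GRing.Theory Num.Theory.
Local Open Scope ring_scope.
Local Open Scope classical_set_scope.

Definition is_dirichlet_char (R : rcfType) (q : nat) (chi : nat -> R[i]) : Prop :=
  [/\ chi 1%N = 1,
      (forall m n : nat, chi (m * n)%N = chi m * chi n),
      (forall n : nat, chi (n + q)%N = chi n) &
      (forall n : nat, (chi n != 0) = coprime n q)].

Definition is_principal_char (R : rcfType) (q : nat) (chi : nat -> R[i]) : Prop :=
  forall n : nat, coprime n q -> chi n = 1.

Definition char_sum (R : realType) (chi : nat -> R[i]) (N : R) : R[i] :=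
  \sum_(1 <= n < (Num.truncn N).+1) chi n.

Definition Delta (R : realType) (N : R) (q : nat) : R :=
  sup [set Normc.normc (char_sum chi N) | chi in
        [set chi : nat -> R[i] | is_dirichlet_char q chi /\ ~ is_principal_char q chi]].

(* Main.v *)
Require Import Defs.
From HB Require Import structures.
From mathcomp Require Import all_boot all_order all_algebra.
From mathcomp Require Import all_fingroup all_solvable all_field all_character.
From mathcomp Require Import all_classical all_reals.
From mathcomp Require Import all_analysis.
From mathcomp Require Import complex zify ring lra.

Set Implicit Arguments.
Unset Strict Implicit.
Unset Printing Implicit Defensive.

Import Order.TTheory GRing.Theory Num.Theory.

(* Resonance method.  The mean over the characters mod q of |S_N|^2 |R|^2, for a
   Dirichlet polynomial R = sum r(n) chi(n), is a quadratic form in r whose (n, n')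
   entry counts the solutions of m n = m' n' mod q with m, m' <= N.  Comparing it
   with the mean of |R|^2 bounds Delta from below.

   If a / b is n / n' in lowest terms, the entry is at least about N / max(a, b).
   Take r supported on squarefree products of primes p in (L, L^K], L = log q, with
   r(p) = lam / (sqrt p log p).  If n and n' lie in a common dyadic window then
   max(a, b) is comparable with sqrt(ab), and the form with entries 1 / sqrt(ab) is
   essentially a sum of squares, so cutting r into O(log q) windows costs only a
   factor O(log q).  By Cauchy-Schwarz the size of that form is controlled by the
   linear sum of r(k) r(k m) / sqrt m, an Euler product up to Rankin tails, which is
   evaluated with Mertens' theorem.

   For the sum of length M = q / N with q prime, the principal character removes
   M^2 / q solutions from each entry.  The congruence b m = a m' mod q has at least
   M^2 / q - M / max(a, b) - O(1 + max(a, b) / N) solutions in the box, because the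
   number of points on the line b m - a m' = t almost decreases as |t| grows.  So
   the entries with max(a, b) small keep their size, while the possibly negative
   ones, with max(a, b) > N / L^3, are negligible by Rankin's trick. *)


(** * Lattice points on lines and in congruences *)

(** Where the exponents come from. Relative to the norm of r, the linear sum gains exp(sum of r(p) /
    sqrt p), about exp(lam / l) with l = ln ln q, because the sum of 1 / (p ln p) over p > L is
    about 1 / l. The truncation k m <= x = exp X limits lam: Rankin's trick needs the sum of r(p)^2
    ln p, about lam^2 / l, to stay below X. So lam^2 is nearly X l and the gain is nearly exp(sqrt(X
    / l)). The principal character limits x: in the first bound it costs N^2 x / phi(q), which is
    O(N) for x = q / (N ln q). In the second, the errors of the congruence count cost O(x + x^2 /
    N); x = sqrt M keeps this O(M) and accounts for the 2 under the root. Stopping at L^K loses a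
    proportion about 1 / K of the sum of 1 / (p ln p), but keeps the sum of 1 / p bounded, and the
    exponential of that sum is lost when the form is written with squares. Cutting the height at N /
    L^3 needs ln N to exceed any constant times lam; as lam <= sqrt(L l), this is the hypothesis on
    N, whose factor ln ln ln q absorbs the constants. Powers of ln q = exp l are negligible against
    exp(sqrt(X / l)). *)

Lemma card_congruent_le (M H b : nat) (S : {set 'I_M}) : 0 < b ->
  {in S, forall v : 'I_M, v < H} ->
  {in S &, forall v w : 'I_M, v = w %[mod b]} -> #|S| <= (H %/ b).+1.
Proof.
move=> b0 SH Sb.
pose f (v : 'I_M) : 'I_(H %/ b).+1 := inord (v %/ b).
have fE v : v \in S -> f v = v %/ b :> nat.
  move=> vS; rewrite inordK // ltnS leq_div2r //; exact: ltnW (SH v vS).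
have injf : {in S &, injective f}.
  move=> v w vS wS /(congr1 val) /=; rewrite !fE // => e.
  by apply: val_inj; rewrite /= (divn_eq v b) (divn_eq w b) e (Sb v w).
by rewrite -(card_in_imset injf) (leq_trans (max_card _)) // card_ord.
Qed.

Lemma card_congruent_ge (M H b c : nat) (S : {set 'I_M}) : 0 < b -> H <= M ->
  (forall v : 'I_M, v < H -> v = c %[mod b] -> v \in S) -> H %/ b <= #|S|.
Proof.
move=> b0 HM HS.
have lt (k : 'I_(H %/ b)) : k * b + c %% b < H.
  have k1 := ltn_ord k.
  have h1 : k.+1 * b <= H by apply: leq_trans (leq_trunc_div H b); rewrite leq_mul2r k1 orbT.
  by apply: leq_trans h1; rewrite mulSn addnC ltn_add2r ltn_mod.
pose f (k : 'I_(H %/ b)) : 'I_M := Ordinal (leq_trans (lt k) HM).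
have injf : injective f.
  move=> k k' /(congr1 val) /= /addIn /eqP; rewrite eqn_mul2r (gtn_eqF b0) /=.
  by move=> /eqP; apply: val_inj.
rewrite -[X in X <= _]card_ord -(card_imset _ injf); apply: subset_leq_card.
apply/fintype.subsetP => _ /imsetP [k _ ->]; apply: HS; first exact: lt.
by rewrite /= modnMDl modn_mod.
Qed.

Section LatticePoints.
Variables (a b M : nat).
Hypotheses (a0 : 0 < a) (b0 : 0 < b) (cab : coprime a b).

(** An element of ['I_M] stands for its successor, so that the coordinates run over 1, ..., M. *)
Definition on_line t := [set u : 'I_M * 'I_M | u.1.+1 * b == u.2.+1 * a + t].

(** The second coordinates of the points of [on_line t]: divisibility produces the first coordinate,
    and the inequality keeps it at most [M]. *)
Let V t := [set v : 'I_M | (b %| v.+1 * a + t) && (v.+1 * a + t <= b * M)].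

Let card_V t : #|on_line t| = #|V t|.
Proof.
apply/eqP; rewrite eqn_leq; apply/andP; split.
  have injf : {in on_line t &, injective snd}.
    move=> [u v] [u' v']; rewrite !inE /= => /eqP e /eqP e' vv.
    move: e'; rewrite -vv -e => /eqP; rewrite eqn_mul2r (gtn_eqF b0) /=.
    by rewrite eqSS => /eqP uu; congr pair; apply: val_inj.
  rewrite -(card_in_imset injf); apply: subset_leq_card.
  apply/fintype.subsetP => _ /imsetP [[u v] + ->]; rewrite !inE /= => /eqP <-.
  by rewrite dvdn_mull // mulnC leq_mul2l ltn_ord orbT.
pose g (v : 'I_M) : 'I_M * 'I_M :=
  (insubd v ((v.+1 * a + t) %/ b).-1, v).
have injg : injective g by move=> v w [].
rewrite -(card_imset _ injg); apply: subset_leq_card.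
apply/fintype.subsetP => _ /imsetP [v + ->]; rewrite !inE /= => /andP [dv le].
have q0 : 0 < (v.+1 * a + t) %/ b.
  by rewrite divn_gt0 // dvdn_leq // addn_gt0 muln_gt0 a0.
have qM : (v.+1 * a + t) %/ b <= M by rewrite leq_divLR // [M * b]mulnC.
have -> : (insubd v ((v.+1 * a + t) %/ b).-1 : nat) = ((v.+1 * a + t) %/ b).-1.
  by rewrite [LHS](val_insubd v) prednK // qM.
by rewrite prednK // divnK.
Qed.

(* For t >= 0 the points on the line are indexed by v in a residue class mod b
   inside an initial segment of [1, M] that shrinks as t grows. *)
Lemma on_line_almost_decreasing t t' : t <= t' -> #|on_line t'| <= #|on_line t|.+1.
Proof.
move=> tt'; rewrite !card_V.
pose H s := minn M ((b * M - s) %/ a).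
have VH s (v : 'I_M) : (v.+1 * a + s <= b * M) = (v < H s).
  rewrite /H leq_min ltn_ord /= leq_divRL //; have := ltn_ord v.
  by case: v => v /= _ _; lia.
have Hle : H t' <= H t by rewrite leq_min geq_minl /= (leq_trans (geq_minr _ _)) // leq_div2r // leq_sub2l.
apply: leq_trans (_ : (H t' %/ b).+1 <= _).
  apply: card_congruent_le => //.
    by move=> v; rewrite inE VH => /andP[].
  move=> v w; rewrite !inE => /andP[dv _] /andP[dw _].
  wlog vw : v w dv dw / v <= w.
    by move=> W; case/orP: (leq_total v w) => h; [|apply/esym]; apply: W.
  apply/esym/eqP; rewrite eqn_mod_dvd //.
  have : b %| (w.+1 * a + t') - (v.+1 * a + t') by rewrite dvdn_sub.
  rewrite subnDr -mulnBl subSS Gauss_dvdl //.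
  by rewrite coprime_sym.
rewrite ltnS; apply: leq_trans (leq_div2r b Hle) _.
have [x _ dx] := Bezoutl a b0.
rewrite gcdnC (eqP cab) in dx.
(* [x] is minus the inverse of [a] mod [b], so the divisibility says [v.+1 = x * t] mod [b]; adding
   [b.-1] plays the part of subtracting 1. *)
apply: (card_congruent_ge (c := x * t + b.-1)) => //; first exact: geq_minl.
move=> v vH vc; rewrite inE VH vH andbT.
have : v.+1 = x * t %[mod b].
  by rewrite -addn1 -modnDml vc modnDml -addnA addn1 prednK // modnDr.
move=> e; rewrite /dvdn -modnDml -modnMml e modnMml modnDml.
have -> : x * t * a + t = t * (1 + x * a) by rewrite mulnDr muln1 addnC mulnCA mulnA.
by rewrite -/(dvdn _ _) dvdn_mull.
Qed.

Variable q : nat.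
Hypothesis q0 : 0 < q.

(** The values t = b m - a m' are grouped into blocks of length [q]. The congruence keeps the first
    value of each block, and by almost monotonicity the other lines of the block carry at most one
    point more. There are [(b * M) %/ q + 1] blocks. *)
Lemma card_above_le :
  #|[set u : 'I_M * 'I_M | u.2.+1 * a <= u.1.+1 * b]| <=
  q * (#|[set u : 'I_M * 'I_M | (u.2.+1 * a <= u.1.+1 * b) &&
          (u.1.+1 * b == u.2.+1 * a %[mod q])]| + (b * M) %/ q + 1).
Proof.
set K := (b * M) %/ q.
pose h (u : 'I_M * 'I_M) := u.1.+1 * b - u.2.+1 * a.
have hlt u : h u < K.+1 * q.
  have := ltn_ord u.1; rewrite /h => u1.
  have : b * M < K.+1 * q by rewrite /K ltn_ceil.
  apply: leq_ltn_trans; apply: leq_trans (leq_subr _ _) _.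
  by rewrite mulnC leq_mul2l u1 orbT.
have E : #|[set u : 'I_M * 'I_M | u.2.+1 * a <= u.1.+1 * b]| =
   \sum_(t < K.+1 * q) #|on_line t|.
  rewrite -sum1_card (partition_big (fun u => Ordinal (hlt u)) predT) //=.
  apply: eq_bigr => t _; rewrite -sum1_card; apply: eq_bigl => u.
  rewrite !inE -val_eqE /= /h; apply/andP/eqP => [[h1 /eqP h2]|h1].
    by rewrite -h2 subnKC.
  by rewrite h1 leq_addr addKn.
have F : #|[set u : 'I_M * 'I_M | (u.2.+1 * a <= u.1.+1 * b) &&
          (u.1.+1 * b == u.2.+1 * a %[mod q])]| = \sum_(k < K.+1) #|on_line (k * q)|.
  have hq u : h u %/ q < K.+1 by rewrite ltn_divLR.
  rewrite -sum1_card (partition_big (fun u => Ordinal (hq u)) predT) //=.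
  apply: eq_bigr => k _; rewrite -sum1_card; apply: eq_bigl => u.
  rewrite !inE -val_eqE /= /h; apply/andP/eqP => [[/andP[h1 h2] /eqP h3]|h1].
    by rewrite -h3 divnK ?subnKC // -eqn_mod_dvd.
  by rewrite h1 leq_addr addKn mulnK // eqxx addnC modnMDl eqxx.
rewrite E F.
rewrite -(big_mkord predT (fun t => #|on_line t|)).
rewrite -(big_mkord predT (fun k => #|on_line (k * q)|)) -addnA addn1.
elim: K.+1 => [|n IH]; first by rewrite mul0n big_geq.
rewrite (big_cat_nat (n := n * q)) //=; last by rewrite leq_mul2r leqnSn orbT.
rewrite [X in _ <= q * (X + _)]big_nat_recr //= -[n.+1 in X in _ <= X]addn1.
rewrite addnACA mulnDr leq_add //.
apply: (@leq_trans (\sum_(n * q <= i < n.+1 * q) (#|on_line (n * q)|.+1))).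
  by rewrite big_nat [leqRHS]big_nat; apply: leq_sum => t /andP[h1 _]; exact: on_line_almost_decreasing.
by rewrite sum_nat_const_nat -mulnBl subSn // subnn mul1n addn1.
Qed.

End LatticePoints.

(** By coprimality the first coordinate is a multiple of [a], and the quotient determines the
    point. *)
Lemma card_on_line0_le a b M : 0 < a -> 0 < b -> coprime a b ->
  #|on_line a b M 0| <= M %/ a.
Proof.
move=> a0 b0 cab.
pose f (k : 'I_(M %/ a)) : nat := k.+1 * a.
have D (u : 'I_M * 'I_M) : u \in on_line a b M 0 -> a %| u.1.+1.
  rewrite inE addn0 => /eqP e; rewrite -(Gauss_dvdl _ cab) e; exact: dvdn_mull.
have lt (u : 'I_M * 'I_M) : (u.1.+1 %/ a).-1 < (M %/ a).+1.
  by rewrite ltnS (leq_trans (leq_pred _)) // leq_div2r.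
pose g (u : 'I_M * 'I_M) : nat := (u.1.+1 %/ a).-1.
have gl u : u \in on_line a b M 0 -> g u < M %/ a.
  move=> /D du; rewrite /g prednK ?divn_gt0 // ?leq_div2r //; exact: dvdn_leq.
case E : (M %/ a) => [|m].
  rewrite leqn0 cards_eq0 -finset.subset0; apply/fintype.subsetP => u /gl; by rewrite E.
pose g' (u : 'I_M * 'I_M) : 'I_m.+1 := inord (g u).
have inj : {in on_line a b M 0 &, injective g'}.
  move=> u v uS vS /(congr1 val) /=; rewrite !inordK -?E ?gl // /g.
  have du := D _ uS; have dv := D _ vS.
  have pu : 0 < u.1.+1 %/ a by rewrite divn_gt0 //; exact: dvdn_leq.
  have pv : 0 < v.1.+1 %/ a by rewrite divn_gt0 //; exact: dvdn_leq.
  move=> /(congr1 S); rewrite !prednK // => /(congr1 (muln^~ a)).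
  rewrite !divnK // => /eqP; rewrite eqSS => /eqP e1.
  move: uS vS; rewrite !inE !addn0 e1 => /eqP -> /eqP /eqP.
  rewrite eqn_mul2r (gtn_eqF a0) eqSS /= => /eqP e2.
  by case: u v e1 e2 {du dv pu pv} => [u1 u2] [v1 v2] /= e1 e2; congr pair; apply: val_inj.
by rewrite -(card_in_imset inj) (leq_trans (max_card _)) // card_ord.
Qed.

(** The box is the union of the points on or above the line b m = a m' and those on or below it.
    Each half is bounded by the block argument; solutions on the line itself are counted twice,
    which costs [M %/ maxn a b]. *)
Lemma congruence_count_ge a b M q :
  0 < a -> 0 < b -> coprime a b -> 0 < q ->
  M ^ 2 <= q * (#|[set u : 'I_M * 'I_M | u.1.+1 * b == u.2.+1 * a %[mod q]]|
                + M %/ maxn a b + (b * M) %/ q + (a * M) %/ q + 2).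
Proof.
move=> a0 b0 cab q0.
set S := [set u : 'I_M * 'I_M | u.1.+1 * b == u.2.+1 * a %[mod q]].
pose A := [set u : 'I_M * 'I_M | u.2.+1 * a <= u.1.+1 * b].
pose B := [set u : 'I_M * 'I_M | u.1.+1 * b <= u.2.+1 * a].
have hA : #|A| <= q * (#|A :&: S| + (b * M) %/ q + 1).
  apply: leq_trans (card_above_le M a0 b0 cab q0) _.
  by rewrite leq_mul2l !leq_add2r; apply/orP; right; apply: eq_leq; apply: eq_card => u; rewrite !inE.
have hB : #|B| <= q * (#|B :&: S| + (a * M) %/ q + 1).
  pose sw (u : 'I_M * 'I_M) := (u.2, u.1).
  have injs : injective sw by move=> [x y] [x' y'] [-> ->].
  have cba : coprime b a by rewrite coprime_sym.
  apply: leq_trans (leq_trans _ (card_above_le M b0 a0 cba q0)) _.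
    rewrite -(card_imset _ injs); apply: subset_leq_card.
    by apply/fintype.subsetP => _ /imsetP[u + ->]; rewrite !inE.
  rewrite leq_mul2l !leq_add2r; apply/orP; right.
  rewrite -(card_imset _ injs); apply: subset_leq_card.
  by apply/fintype.subsetP => _ /imsetP[u + ->]; rewrite !inE /= eq_sym.
have AB : A :|: B = [set: 'I_M * 'I_M].
  by apply/finset.setP => u; rewrite !inE leq_total.
have ABS : A :&: B = on_line a b M 0.
  by apply/finset.setP => u; rewrite !inE addn0 -eqn_leq eq_sym.
have N0 : #|on_line a b M 0| <= M %/ maxn a b.
  rewrite /maxn; case: ifP => _; last exact: card_on_line0_le.
  have cba : coprime b a by rewrite coprime_sym.
  apply: leq_trans (card_on_line0_le M b0 a0 cba).
  pose sw (u : 'I_M * 'I_M) := (u.2, u.1).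
  have injs : injective sw by move=> [x y] [x' y'] [-> ->].
  rewrite -(card_imset _ injs); apply: subset_leq_card.
  by apply/fintype.subsetP => _ /imsetP[u + ->]; rewrite !inE /= !addn0 eq_sym.
have M2 : M ^ 2 <= #|A| + #|B|.
  by rewrite -cardsUI AB cardsT card_prod card_ord mulnn leq_addr.
have SS : #|A :&: S| + #|B :&: S| <= #|S| + M %/ maxn a b.
  rewrite -cardsUI -finset.setIUl AB finset.setTI leq_add2l (leq_trans _ N0) // -ABS.
  by apply: subset_leq_card; apply/fintype.subsetP => u; rewrite !inE => /andP[/andP[-> _] /andP[-> _]].
apply: leq_trans M2 _; apply: leq_trans (leq_add hA hB) _.
rewrite -mulnDr leq_mul2l; apply/orP; right.
by move: SS; lia.
Qed.

(** * Primorials *)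

Lemma prod_primes_dvdn (s : seq nat) n :
  uniq s -> all prime s -> all (fun p => p %| n) s -> \prod_(p <- s) p %| n.
Proof.
elim: s => [|p s IH] /=; first by rewrite big_nil dvd1n.
move=> /andP[ps us] /andP[pp ap] /andP[pn an]; rewrite big_cons.
suff cp : coprime p (\prod_(j <- s) j) by rewrite Gauss_dvd // pn IH.
rewrite big_seq; apply: (big_ind (fun k => coprime p k)) => [|j k cj ck|r rs]; first exact: coprimen1.
  by rewrite coprimeMr cj.
rewrite prime_coprime // dvdn_prime2 ?(allP ap r rs) //.
by apply: contraNneq ps => ->.
Qed.

Lemma prod_primes_dvdn_big B (P : pred nat) n : 
  (forall p, P p -> prime p && (p %| n)) ->
  \prod_(0 <= p < B | P p) p %| n.
Proof.
move=> H; rewrite -big_filter; apply: prod_primes_dvdn.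
- exact: filter_uniq (iota_uniq _ _).
- by apply/allP => p; rewrite mem_filter => /andP[/H /andP[]].
- by apply/allP => p; rewrite mem_filter => /andP[/H /andP[]].
Qed.

(** The two equal middle coefficients both occur in the expansion of (1 + 1)^(2m+1). *)
Lemma bin_middle_le m : 'C(m.*2.+1, m) <= 4 ^ m.
Proof.
have : 2 * 'C(m.*2.+1, m) <= 2 ^ m.*2.+1.
  rewrite -[X in _ <= X ^ _]/(1 + 1) Pascal.
  have lm : m < m.*2.+2 by lia.
  have lm' : m.+1 < m.*2.+2 by lia.
  rewrite (bigD1 (Ordinal lm)) //= (bigD1 (Ordinal lm')) /=; last first.
    by rewrite -val_eqE /=; lia.
  rewrite !exp1n !muln1 addnA.
  have -> : 'C(m.*2.+1, m.+1) = 'C(m.*2.+1, m).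
    rewrite -[LHS]bin_sub; last by lia.
    by congr 'C(_, _); lia.
  by rewrite mul2n -addnn leq_addr.
rewrite expnS leq_pmul2l // -mul2n expnM.
by [].
Qed.

(** Erdos's argument: the primes in (m + 1, 2m + 1] divide the binomial coefficient C(2m+1, m), and
    an even n > 2 adds no prime. *)
Lemma primorial_le n : \prod_(0 <= p < n.+1 | prime p) p <= 4 ^ n.
Proof.
elim/ltn_ind: n => -[|[|[|n]]] IH.
- by rewrite big_mkcond big_nat1.
- by rewrite big_mkcond !big_nat_recr //= big_nil.
- by rewrite big_mkcond !big_nat_recr //= big_nil.
have [on|en] := boolP (odd n); last first.
  pose m := (n./2).+1.
  have e : n.+3 = m.*2.+1 by rewrite /m; have := odd_double_half n; rewrite (negPf en); lia.
  rewrite e (big_cat_nat (n := m.+2)) //=; last by lia.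
  have -> : 4 ^ m.*2.+1 = 4 ^ m.+1 * 4 ^ m by rewrite -expnD; congr (_ ^ _); lia.
  apply: leq_mul; first by apply: IH; rewrite /m; lia.
  apply: leq_trans (bin_middle_le m).
  apply: dvdn_leq; first by rewrite bin_gt0; lia.
  rewrite -big_filter; apply: prod_primes_dvdn.
  - exact: filter_uniq (iota_uniq _ _).
  - by apply/allP => p; rewrite mem_filter => /andP[].
  apply/allP => p; rewrite mem_filter mem_index_iota => /andP[pp /andP[p1 p2]].
  have : p %| (m.*2.+1)`! by apply: dvdn_fact; lia.
  rewrite -(@bin_fact m.*2.+1 m); last by lia.
  rewrite Euclid_dvdM // Euclid_dvdM // => /orP[//|].
  have pf k : k < p -> p %| k`! -> false.
    elim: k => [|k IHk] kp; first by rewrite fact0 dvdn1 => /eqP p1'; rewrite p1' in pp.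
    rewrite factS Euclid_dvdM // => /orP[/dvdn_leq -/(_ isT)|]; first by lia.
    by apply: IHk; exact: ltnW.
  by case/orP => h; suff : false by []; apply: (pf _ _ h); lia.
rewrite big_mkcond big_nat_recr //= -big_mkcond /=.
have -> : prime n.+3 = false.
  by apply/negP => /even_prime[//|/=]; rewrite on.
by rewrite muln1 (leq_trans (IH n.+2 _)) // leq_exp2l.
Qed.

Local Open Scope ring_scope.

(** * Dirichlet characters *)

(** X^n - 1 is separable, so it has n distinct roots, and they form a cyclic group. *)
Lemma prim_root_exists (C : numClosedFieldType) n :
  (0 < n)%N -> exists z : C, n.-primitive_root z.
Proof.
pose p : {poly C} := 'X^n - 1; have [r Dp] := closed_field_poly_normal p.
move=> n_gt0; rewrite (monicP _) ?monicXnsubC // scale1r in Dp.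
have rn1: all n.-unity_root r by apply/allP=> z; rewrite -root_prod_XsubC -Dp.
have sz_r: (n < (size r).+1)%N.
  by rewrite -(size_prod_XsubC r id) -Dp size_XnsubC.
have [|z] := hasP (has_prim_root n_gt0 rn1 _ sz_r); last by exists z.
by rewrite -separable_prod_XsubC -Dp separable_Xn_sub_1 // pnatr_eq0 -lt0n.
Qed.

(** * Duality of finite abelian groups *)

Section AbelianDual.
Variables (gT : finGroupType) (m : nat).
Hypothesis abG : abelian [set: gT].
Hypothesis cardG : #|[set: gT]| = m.+1.

(* A homomorphism gT -> Z/|gT|, written additively; composed with k |-> zeta^k,
   for zeta a primitive |gT|-th root of unity, it is a character. *)
Definition is_dual (f : {ffun gT -> 'I_m.+1}) : bool :=
  [forall x, forall y, f (x * y)%g == f x + f y].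

Lemma is_dualP (f : {ffun gT -> 'I_m.+1}) :
  reflect (forall x y, f (x * y)%g = f x + f y) (is_dual f).
Proof.
by apply: (iffP forallP) => [H x y|H x]; [move/forallP: (H x) => /(_ y) /eqP|
  apply/forallP => y; apply/eqP].
Qed.

(** The irreducible characters of an abelian group are linear and their kernels meet trivially. They
    have values in the algebraic numbers; taking exponents with respect to a primitive root makes
    them independent of the field, so that they can be evaluated in any [C] below. *)
Lemma dual_separates x : x != 1%g -> exists2 f, is_dual f & f x != 0.
Proof.
move=> xn1.
have [i ci] : exists i : Iirr [set: gT], 'chi_i x != 1.
  apply/existsP; apply: contraNT xn1; rewrite negb_exists => /forallP H.
  suff : x \in (\bigcap_i cfker 'chi[[set: gT]]_i)%g by rewrite TI_cfker_irr inE.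
  apply/finset.bigcapP => i _.
  have li := (char_abelianP _ abG) i.
  rewrite cfkerEchar ?irr_char // inE finset.in_setT lin_char1 //.
  by move: (H i); rewrite negbK.
have li := (char_abelianP _ abG) i.
have [z prz] := C_prim_root_exists (ltn0Sn m).
have rt y : 'chi_i y ^+ m.+1 = 1.
  by rewrite -lin_charX ?finset.in_setT // -cardG expg_cardG ?finset.in_setT // lin_char1.
pose f := [ffun y => sval (prim_rootP prz (rt y))].
have fE y : 'chi_i y = z ^+ f y by rewrite ffunE; case: (prim_rootP _ _).
exists f.
  apply/is_dualP => y1 y2; apply/val_inj => /=.
  have /eqP := lin_charM li (finset.in_setT y1) (finset.in_setT y2).
  by rewrite !fE -exprD (eq_prim_root_expr prz) => /eqP <-; rewrite modn_small.
by apply: contraNneq ci => fx0; rewrite fE fx0.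
Qed.

Variables (C : numClosedFieldType) (zeta : C).
Hypothesis przeta : m.+1.-primitive_root zeta.

Definition dual_val (f : {ffun gT -> 'I_m.+1}) x : C := zeta ^+ f x.

Lemma dual_valD f g x : dual_val (f + g) x = dual_val f x * dual_val g x.
Proof.
by rewrite /dual_val ffunE -exprD; apply/eqP; rewrite (eq_prim_root_expr przeta) /= modn_mod.
Qed.

Lemma dual_valM f x y : is_dual f -> dual_val f (x * y)%g = dual_val f x * dual_val f y.
Proof.
move=> /is_dualP fM; rewrite /dual_val fM -exprD.
by apply/eqP; rewrite (eq_prim_root_expr przeta) /= modn_mod.
Qed.

Lemma dual_val_eq1 f x : (dual_val f x == 1) = (f x == 0).
Proof.
rewrite /dual_val -[1](expr0 zeta) (eq_prim_root_expr przeta) mod0n.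
by rewrite modn_small // -val_eqE.
Qed.

Lemma dual_val_norm f x : `|dual_val f x| = 1.
Proof.
suff z1 : `|zeta| = 1 by rewrite normrX z1 expr1n.
apply/eqP; rewrite -(@pexpr_eq1 _ `|zeta| m.+1) // -normrX.
by rewrite (prim_expr_order przeta) normr1.
Qed.

Lemma dual_val1 f : is_dual f -> dual_val f 1%g = 1.
Proof.
move=> df; have := dual_valM 1%g 1%g df; rewrite mulg1.
have nz : dual_val f 1%g != 0 by rewrite -normr_eq0 dual_val_norm oner_eq0.
by rewrite -{1}[dual_val f 1%g]mulr1 => /(mulfI nz).
Qed.

Lemma dual_valV f x : is_dual f -> dual_val f x^-1%g = (dual_val f x)^*.
Proof.
move=> df; have nz : dual_val f x != 0 by rewrite -normr_eq0 dual_val_norm oner_eq0.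
apply: (mulfI nz); rewrite -dual_valM // mulgV dual_val1 //.
by rewrite -normCK dual_val_norm expr1n.
Qed.

Lemma is_dual0 : is_dual 0.
Proof. by apply/is_dualP => x y; rewrite !ffunE addr0. Qed.

Lemma is_dualDr g f : is_dual g -> is_dual (f + g) = is_dual f.
Proof.
move=> /is_dualP dg; apply/is_dualP/is_dualP => H x y.
  have := H x y; rewrite !ffunE dg => /eqP.
  by rewrite addrACA (inj_eq (addIr _)) => /eqP.
by rewrite !ffunE dg H addrACA.
Qed.

(** Translation by a dual element that separates [x] from 1 permutes the sum and multiplies it by a
    factor different from 1. *)
Lemma sum_dual_val_neq1 x : x != 1%g -> \sum_(f | is_dual f) dual_val f x = 0.
Proof.
move=> /dual_separates [g dg gx].
set s := \sum_(_ | _) _.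
have /eqP : s = s * dual_val g x.
  rewrite {1}/s (reindex_inj (addIr g)) mulr_suml.
  by apply: eq_big => [f|f _]; rewrite ?is_dualDr ?dual_valD.
rewrite -subr_eq0 -{1}[s]mulr1 -mulrBr mulf_eq0 => /orP[/eqP //|].
by rewrite subr_eq0 eq_sym dual_val_eq1 (negPf gx).
Qed.

(** The double sum of f(x) is evaluated in both orders: only x = 1 survives in one, only f = 0 in
    the other. *)
Lemma card_dual : \sum_(f : {ffun gT -> 'I_m.+1} | is_dual f) (1 : C) = m.+1%:R.
Proof.
have H1 : \sum_(x : gT) \sum_(f | is_dual f) dual_val f x = \sum_(f : {ffun gT -> 'I_m.+1} | is_dual f) (1 : C).
  rewrite (bigD1 1%g) //= [X in _ + X]big1 ?addr0; last by move=> x /sum_dual_val_neq1.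
  by apply: eq_bigr => f /dual_val1.
rewrite -H1 exchange_big /= (bigD1 (0 : {ffun gT -> 'I_m.+1})) ?is_dual0 //= [X in _ + X]big1 ?addr0.
  rewrite (eq_bigr (fun _ => 1)) ?sumr_const; last first.
    by move=> x _; apply/eqP; rewrite dual_val_eq1 ffunE.
  by rewrite -[#|_|]cardsT cardG.
move=> f /andP[df fn0].
have [g gx] : exists g, dual_val f g != 1.
  apply/existsP; apply: contraNT fn0; rewrite negb_exists => /forallP H.
  apply/eqP/ffunP => x; rewrite ffunE; apply/eqP; rewrite -dual_val_eq1.
  by move: (H x); rewrite negbK.
set s := \sum_(_ | _) _.
have /eqP : s = dual_val f g * s.
  rewrite {1}/s (reindex_inj (mulgI g)) mulr_sumr.
  by apply: eq_bigr => x _; rewrite dual_valM.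
by rewrite -subr_eq0 -{1}[s]mul1r -mulrBl mulf_eq0 subr_eq0 eq_sym (negPf gx) => /eqP.
Qed.

Lemma dual_orthogonality x y :
  \sum_(f | is_dual f) dual_val f x * (dual_val f y)^* = if x == y then m.+1%:R else 0.
Proof.
rewrite (eq_bigr (fun f => dual_val f (x * y^-1)%g)); last first.
  by move=> f df; rewrite dual_valM // dual_valV.
case: eqP => [->|/eqP xy].
  rewrite mulgV -card_dual; apply: eq_bigr => f df; exact: dual_val1.
by apply: sum_dual_val_neq1; rewrite -eq_mulgV1.
Qed.

End AbelianDual.

Lemma normc_norm (R : rcfType) (z : R[i]) : (Normc.normc z)%:C%C = `|z|.
Proof. by case: z => a b; rewrite normc_def. Qed.

(** * Dirichlet characters as characters of the units mod q *)

Section DirichletChar.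
Variables (R : realType) (q : nat).
Hypothesis q_gt1 : (1 < q)%N.

Local Notation U := {unit 'Z_q}.
Local Notation m := (totient q).-1.

(** The default value 1 at non-units does no harm, since [dchar] tests coprimality first. *)
Definition zunit (n : nat) : U := insubd (1%g : U) (n%:R : 'Z_q).

Lemma coprime_unitZp n : coprime n q -> (n%:R : 'Z_q) \is a GRing.unit.
Proof. by rewrite unitZpE // coprime_sym. Qed.

Lemma val_zunit n : coprime n q -> val (zunit n) = n%:R.
Proof. by move=> cn; rewrite val_insubd coprime_unitZp. Qed.

Lemma zunit1 : zunit 1 = 1%g.
Proof. by apply: val_inj; rewrite val_zunit ?coprime1n. Qed.

Lemma zunitM a b : coprime a q -> coprime b q -> zunit (a * b) = (zunit a * zunit b)%g.
Proof.
move=> ca cb; apply: val_inj; rewrite val_zunit ?coprimeMl ?ca //.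
by rewrite natrM [RHS]/= !val_zunit.
Qed.

Lemma zunit_eq a b : coprime a q -> coprime b q ->
  (zunit a == zunit b) = (a == b %[mod q]).
Proof.
move=> ca cb; rewrite -val_eqE /= !val_zunit // -val_eqE /= .
by rewrite !val_Zp_nat.
Qed.

Lemma zunitDr n : zunit (n + q) = zunit n.
Proof. by rewrite /zunit natrD pchar_Zp // addr0. Qed.

Lemma zunit_surj (u : U) : exists2 n, coprime n q & zunit n = u.
Proof.
have cn : coprime (val u : 'Z_q) q.
  by rewrite coprime_sym -unitZpE // natr_Zp; exact: (valP u).
by exists (val u : 'Z_q) => //; apply: val_inj; rewrite val_zunit // natr_Zp.
Qed.

Lemma card_unitZ : #|[set: U]| = m.+1.
Proof.
rewrite prednK ?totient_gt0 ?(ltnW q_gt1) //.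
exact: (card_units_Zp (ltnW q_gt1)).
Qed.

Variable zeta : R[i].
Hypothesis przeta : m.+1.-primitive_root zeta.

Definition dchar (f : {ffun U -> 'I_m.+1}) (n : nat) : R[i] :=
  if coprime n q then dual_val zeta f (zunit n) else 0.

Lemma dchar_dirichlet f : is_dual f -> is_dirichlet_char q (dchar f).
Proof.
move=> df; split.
- by rewrite /dchar coprime1n zunit1 dual_val1.
- move=> a b; rewrite /dchar coprimeMl.
  case: (boolP (coprime a q)) => ca; last by rewrite mul0r.
  case: (boolP (coprime b q)) => cb; last by rewrite mulr0.
  by rewrite /= zunitM // dual_valM.
- by move=> n; rewrite /dchar zunitDr -coprime_modl modnDr coprime_modl.
- move=> n; rewrite /dchar; case: ifP => _; last by rewrite eqxx.
  by rewrite -normr_eq0 (dual_val_norm przeta) oner_eq0.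
Qed.

Lemma dchar_principal f : is_principal_char q (dchar f) -> f = 0.
Proof.
move=> pf; apply/ffunP => u; rewrite ffunE; apply/eqP.
have [n cn <-] := zunit_surj u.
by have := pf n cn; rewrite /dchar cn => /eqP; rewrite (dual_val_eq1 przeta) => /eqP ->.
Qed.

Lemma dchar0 n : dchar 0 n = (coprime n q)%:R.
Proof.
rewrite /dchar; case: ifP => // _; apply/eqP; rewrite (dual_val_eq1 przeta).
by rewrite ffunE.
Qed.

Lemma dchar_orthogonality a b :
  \sum_(f | is_dual f) dchar f a * (dchar f b)^* =
  if [&& coprime a q, coprime b q & a == b %[mod q]] then (totient q)%:R else 0.
Proof.
rewrite /dchar; case: (boolP (coprime a q)) => ca /=; last first.
  by rewrite big1 // => f _; rewrite mul0r.
case: (boolP (coprime b q)) => cb /=; last first.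
  by rewrite big1 // => f _; rewrite conjC0 mulr0.
have abU : abelian [set: U] := units_Zp_abelian q.
rewrite (dual_orthogonality abU card_unitZ przeta) zunit_eq //.
by rewrite prednK ?totient_gt0 ?(ltnW q_gt1).
Qed.

(** Orthogonality after expanding the square; the computation is made in [R[i]], where conjugation
    is available, and pulled back to [R]. *)
Lemma sum_normc_dchar (T : finType) (c : T -> R) (n : T -> nat) :
  \sum_(f | is_dual f) Normc.normc (\sum_t (c t)%:C%C * dchar f (n t)) ^+ 2 =
  (totient q)%:R * \sum_t \sum_t' c t * c t' *
     [&& coprime (n t) q, coprime (n t') q & n t == n t' %[mod q]]%:R.
Proof.
apply: (@complexI R).
rewrite rmorphM rmorph_nat !rmorph_sum /= mulr_sumr.
under eq_bigr => f _.
  rewrite rmorphXn /= normc_norm normCK mulr_suml rmorph_sum /=.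
  under eq_bigr => t _ do rewrite mulr_sumr.
  over.
rewrite exchange_big /=; apply: eq_bigr => t _.
rewrite exchange_big /= rmorph_sum mulr_sumr; apply: eq_bigr => t' _.
under eq_bigr => f _.
  rewrite rmorphM /= mulrACA.
  over.
rewrite -mulr_sumr dchar_orthogonality.
have -> : ((c t')%:C%C)^* = (c t')%:C%C :> R[i].
  by apply/CrealP; rewrite complex_real.
rewrite !rmorphM rmorph_nat; case: ifP => _; rewrite ?mulr0 //.
by rewrite mulr1 mulrC.
Qed.

End DirichletChar.

(** By Euler's theorem a nonzero value is a root of unity. *)
Lemma dirichlet_char_norm_le1 (R : rcfType) q (chi : nat -> R[i]) n :
  (0 < q)%N -> is_dirichlet_char q chi -> `|chi n| <= 1.
Proof.
move=> q0 [c1 cM cD c0]; case: (boolP (coprime n q)) => [cn|]; last first.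
  by rewrite -c0 negbK => /eqP ->; rewrite normr0 ler01.
have cX k : chi (n ^ k)%N = chi n ^+ k.
  by elim: k => [|k IH]; rewrite ?expn0 ?c1 // expnS cM IH exprS.
have cDk k a : chi (a + k * q)%N = chi a.
  by elim: k => [|k IH]; rewrite ?mul0n ?addn0 // mulSn addnCA addnC cD IH.
have cmod a : chi a = chi (a %% q)%N by rewrite {1}(divn_eq a q) addnC cDk.
have : chi n ^+ totient q = 1.
  by rewrite -cX cmod (Euler_exp_totient cn) -cmod.
move=> /(congr1 (fun z => `|z|)); rewrite normr1 normrX => /eqP.
by rewrite pexpr_eq1 ?totient_gt0 // => /eqP ->.
Qed.

(** A supremum dominates the members of its set only once the set is bounded; the number of terms is
    a bound here. *)
Lemma char_sum_le_Delta (R : realType) q (chi : nat -> R[i]) (N : R) :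
  (0 < q)%N -> is_dirichlet_char q chi -> ~ is_principal_char q chi ->
  Normc.normc (char_sum chi N) <= Delta N q.
Proof.
move=> q0 dchi nchi; apply: ub_le_sup; last by exists chi.
exists (Num.truncn N)%:R => _ [psi [dpsi _] <-].
rewrite -lecR normc_norm /char_sum.
apply: (le_trans (ler_norm_sum _ _ _)).
apply: (@le_trans _ _ (\sum_(1 <= i < (Num.truncn N).+1) (1 : R[i]))).
  by apply: ler_sum => i _; exact: dirichlet_char_norm_le1 dpsi.
by rewrite sumr_const_nat subn1 rmorph_nat.
Qed.

(** Every non-principal sum is at most [Delta N q], and the principal character, the dual element 0,
    contributes exactly the subtracted square. Since the [n t] are distinct mod [q], the mean of the
    square of the resonator is diagonal. *)
Lemma Delta_resonance (R : realType) q (N : R) (T : finType) (c : T -> R) (n : T -> nat) :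
  (1 < q)%N ->
  (forall t, coprime (n t) q) ->
  (forall t t', n t = n t' %[mod q] -> t = t') ->
  let K := Num.truncn N in
  (totient q)%:R * (\sum_t \sum_t' c t * c t' *
    #|[set u : 'I_K * 'I_K | [&& coprime u.1.+1 q, coprime u.2.+1 q &
       u.1.+1 * n t == u.2.+1 * n t' %[mod q]]]|%:R)
  - (#|[set k : 'I_K | coprime k.+1 q]|%:R * \sum_t c t) ^+ 2
  <= Delta N q ^+ 2 * ((totient q)%:R * \sum_t c t ^+ 2).
Proof.
move=> q1 cop inj; set K := Num.truncn N; cbv zeta; have q0 := ltnW q1.
have [zeta pz] := prim_root_exists (R[i]) (ltn0Sn (totient q).-1).
pose F : finType := {ffun {unit 'Z_q} -> 'I_(totient q).-1.+1}.
pose D : F -> nat -> R[i] := @dchar R q zeta.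
pose A (f : F) := \sum_t (c t)%:C%C * D f (n t).
pose S (f : F) := char_sum (D f) N.
have SE (f : F) : S f = \sum_(k < K) D f k.+1.
  by rewrite /S /char_sum big_add1 /= big_mkord.
have dM (f : F) a b : is_dual f -> D f (a * b)%N = D f a * D f b.
  by move=> df; have [_ H _ _] := dchar_dirichlet q1 pz df; exact: H.
have E1 : \sum_(f | is_dual f) Normc.normc (A f) ^+ 2 = (totient q)%:R * \sum_t c t ^+ 2.
  rewrite (@sum_normc_dchar R q q1 zeta pz); congr (_ * _); apply: eq_bigr => t _.
  rewrite (bigD1 t) //= big1 ?addr0; first by rewrite cop eqxx mulr1 expr2.
  by move=> t' tt'; rewrite !cop /=; case: eqP => [/inj e|]; [rewrite e eqxx in tt'|rewrite mulr0].
have E2 : \sum_(f | is_dual f) Normc.normc (S f * A f) ^+ 2 =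
  (totient q)%:R * (\sum_t \sum_t' c t * c t' *
    #|[set u : 'I_K * 'I_K | [&& coprime u.1.+1 q, coprime u.2.+1 q &
       u.1.+1 * n t == u.2.+1 * n t' %[mod q]]]|%:R).
  transitivity (\sum_(f | is_dual f)
     Normc.normc (\sum_(s : 'I_K * T) (c s.2)%:C%C * D f (s.1.+1 * n s.2)%N) ^+ 2).
    apply: eq_bigr => f df; congr (Normc.normc _ ^+ 2).
    rewrite SE mulr_suml -(pair_big predT predT (fun (k : 'I_K) t => (c t)%:C%C * D f (k.+1 * n t)%N)) /=.
    apply: eq_bigr => k _; rewrite mulr_sumr; apply: eq_bigr => t _.
    by rewrite dM // mulrCA.
  rewrite (@sum_normc_dchar R q q1 zeta pz); congr (_ * _).
  rewrite -(pair_big predT predT (fun (k : 'I_K) t => \sum_(s' : 'I_K * T) c t * c s'.2 *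
     [&& coprime (k.+1 * n t) q, coprime (s'.1.+1 * n s'.2) q
       & k.+1 * n t == s'.1.+1 * n s'.2 %[mod q]]%:R)) /= exchange_big /=.
  apply: eq_bigr => t _.
  under eq_bigr => k _.
    rewrite -(pair_big predT predT (fun (k' : 'I_K) t' => c t * c t' *
     [&& coprime (k.+1 * n t) q, coprime (k'.+1 * n t') q
       & k.+1 * n t == k'.+1 * n t' %[mod q]]%:R)) /= exchange_big /=.
    over.
  rewrite exchange_big /=; apply: eq_bigr => t' _.
  under eq_bigr => k _ do rewrite -mulr_sumr.
  rewrite -mulr_sumr; congr (_ * _).
  rewrite -sum1_card natr_sum [RHS]big_mkcond /= .
  rewrite pair_big /=; apply: eq_bigr => -[k k'] _ /=.
  by rewrite inE /= !coprimeMl !cop !andbT; case: ifP.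
have D0 k : D 0 k = (coprime k q)%:R by exact: (dchar0 pz k).
have A0 : A 0 = (\sum_t c t)%:C%C.
  rewrite rmorph_sum; apply: eq_bigr => t _.
  by rewrite D0 cop mulr1.
have S0 : S 0 = (#|[set k : 'I_K | coprime k.+1 q]|%:R)%:C%C.
  rewrite SE rmorph_nat -sum1_card natr_sum [RHS]big_mkcond.
  by apply: eq_bigr => k _; rewrite D0 inE; case: ifP.
rewrite -E2 -E1 (bigD1 (0 : {ffun {unit 'Z_q} -> 'I_(totient q).-1.+1})) ?is_dual0 //= A0 S0 -rmorphM.
have nc (x : R) : Normc.normc x%:C%C ^+ 2 = x ^+ 2.
  by rewrite /Normc.normc /= expr0n addr0 sqr_sqrtr ?sqr_ge0.
rewrite nc addrAC subrr add0r.
(* On the right the principal term is nonnegative and is dropped. *)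
rewrite mulr_sumr [leRHS](bigID (fun f => f != 0)) /=.
apply: ler_wpDr; first by apply: sumr_ge0 => f _; rewrite mulr_ge0 ?sqr_ge0.
apply: ler_sum => f /andP[df f0].
rewrite Normc.normcM exprMn ler_wpM2r ?sqr_ge0 //.
rewrite lerXn2r ?nnegrE //.
- by rewrite -ler0c normc_norm.
- apply: le_trans (char_sum_le_Delta _ q0 (dchar_dirichlet q1 pz df) _).
    by rewrite -ler0c normc_norm; exact: normr_ge0.
  by move/(dchar_principal q1 pz) => f00; rewrite f00 eqxx in f0.
- apply: char_sum_le_Delta q0 (dchar_dirichlet q1 pz df) _.
  by move/(dchar_principal q1 pz) => f00; rewrite f00 eqxx in f0.
Qed.

(** * Mertens' estimates *)

Section Mertens.
Variable R : realType.
Implicit Types (n p q B : nat) (x y z l : R).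

Lemma ln_natr_ge0 n : 0 <= ln (n%:R : R).
Proof. by case: n => [|n]; [rewrite ln0 ?lexx|rewrite ln_ge0 // ler1n]. Qed.

Lemma ln_prod_natr (I : Type) (s : seq I) (P : pred I) (F : I -> nat) :
  (forall i, P i -> (0 < F i)%N) ->
  ln ((\prod_(i <- s | P i) F i)%N%:R : R) = \sum_(i <- s | P i) ln ((F i)%:R : R).
Proof.
move=> F0; pose K (x : nat) (y : R) := (0 < x)%N /\ ln (x%:R : R) = y.
suff [] : K (\prod_(i <- s | P i) F i)%N (\sum_(i <- s | P i) ln ((F i)%:R : R)) by [].
apply: (big_ind2 K); first by split => //; rewrite ln1.
- move=> x1 x2 y1 y2 [p1 <-] [p2 <-]; split; first by rewrite muln_gt0 p1.
  by rewrite natrM lnM ?posrE ?ltr0n.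
- by move=> i Pi; split => //; exact: F0.
Qed.

Lemma natr_factorization N B : (0 < N)%N -> (forall p, prime p -> (p %| N)%N -> (p < B)%N) ->
  N = (\prod_(0 <= p < B | prime p) p ^ logn p N)%N.
Proof.
move=> N0 NB; rewrite -{1}(partnT N0) (@widen_partn (maxn B N)) ?leq_maxr //.
rewrite (big_cat_nat (n := B)) //=; last by rewrite ltnW // ltnS leq_maxl.
rewrite [X in (_ * X)%N]big_nat_cond [X in (_ * X)%N]big1 ?muln1 => [|p h].
  rewrite [RHS]big_mkcond; apply: eq_bigr => p _; case: ifP => // pp.
  by rewrite lognE pp.
have Bp : (B <= p)%N by move: h; lia.
rewrite lognE; case: ifP => // /and3P[pp _ pN].
by have := NB p pp pN; rewrite ltnNge Bp.
Qed.

Lemma ln_factorization N B : (0 < N)%N -> (forall p, prime p -> (p %| N)%N -> (p < B)%N) ->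
  ln (N%:R : R) = \sum_(0 <= p < B | prime p) (logn p N)%:R * ln (p%:R : R).
Proof.
move=> N0 NB; rewrite {1}(natr_factorization N0 NB) ln_prod_natr; last first.
  by move=> p pp; rewrite expn_gt0 prime_gt0.
apply: eq_bigr => p pp; rewrite natrX lnXn ?ltr0n ?prime_gt0 //.
by rewrite mulr_natl.
Qed.

Lemma prime_dvd_fact_le p n : prime p -> (p %| n`!)%N -> (p <= n)%N.
Proof.
move=> pp; elim: n => [|n IH]; first by rewrite fact0 dvdn1 => /eqP p1; rewrite p1 in pp.
rewrite factS Euclid_dvdM // => /orP[/dvdn_leq -/(_ isT) //|/IH/leqW //].
Qed.

(** Chebyshev's bound from the primorial; the crude estimate ln 4 <= 3 is enough. *)
Lemma sum_ln_primes_le n : \sum_(0 <= p < n.+1 | prime p) ln (p%:R : R) <= n%:R * 3.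
Proof.
rewrite -ln_prod_natr; last by move=> p /prime_gt0.
apply: (@le_trans _ _ (ln ((4 ^ n)%N%:R : R))).
  rewrite ler_ln ?posrE ?ltr0n ?expn_gt0 //; first by rewrite ler_nat primorial_le.
  by rewrite prodn_cond_gt0 // => p /prime_gt0.
rewrite natrX lnXn // -[ln _ *+ n]mulr_natl ler_wpM2l //.
have := @le_ln1Dx R 3; lra.
Qed.

Lemma logn_fact_ge p n : prime p -> (n%:R / p%:R - 1 : R) <= (logn p n`!)%:R.
Proof.
move=> pp; have p0 := prime_gt0 pp.
have h : (n %/ p <= logn p n`!)%N.
  rewrite logn_fact //; case: n => [|n]; first by rewrite div0n.
  by rewrite big_nat_recl //= expn1 leq_addr.
apply: le_trans (_ : (n %/ p)%:R <= _); last by rewrite ler_nat.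
rewrite lerBlDr ler_pdivrMr ?ltr0n // -[1](mulr1n) -natrD -natrM ler_nat.
by rewrite addn1 ltnW // ltn_ceil.
Qed.

Lemma logn_fact_le p n : prime p -> (logn p n`!)%:R <= (n%:R / (p%:R - 1) : R).
Proof.
move=> pp; have p1 := prime_gt1 pp.
have p1' : 0 < (p%:R - 1 : R) by rewrite subr_gt0 ltr1n.
rewrite ler_pdivlMr // logn_fact //.
have -> : (p%:R - 1 : R) = (p - 1)%:R by rewrite natrB // ltnW.
rewrite -natrM ler_nat.
(* With the remainder [n %/ p ^ m] carried along, the geometric series telescopes in integers. *)
suff H m : ((\sum_(1 <= k < m.+1) n %/ p ^ k) * (p - 1) + n %/ p ^ m <= n)%N.
  by apply: leq_trans (H n); rewrite leq_addr.
elim: m => [|m IH]; first by rewrite big_geq // mul0n expn0 divn1.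
rewrite big_nat_recr //= mulnDl -addnA; apply: leq_trans IH; rewrite leq_add2l.
rewrite expnSr divnMA -{2}[(n %/ p ^ m %/ p)%N]muln1 -mulnDr subnK ?(ltnW p1) //.
exact: leq_trunc_div.
Qed.

Lemma ln_natS_sub n : (0 < n)%N -> ln (n.+1%:R : R) - ln (n%:R : R) <= n%:R^-1.
Proof.
move=> n0; have n0' : 0 < (n%:R : R) by rewrite ltr0n.
rewrite -ln_div ?posrE ?ltr0n //.
have -> : (n.+1%:R / n%:R : R) = 1 + n%:R^-1 by rewrite -natr1; field; rewrite gt_eqF.
by apply: le_ln1Dx; rewrite (lt_trans _ (_ : 0 < _)) ?invr_gt0 // ltrN10.
Qed.

Lemma ln_fact_ge n : n%:R * ln (n%:R : R) - n%:R <= ln (n`!%:R : R).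
Proof.
elim: n => [|n IH]; first by rewrite mul0r sub0r fact0 ln1 oppr0.
rewrite factS natrM lnM ?posrE ?ltr0n ?fact_gt0 //.
case: (posnP n) => [->|n0].
  by rewrite fact0 ln1; lra.
have := ln_natS_sub n0; have n0' : 0 < (n%:R : R) by rewrite ltr0n.
rewrite -(ler_pM2l n0') mulfV ?gt_eqF // => h.
by move: IH h; rewrite -natr1; set u := n%:R; set a := ln u; set b := ln (u + 1); nra.
Qed.

Lemma ln_fact_le n : ln (n`!%:R : R) <= n%:R * ln (n%:R : R).
Proof.
case: n => [|n]; first by rewrite fact0 ln1 mul0r.
have -> : n.+1%:R * ln (n.+1%:R : R) = ln ((n.+1 ^ n.+1)%N%:R : R).
  by rewrite natrX lnXn ?ltr0n // mulr_natl.
rewrite ler_ln ?posrE ?ltr0n ?fact_gt0 ?expn_gt0 // ler_nat.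
have -> : (n.+1 ^ n.+1 = \prod_(i < n.+1) n.+1)%N by rewrite prod_nat_const card_ord.
rewrite fact_prod big_add1 /= big_mkord.
by apply: leq_prod.
Qed.

Lemma sum_ln_div_le n :
  \sum_(0 <= p < n.+1 | prime p) ln (p%:R : R) / (p%:R * (p%:R - 1)) <= 2.
Proof.
have ge k : 0 <= ln (k%:R : R) / (k%:R * (k%:R - 1)).
  case: k => [|k]; first by rewrite mul0r invr0 mulr0.
  by rewrite divr_ge0 ?ln_natr_ge0 // mulr_ge0 // subr_ge0 ler1n.
case: n => [|n]; first by rewrite big_mkcond big_nat1.
apply: (@le_trans _ _ (\sum_(2 <= p < n.+2) ln (p%:R : R) / (p%:R * (p%:R - 1)))).
  rewrite big_mkcond (big_cat_nat (n := 2)) //= [X in X + _](_ : _ = 0) ?add0r.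
    by apply: ler_sum => p _; case: ifP.
  by rewrite !big_nat_recr //= big_geq // !addr0.
(* A discrete primitive of ln x / x^2. The primitive itself is -(ln x + 1) / x; the 2 in place of 1
   absorbs the increments of ln. Primality has been dropped. *)
pose f (k : nat) : R := (ln k%:R + 2) / k%:R.
suff H m : \sum_(2 <= p < m.+2) ln (p%:R : R) / (p%:R * (p%:R - 1)) <= 2 - f m.+1.
  apply: le_trans (H n) _; rewrite gerBl /f divr_ge0 // addr_ge0 //; exact: ln_natr_ge0.
elim: m => [|m IH]; first by rewrite big_geq // /f ln1 divr1; lra.
rewrite big_nat_recr //=.
have h := ln_natS_sub (ltn0Sn m).
have m0 : 1 <= (m.+1%:R : R) by rewrite ler1n.
move: IH h; rewrite /f -[m.+2%:R]natr1; set S := \sum_(_ <= _ < _) _.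
move: m0; set u := m.+1%:R; set a := ln u; set b := ln (u + 1) => u1 IH h.
have u0 : 0 < u by lra.
have -> : u + 1 - 1 = u by lra.
suff : b / ((u + 1) * u) <= (a + 2) / u - (b + 2) / (u + 1) by move: IH; set X := _ / u; set Y := (_ + 2) / _; set Z := b / _; lra.
have -> : (a + 2) / u - (b + 2) / (u + 1) = ((a + 2) * (u + 1) - (b + 2) * u) / ((u + 1) * u).
  by field; rewrite !gt_eqF //; lra.
rewrite ler_pM2r ?invr_gt0 ?mulr_gt0 //; last by lra.
have h1 : (b - a) * u <= 1 by rewrite -ler_pdivlMr // div1r.
have h2 : b - a <= 1 by apply: le_trans h _; rewrite invf_le1.
nra.
Qed.

Definition mertens_sum n : R := \sum_(0 <= p < n.+1 | prime p) ln (p%:R : R) / p%:R.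

Lemma ln_fact_primes n :
  ln (n`!%:R : R) = \sum_(0 <= p < n.+1 | prime p) (logn p n`!)%:R * ln (p%:R : R).
Proof.
apply: ln_factorization; first exact: fact_gt0.
by move=> p pp /prime_dvd_fact_le; rewrite ltnS; apply.
Qed.

(** ln n! is computed by Stirling and by Legendre. One side loses 1 from Stirling and 2 from
    [sum_ln_div_le], the other loses 3 from Chebyshev. *)
Lemma mertens_first n : (0 < n)%N -> `|mertens_sum n - ln (n%:R : R)| <= 3.
Proof.
move=> n0; have n0' : 0 < (n%:R : R) by rewrite ltr0n.
rewrite ler_norml; apply/andP; split; rewrite -(ler_pM2l n0') mulrBr.
  have : ln (n`!%:R : R) <= n%:R * mertens_sum n + n%:R * 2.
    apply: (@le_trans _ _ (\sum_(0 <= p < n.+1 | prime p)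
      (n%:R * (ln (p%:R : R) / p%:R) + n%:R * (ln (p%:R : R) / (p%:R * (p%:R - 1)))))).
      rewrite ln_fact_primes; apply: ler_sum => p pp.
      have p1 : (1 : R) < p%:R by rewrite ltr1n prime_gt1.
      apply: le_trans (ler_wpM2r (ln_natr_ge0 _) (logn_fact_le n pp)) _.
      rewrite le_eqVlt; apply/orP; left; apply/eqP; field.
      by rewrite !gt_eqF //; lra.
    by rewrite big_split /= -!mulr_sumr lerD2l ler_wpM2l // sum_ln_div_le.
  by have := ln_fact_ge n; lra.
have : n%:R * mertens_sum n - n%:R * 3 <= ln (n`!%:R : R).
  apply: (@le_trans _ _ (\sum_(0 <= p < n.+1 | prime p)
      (n%:R * (ln (p%:R : R) / p%:R) - ln (p%:R : R)))).
    by rewrite sumrB -mulr_sumr lerD2l lerN2 sum_ln_primes_le.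
  rewrite ln_fact_primes; apply: ler_sum => p pp.
  apply: le_trans (ler_wpM2r (ln_natr_ge0 _) (logn_fact_ge n pp)).
  by rewrite mulrBl mul1r mulrA mulrAC.
by have := ln_fact_le n; lra.
Qed.

End Mertens.

(** * Prime sums on the scale of ln p *)

Section MertensBlocks.
Variable R : realType.
Implicit Types (n p q B : nat) (x y z l : R).

Lemma ln_le_expR x z : 0 < x -> (ln x <= z) = (x <= expR z).
Proof. by move=> x0; rewrite -[z in LHS]expRK ler_ln ?posrE ?expR_gt0. Qed.

(** Rounding exp z down to an integer changes the logarithm by at most 1, hence 4 = 3 + 1. *)
Lemma mertens_ln_le z B : 0 <= z -> expR z < B%:R ->
  `|\sum_(0 <= p < B | prime p && (ln (p%:R : R) <= z)) ln (p%:R : R) / p%:R - z| <= 4.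
Proof.
move=> z0 zB; pose n := Num.truncn (expR z).
have e1 : 1 <= expR z by rewrite -expR0 ler_expR.
have /andP[ne en] := truncn_itv (expR_ge0 z); rewrite -/n in ne en.
have n0 : (0 < n)%N by rewrite truncn_gt0.
have -> : \sum_(0 <= p < B | prime p && (ln (p%:R : R) <= z)) ln (p%:R : R) / p%:R = mertens_sum R n.
  have nB : (n < B)%N by rewrite -(ltr_nat R) (le_lt_trans ne).
  rewrite (big_cat_nat (n := n.+1)) //= [X in _ + X]big_nat_cond [X in _ + X]big1 ?addr0; last first.
    move=> p /andP[/andP[np _] /andP[pp]]; rewrite ln_le_expR ?ltr0n ?prime_gt0 // => pz.
    suff : (p%:R : R) < p%:R by rewrite ltxx.
    by apply: le_lt_trans pz _; apply: lt_le_trans en _; rewrite ler_nat.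
  rewrite /mertens_sum big_nat_cond [RHS]big_nat_cond; apply: eq_bigl => p.
  rewrite leq0n /= ltnS; case: leqP => //= pn; case pp: (prime p) => //=.
  rewrite ln_le_expR ?ltr0n ?prime_gt0 //; apply: le_trans ne; by rewrite ler_nat.
have h1 := mertens_first R n0.
have n0' : 0 < (n%:R : R) by rewrite ltr0n.
have h2 : ln (n%:R : R) <= z by rewrite ln_le_expR.
have h3 : z <= ln (n.+1%:R : R).
  by rewrite -[z]expRK ler_ln ?posrE ?expR_gt0 ?ltr0n // ltW.
have h4 := ln_natS_sub R n0.
have h5 : (n%:R : R)^-1 <= 1 by rewrite invf_le1 // ler1n.
by move: h1; rewrite !ler_norml => /andP[h6 h7]; apply/andP; split; lra.
Qed.

Lemma mertens_interval l z B : 0 <= l -> l <= z -> expR z < B%:R ->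
  `|\sum_(0 <= p < B | prime p && (l < ln (p%:R : R) <= z)) ln (p%:R : R) / p%:R - (z - l)| <= 8.
Proof.
move=> l0 lz zB.
have lB : expR l < B%:R by apply: le_lt_trans zB; rewrite ler_expR.
have h1 := mertens_ln_le (le_trans l0 lz) zB.
have h2 := mertens_ln_le l0 lB.
move: h1; rewrite (bigID (fun p => ln (p%:R : R) <= l)) /=.
rewrite (eq_bigl (fun p => prime p && (ln (p%:R : R) <= l))); last first.
  move=> p; case: (prime p) => //=; case: (leP (ln p%:R) l) => // h; rewrite ?andbF //.
  by rewrite (le_trans h lz).
rewrite [X in _ + X - _](eq_bigl (fun p => prime p && (l < ln (p%:R : R) <= z))); last first.
  by move=> p; rewrite -ltNge -andbA; congr andb; rewrite andbC.
move: h2; rewrite !ler_norml => /andP[h1 h2] /andP[h3 h4]; apply/andP; split; lra.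
Qed.

(** 1 / (p ln p) is ln p / p divided by (ln p)^2, and the square is frozen at an end of the
    block. *)
Lemma sum_inv_p_lnp_block (a b : R) B : 0 < a -> a <= b -> expR b < B%:R ->
  (b - a - 8) / b ^+ 2 <=
   \sum_(0 <= p < B | prime p && (a < ln (p%:R : R) <= b)) (p%:R * ln (p%:R : R))^-1
  <= (b - a + 8) / a ^+ 2.
Proof.
move=> a0 ab bB.
have := mertens_interval (ltW a0) ab bB; rewrite ler_norml => /andP[h1 h2].
have b0 : 0 < b := lt_le_trans a0 ab.
have E p : prime p && (a < ln (p%:R : R) <= b) ->
  (p%:R * ln (p%:R : R))^-1 = (ln (p%:R : R) / p%:R) / ln (p%:R : R) ^+ 2.
  move=> /and3P[pp ap _]; have l0 := lt_trans a0 ap; field.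
  by rewrite (gt_eqF l0) /= pnatr_eq0 -lt0n prime_gt0.
rewrite (eq_bigr _ E).
apply/andP; split.
  apply: (@le_trans _ _ (\sum_(0 <= p < B | prime p && (a < ln (p%:R : R) <= b)) (ln (p%:R : R) / p%:R) / b ^+ 2)).
    by rewrite -mulr_suml ler_pM2r ?invr_gt0 ?exprn_gt0 //; lra.
  apply: ler_sum => p /and3P[pp ap pb]; have l0 := lt_trans a0 ap.
  rewrite ler_wpM2l ?divr_ge0 ?(ltW l0) // lef_pV2 ?posrE ?exprn_gt0 //.
  by rewrite lerXn2r ?nnegrE ?(ltW l0) ?(ltW b0).
apply: (@le_trans _ _ (\sum_(0 <= p < B | prime p && (a < ln (p%:R : R) <= b)) (ln (p%:R : R) / p%:R) / a ^+ 2)).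
  apply: ler_sum => p /and3P[pp ap pb]; have l0 := lt_trans a0 ap.
  rewrite ler_wpM2l ?divr_ge0 ?(ltW l0) // lef_pV2 ?posrE ?exprn_gt0 //.
  by rewrite lerXn2r ?nnegrE ?(ltW l0) ?(ltW a0) ?(ltW ap).
by rewrite -mulr_suml ler_pM2r ?invr_gt0 ?exprn_gt0 //; lra.
Qed.

(* The range (l, g^J l] of ln p is cut into the blocks (g^j l, g^(j+1) l]. *)
Lemma sum_inv_p_lnp_geometric (eta l : R) J B : 0 < eta -> 0 < l ->
  let g := 1 + eta in expR (g ^+ J * l) < B%:R ->
  (1 - 8 / (eta * l)) * (1 - g ^- J) / (g * l) <=
   \sum_(0 <= p < B | prime p && (l < ln (p%:R : R) <= g ^+ J * l)) (p%:R * ln (p%:R : R))^-1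
  <= (1 + 8 / (eta * l)) * (1 - g ^- J) * g / l.
Proof.
move=> e0 l0 g; have g1 : 1 < g by rewrite /g; lra.
have g0 : 0 < g by lra.
elim: J => [|J IH] hB.
  rewrite expr0 mul1r invr1 subrr !mulr0 !mul0r big_pred0 ?lexx //.
  by move=> p; rewrite andbC; case: ltP => //= h; rewrite leNgt h.
set a := g ^+ J * l; have a0 : 0 < a by rewrite mulr_gt0 ?exprn_gt0.
have la : l <= a by rewrite ler_peMl ?(ltW l0) // exprn_ege1 // ltW.
have ab : a <= g ^+ J.+1 * l by rewrite exprS -mulrA ler_peMl ?(ltW a0) // ltW.
have aB : expR a < B%:R by apply: le_lt_trans hB; rewrite ler_expR.
have /andP[IH1 IH2] := IH aB.
have /andP[h1 h2] := sum_inv_p_lnp_block a0 ab hB.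
rewrite (bigID (fun p => ln (p%:R : R) <= a)) /=.
rewrite (eq_bigl (fun p => prime p && (l < ln (p%:R : R) <= a))); last first.
  move=> p; case: (prime p) => //=; case: (leP (ln p%:R) a) => // h; rewrite ?andbF //.
  by rewrite (le_trans h ab) !andbT.
rewrite [X in _ <= _ + X <= _](eq_bigl (fun p => prime p && (a < ln (p%:R : R) <= g ^+ J.+1 * l))); last first.
  move=> p; rewrite -ltNge -andbA; congr andb.
  case: (ltP a (ln p%:R)) => h; rewrite ?andbF // andbT (le_lt_trans la h) //.
move: IH1 IH2 h1 h2; set s1 := \sum_(_ <= _ < _ | _) _; set s2 := \sum_(_ <= _ < _ | _) _.
(* In terms of [w] both comparisons below reduce to [w <= 1]. *)
pose w := g ^- J; have w0 : 0 < w by rewrite invr_gt0 exprn_gt0.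
have w1 : w <= 1 by rewrite invf_le1 ?exprn_gt0 // exprn_ege1 // ltW.
have aw : a = l / w by rewrite /a /w invrK mulrC.
have -> : g ^- J.+1 = w / g by rewrite /w exprS invfM mulrC.
have -> : g ^+ J.+1 * l = g * a by rewrite /a exprS mulrA.
rewrite -/w => IH1 IH2 h1 h2; apply/andP; split.
  apply: le_trans (lerD IH1 h1).
  suff : (1 - 8 / (eta * l)) * (w - w / g) / (g * l) <= (g * a - a - 8) / (g * a) ^+ 2.
    set X := _ / (g * a) ^+ 2; rewrite -lerBlDl; apply: le_trans.
    by rewrite le_eqVlt; apply/orP; left; apply/eqP; ring.
  have -> : (1 - 8 / (eta * l)) * (w - w / g) / (g * l) = w * (eta * l - 8) / (g * l) ^+ 2.
    by rewrite /g; field; rewrite !gt_eqF //=; lra.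
  have -> : (g * a - a - 8) / (g * a) ^+ 2 = w * (eta * l - 8 * w) / (g * l) ^+ 2.
    by rewrite aw /g; field; rewrite !gt_eqF //=; lra.
  rewrite ler_pM2r ?invr_gt0 ?exprn_gt0 ?mulr_gt0 // ler_pM2l //; lra.
apply: le_trans (lerD IH2 h2) _.
suff : (g * a - a + 8) / a ^+ 2 <= (1 + 8 / (eta * l)) * (w - w / g) * g / l.
  set X := _ / a ^+ 2; rewrite -lerBrDl => h; apply: le_trans h _.
  by rewrite le_eqVlt; apply/orP; left; apply/eqP; ring.
have -> : (1 + 8 / (eta * l)) * (w - w / g) * g / l = w * (eta * l + 8) / l ^+ 2.
  by rewrite /g; field; rewrite !gt_eqF //=; lra.
have -> : (g * a - a + 8) / a ^+ 2 = w * (eta * l + 8 * w) / l ^+ 2.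
  by rewrite aw /g; field; rewrite !gt_eqF //=; lra.
rewrite ler_pM2r ?invr_gt0 ?exprn_gt0 ?mulr_gt0 // ler_pM2l //; lra.
Qed.

(** With u = ln p the sum behaves like the integral of du / u^2 over [l, K l]. Four errors of
    relative size about [eta = d / 4] are allowed: the ratio [g] of a block, its rounding (hence
    [l0 = 8 / eta ^ 2]), and the missing tail, for which Bernoulli's inequality provides [J]. So [K]
    depends on [d] only. *)
Lemma sum_inv_p_lnp (d : R) : 0 < d < 1 ->
  exists K l0 : R, [/\ 1 < K, 0 < l0 & forall l B, l0 <= l -> expR (K * l) < B%:R ->
  (1 - d) / l <=
   \sum_(0 <= p < B | prime p && (l < ln (p%:R : R) <= K * l)) (p%:R * ln (p%:R : R))^-1
  <= (1 + d) / l].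
Proof.
move=> /andP[d0 d1]; pose eta := d / 4; pose g := 1 + eta.
have e0 : 0 < eta by rewrite /eta; lra.
have g1 : 1 < g by rewrite /g; lra.
have g0 : 0 < g by lra.
have [J hJ] : exists J, g ^- J.+1 <= eta.
  have bern J : 1 + J%:R * eta <= g ^+ J.
    elim: J => [|J IH]; first by rewrite mul0r addr0.
    rewrite exprS; apply: le_trans (_ : g * (1 + J%:R * eta) <= _); last by rewrite ler_pM2l.
    have : 0 <= (J%:R : R) by [].
    by rewrite /g -natr1; move: e0; nra.
  exists (Num.bound (eta^-1 / eta)).
  rewrite -[leRHS]invrK lef_pV2 ?posrE ?invr_gt0 ?exprn_gt0 //.
  apply: le_trans (bern _); rewrite -natr1.
  have : eta^-1 / eta < (Num.bound (eta^-1 / eta))%:R.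
    by rewrite archi_boundP // divr_ge0 ?invr_ge0 ?(ltW e0).
  by rewrite ltr_pdivrMr // => h; move: e0; nra.
exists (g ^+ J.+1), (8 / (eta * eta)); split.
- by rewrite exprn_egt1.
- by rewrite divr_gt0 // mulr_gt0.
move=> l B hl hB.
have l0 : 0 < l by apply: lt_le_trans hl; rewrite divr_gt0 // mulr_gt0.
have h8 : 8 / (eta * l) <= eta.
  move: hl; rewrite ler_pdivrMr ?mulr_gt0 // => hl.
  by rewrite ler_pdivrMr ?mulr_gt0 //; have -> : eta * (eta * l) = l * (eta * eta) by ring.
have h80 : 0 <= 8 / (eta * l) by rewrite divr_ge0 // mulr_ge0 ?(ltW e0) ?(ltW l0).
have w0 : 0 <= g ^- J.+1 by rewrite invr_ge0 exprn_ge0 // ltW.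
have /andP[h1 h2] := sum_inv_p_lnp_geometric e0 l0 hB.
apply/andP; split.
  apply: le_trans h1; rewrite -/g [(g * l)^-1]invfM mulrA.
  rewrite ler_pM2r ?invr_gt0 // ler_pdivlMr //.
  move: hJ w0 h8 h80; set W := g ^- _; set X := 8 / _; rewrite /g => hJ w0 h8 h80.
  have -> : d = 4 * eta by rewrite /eta; field.
  have e1 : eta < 1 by rewrite /eta; lra.
  apply: le_trans (_ : (1 - eta) * (1 - eta) <= _); first by nra.
  by apply: ler_pM; lra.
apply: le_trans h2 _; rewrite ler_pM2r ?invr_gt0 //.
move: hJ w0 h8 h80; set W := g ^- _; set X := 8 / _; rewrite -/g => hJ w0 h8 h80.
have -> : d = 4 * eta by rewrite /eta; field.
have e1 : eta < 1 by rewrite /eta; lra.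
apply: le_trans (_ : (1 + eta) * 1 * g <= _); last by rewrite /g; nra.
rewrite ler_wpM2r ?(ltW g0) //.
by apply: ler_pM; lra.
Qed.

Lemma sum_ln_prime_divisors q B (P : pred nat) : (0 < q)%N ->
  (forall p, P p -> prime p && (p %| q)%N) ->
  \sum_(0 <= p < B | P p) ln (p%:R : R) <= ln (q%:R : R).
Proof.
move=> q0 HP; rewrite -ln_prod_natr; last by move=> p /HP /andP[/prime_gt0].
rewrite ler_ln ?posrE ?ltr0n //; last first.
  by rewrite prodn_cond_gt0 // => p /HP /andP[/prime_gt0].
by rewrite ler_nat dvdn_leq // prod_primes_dvdn_big.
Qed.

(** The terms are ln p / (p (ln p)^2), and the ln p of the prime divisors of [q] add up to at most
    ln q. For exp l = ln q the bound is 1 / l^2, of lower order than 1 / l. *)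
Lemma sum_inv_p_lnp_divisors q B (l K : R) : (0 < q)%N -> 0 < l ->
  \sum_(0 <= p < B | prime p && (l < ln (p%:R : R) <= K * l) && (p %| q)%N) (p%:R * ln (p%:R : R))^-1
  <= ln (q%:R : R) / (expR l * l ^+ 2).
Proof.
move=> q0 l0.
apply: (@le_trans _ _ (\sum_(0 <= p < B | prime p && (l < ln (p%:R : R) <= K * l) && (p %| q)%N)
   ln (p%:R : R) / (expR l * l ^+ 2))).
  apply: ler_sum => p /andP[/and3P[pp lp _] _].
  have p0 : 0 < (p%:R : R) by rewrite ltr0n prime_gt0.
  have lp0 := lt_trans l0 lp.
  have -> : (p%:R * ln p%:R)^-1 = ln p%:R / (p%:R * ln (p%:R : R) ^+ 2).
    by field; rewrite !gt_eqF.
  rewrite ler_pM2l // lef_pV2 ?posrE ?mulr_gt0 ?expR_gt0 ?exprn_gt0 //.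
  apply: ler_pM; rewrite ?expR_ge0 ?exprn_ge0 ?(ltW l0) //.
    by rewrite -[p%:R]lnK ?posrE // ler_expR ltW.
  by rewrite lerXn2r ?nnegrE ?(ltW l0) ?(ltW lp0) ?(ltW lp).
rewrite -mulr_suml ler_wpM2r ?invr_ge0 ?mulr_ge0 ?expR_ge0 ?exprn_ge0 ?(ltW l0) //.
apply: sum_ln_prime_divisors => // p /andP[/and3P[-> _ _] ->] //.
Qed.

Lemma ln2_ge : (2^-1 : R) <= ln 2.
Proof.
have := @le_ln1Dx R (- 2^-1); have -> : (1 + - 2^-1 : R) = 2^-1 by field.
rewrite lnV ?posrE //; lra.
Qed.

Lemma card_prime_divisors_le q B : (0 < q)%N ->
  (\sum_(0 <= p < B | prime p && (p %| q)%N) (1 : R)) <= 2 * ln (q%:R : R).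
Proof.
move=> q0; have h := @sum_ln_prime_divisors q B (fun p => prime p && (p %| q)%N) q0 (fun p h => h).
apply: le_trans (_ : 2 * \sum_(0 <= p < B | prime p && (p %| q)%N) ln (p%:R : R) <= _); last by rewrite ler_pM2l.
rewrite mulr_sumr; apply: ler_sum => p /andP[pp _].
have : ln 2 <= ln (p%:R : R) by rewrite ler_ln ?posrE ?ltr0n ?prime_gt0 // ler_nat prime_gt1.
have := ln2_ge; lra.
Qed.

(** Primes replace a sieve: by Mertens (n / c, n] contains at least n / (c ln q) of them, and at
    most 2 ln q primes divide [q]. *)
Lemma card_coprime_ge : exists2 c : nat, (0 < c)%N & forall q n : nat, (1 < q)%N -> (n <= q)%N ->
  4 * c%:R * ln (q%:R : R) ^+ 2 <= n%:R ->
  n%:R / (2 * c%:R * ln (q%:R : R)) <= (#|[set k : 'I_n | coprime k.+1 q]|%:R : R).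
Proof.
(* 7 = 3 + 3 + 1: two Mertens errors, and 1 left for the sum over (n / c, n]. *)
pose c := (Num.truncn (expR (7 : R))).+1; exists c => // q n q1 nq hn.
have c7 : expR 7 < (c%:R : R) by have /andP[] := truncn_itv (@expR_ge0 R 7).
have c0 : 0 < (c%:R : R) by rewrite ltr0n.
set L := ln (q%:R : R) in hn *.
have L0 : 2^-1 <= L by apply: le_trans ln2_ge _; rewrite ler_ln ?posrE ?ltr0n ?ler_nat ?(ltnW q1).
have L0' : 0 < L by lra.
have c1 : 1 <= (c%:R : R) by rewrite ler1n.
have ncr : c%:R <= (n%:R : R).
  apply: le_trans hn.
  have h4 : 1 <= 4 * L ^+ 2 by rewrite expr2; nra.
  have -> : 4 * c%:R * L ^+ 2 = c%:R * (4 * L ^+ 2) by ring.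
  by rewrite ler_peMr // ltW.
have n0 : (0 < n)%N by rewrite -(ltr0n R); lra.
pose m := (n %/ c)%N.
have m0 : (0 < m)%N by rewrite divn_gt0 // -(ler_nat R).
have mn : (m <= n)%N by rewrite leq_div.
have m0' : 0 < (m%:R : R) by rewrite ltr0n.
have n0' : 0 < (n%:R : R) by rewrite ltr0n.
pose s := \sum_(m.+1 <= p < n.+1 | prime p) ln (p%:R : R) / p%:R.
have hs : 1 <= s.
  have := mertens_first R n0; have := mertens_first R m0.
  have : mertens_sum R n = mertens_sum R m + s by rewrite /mertens_sum (big_cat_nat (n := m.+1)).
  have : 7 <= ln (n%:R : R) - ln m%:R.
    rewrite -ln_div ?posrE // -[7]expRK ler_ln ?posrE ?expR_gt0 ?divr_gt0 //.
    apply: le_trans (ltW c7) _; rewrite ler_pdivlMr // -natrM ler_nat mulnC.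
    exact: leq_trunc_div.
  by rewrite !ler_norml => h1 h2 /andP[h3 h4] /andP[h5 h6]; lra.
have np p : (m < p <= n)%N -> ln (p%:R : R) / p%:R <= c%:R * L / n%:R.
  move=> /andP[mp pn]; have p0 : (0 < p)%N by apply: leq_ltn_trans mp.
  have p0' : 0 < (p%:R : R) by rewrite ltr0n.
  rewrite ler_pdivrMr // mulrAC ler_pdivlMr //.
  have h1 : ln (p%:R : R) <= L by rewrite ler_ln ?posrE ?ltr0n ?ler_nat ?(ltnW q1) // (leq_trans pn nq).
  have h2 : (n%:R : R) <= c%:R * p%:R.
    rewrite -natrM ler_nat mulnC; apply: ltnW; apply: leq_trans (@ltn_ceil n c isT) _.
    by rewrite leq_mul2r; apply/orP; right.
  apply: le_trans (_ : L * n%:R <= _); first by rewrite ler_pM2r.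
  by rewrite [c%:R * L]mulrC -mulrA ler_pM2l.
have hp : n%:R / (c%:R * L) <= \sum_(m.+1 <= p < n.+1 | prime p) (1 : R).
  rewrite ler_pdivrMr ?mulr_gt0 //.
  have : s <= \sum_(m.+1 <= p < n.+1 | prime p) (c%:R * L / n%:R).
    by rewrite /s big_nat_cond [leRHS]big_nat_cond; apply: ler_sum => p /andP[/np].
  rewrite -[X in \sum_(_ <= _ < _ | _) X]mul1r -mulr_suml => hs2.
  by have := le_trans hs hs2; rewrite mulrA ler_pdivlMr // mul1r.
have hq : \sum_(m.+1 <= p < n.+1 | prime p) (1 : R) <=
   #|[set k : 'I_n | coprime k.+1 q]|%:R + 2 * L.
  apply: le_trans (_ : _ <= #|[set k : 'I_n | coprime k.+1 q]|%:R +
      \sum_(0 <= p < n.+1 | prime p && (p %| q)%N) 1) _; last first.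
    by rewrite lerD2l card_prime_divisors_le // ltnW.
  rewrite (bigID (fun p => p %| q)%N) /= addrC lerD //.
    have -> : (#|[set k : 'I_n | coprime k.+1 q]|%:R : R) = \sum_(1 <= p < n.+1 | coprime p q) 1.
      by rewrite big_add1 /= big_mkord -sum1_card natr_sum; apply: eq_bigl => k; rewrite inE.
    rewrite [leRHS](big_cat_nat (n := m.+1)) //=; apply: ler_wpDl; first by apply: sumr_ge0.
    rewrite big_mkcond [leRHS]big_mkcond; apply: ler_sum => p _.
    case: ifP => [/andP[pp pq]|_]; first by rewrite prime_coprime // pq.
    by case: ifP.
  by rewrite [leRHS](big_cat_nat (n := m.+1)) //=; apply: ler_wpDl; first by apply: sumr_ge0.
have h3 : n%:R / (c%:R * L) = 2 * (n%:R / (2 * c%:R * L)) :> R by field; rewrite !gt_eqF.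
suff : 2 * L <= n%:R / (2 * c%:R * L) by lra.
rewrite ler_pdivlMr ?mulr_gt0 //; apply: le_trans hn; rewrite le_eqVlt; apply/orP; left; apply/eqP; ring.
Qed.

End MertensBlocks.

(** * Sums over sets of primes *)

(** Lagrange's identity, in doubled form. *)
Lemma sum_cauchy_schwarz (R : realDomainType) (T : finType) (a b : T -> R) :
  (\sum_t a t * b t) ^+ 2 <= (\sum_t a t ^+ 2) * (\sum_t b t ^+ 2).
Proof.
have h : 0 <= \sum_s \sum_t (a s * b t - a t * b s) ^+ 2.
  by apply: sumr_ge0 => s _; apply: sumr_ge0 => t _; exact: sqr_ge0.
have E : \sum_s \sum_t (a s * b t - a t * b s) ^+ 2 =
  (\sum_t a t ^+ 2) * (\sum_t b t ^+ 2) * 2 - (\sum_t a t * b t) ^+ 2 * 2.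
  have -> : (\sum_t a t ^+ 2) * (\sum_t b t ^+ 2) = \sum_s \sum_t a s ^+ 2 * b t ^+ 2.
    by rewrite mulr_suml; apply: eq_bigr => s _; rewrite mulr_sumr.
  have -> : (\sum_t a t * b t) ^+ 2 = \sum_s \sum_t (a s * b s) * (a t * b t).
    by rewrite expr2 mulr_suml; apply: eq_bigr => s _; rewrite mulr_sumr.
  have -> : (\sum_s \sum_t a s ^+ 2 * b t ^+ 2) * 2 = \sum_s \sum_t (a s ^+ 2 * b t ^+ 2 + a t ^+ 2 * b s ^+ 2).
    under [RHS]eq_bigr => s _ do rewrite big_split /=.
    by rewrite big_split /= [X in _ = _ + X]exchange_big /= mulr2n mulrDr mulr1.
  rewrite mulr_suml -sumrB; apply: eq_bigr => s _.
  rewrite mulr_suml -sumrB; apply: eq_bigr => t _; ring.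
rewrite -(@ler_pM2r _ 2) //; lra.
Qed.

Lemma sum_sqr_le (R : realDomainType) J (b : 'I_J -> R) :
  (\sum_t b t) ^+ 2 <= J%:R * (\sum_t b t ^+ 2).
Proof.
have := sum_cauchy_schwarz (fun _ : 'I_J => 1) b.
rewrite (eq_bigr b) => [|t _]; last by rewrite mul1r.
suff -> : \sum_(t < J) (1 : R) ^+ 2 = J%:R by [].
by under eq_bigr => t _ do rewrite expr1n; rewrite sumr_const card_ord.
Qed.

(** The four memberships of i in A and B are independent for different i, so a multiplicative double
    sum is an Euler product. *)
Lemma sum_set2_prod (R : comPzRingType) (I : finType) (w : I -> bool -> bool -> R) :
  \sum_(A : {set I}) \sum_(B : {set I}) \prod_i w i (i \in A) (i \in B) =
  \prod_i (w i true true + w i true false + (w i false true + w i false false)).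
Proof.
have H (F : I -> bool -> R) : \sum_(B : {set I}) \prod_i F i (i \in B) = \prod_i (F i true + F i false).
  by rewrite bigA_distr; apply: eq_bigr => B _; apply: eq_bigr => i _; case: (i \in B).
rewrite (eq_bigr (fun A : {set I} => \prod_i (w i (i \in A) true + w i (i \in A) false))).
  by rewrite (H (fun i a => w i a true + w i a false)).
by move=> A _; rewrite (H (fun i b => w i (i \in A) b)).
Qed.

Lemma prod1D_le_exp (R : realType) (I : finType) (s e : I -> R) :
  (forall i, 0 <= s i) -> (forall i, 0 <= e i) ->
  \prod_i (1 + s i + e i) <= \prod_i (1 + s i) * expR (\sum_i e i).
Proof.
move=> s0 e0; rewrite expR_sum -big_split /=; apply: ler_prod => i _.
rewrite !addr_ge0 //=; apply: le_trans (_ : (1 + s i) * (1 + e i) <= _).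
  by have := mulr_ge0 (s0 i) (e0 i); lra.
by rewrite ler_wpM2l ?addr_ge0 // expR_ge1Dx.
Qed.

Lemma prod_ge_exp (R : realType) (I : finType) (s v : I -> R) (d : R) :
  (forall i, 0 <= s i) -> (forall i, 0 <= v i) -> (forall i, s i + v i <= d) -> 
  \prod_i (1 + s i) * expR ((\sum_i v i) / (1 + d)) <= \prod_i (1 + s i + v i).
Proof.
move=> s0 v0 hd; rewrite mulr_suml expR_sum -big_split /=; apply: ler_prod => i _.
have p0 : 0 < 1 + s i by have := s0 i; lra.
have q0 : 0 < 1 + s i + v i by have := v0 i; lra.
rewrite mulr_ge0 ?expR_ge0 ?(ltW p0) //=.
(* 1 + u >= expR (u / (1 + u)), from expR (- t) >= 1 - t at t = u / (1 + u). *)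
have t1 : expR (v i / (1 + d)) <= expR (v i / (1 + s i + v i)).
  rewrite ler_expR ler_wpM2l // lef_pV2 ?posrE //; have := hd i; have := s0 i; have := v0 i; lra.
apply: le_trans (ler_wpM2l (ltW p0) t1) _.
have := expR_ge1Dx (- (v i / (1 + s i + v i))); rewrite expRN.
have -> : 1 - v i / (1 + s i + v i) = (1 + s i) / (1 + s i + v i) by field; rewrite gt_eqF.
by rewrite ler_pdivrMr // mulrC ler_pdivlMr ?expR_gt0 // mulrC.
Qed.

Section Resonator.
Variables (R : realType) (I : finType) (p : I -> nat) (r : I -> R).
Hypothesis p_prime : forall i, prime (p i).
Hypothesis p_inj : injective p.
Hypothesis r_ge0 : forall i, 0 <= r i.
Implicit Types A B D E : {set I}.

(** A squarefree integer is represented by the set of its prime factors: divisibility becomes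
    inclusion and the gcd intersection. *)
Definition pprod A : nat := (\prod_(i in A) p i)%N.
Definition rprod A : R := \prod_(i in A) r i.

Lemma pprod_gt0 A : (0 < pprod A)%N.
Proof. by apply: prodn_cond_gt0 => i _; exact: prime_gt0. Qed.

Lemma rprod_ge0 A : 0 <= rprod A.
Proof. by apply: prodr_ge0. Qed.

Lemma coprime_pprod A B : [disjoint A & B] -> coprime (pprod A) (pprod B).
Proof.
move=> dAB; apply: (big_ind (fun k => coprime k (pprod B))) => [|j k cj ck|i iA].
- exact: coprime1n.
- by rewrite coprimeMl cj.
apply: (big_ind (fun k => coprime (p i) k)) => [|j k cj ck|j jB].
- exact: coprimen1.
- by rewrite coprimeMr cj.
rewrite prime_coprime // dvdn_prime2 //; apply: contraTneq dAB => /p_inj e.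
by apply/pred0Pn; exists i; rewrite /= iA e.
Qed.

Lemma dvdn_pprod i A : (p i %| pprod A)%N = (i \in A).
Proof.
apply/idP/idP => [|iA]; last by rewrite /pprod (bigD1 i) //= dvdn_mulr.
apply: contraTT => iA; rewrite -prime_coprime //.
have -> : p i = pprod [set i] by rewrite /pprod finset.big_set1.
by apply: coprime_pprod; rewrite disjoints1.
Qed.

Lemma pprod_inj : injective pprod.
Proof. by move=> A B e; apply/finset.setP => i; rewrite -!dvdn_pprod e. Qed.

Lemma pprodID A B : pprod A = (pprod (A :&: B) * pprod (A :\: B))%N.
Proof. by rewrite /pprod (big_setID B). Qed.

Lemma pprodU A B : B \subset A -> pprod A = (pprod B * pprod (A :\: B))%N.
Proof. by move=> /finset.setIidPr e; rewrite (pprodID A B) e. Qed.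

Lemma pprod_subset A B : A \subset B -> (pprod A <= pprod B)%N.
Proof. by move=> /pprodU ->; rewrite leq_pmulr // pprod_gt0. Qed.

Lemma ln_pprod A : ln ((pprod A)%:R : R) = \sum_(i in A) ln ((p i)%:R : R).
Proof.
pose K (x : nat) (y : R) := (0 < x)%N /\ ln (x%:R : R) = y.
suff [] : K (pprod A) (\sum_(i in A) ln ((p i)%:R : R)) by [].
apply: (big_ind2 K); first by split => //; rewrite ln1.
- move=> x1 x2 y1 y2 [p1 <-] [p2 <-]; split; first by rewrite muln_gt0 p1.
  by rewrite natrM lnM ?posrE ?ltr0n.
- by move=> i Pi; split => //; exact: prime_gt0.
Qed.

(* If n = pprod A and m = pprod B, then n / m in lowest terms is
   pprod (A :\: B) / pprod (B :\: A), of height hgt A B. *)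
Definition hgt A B : nat := maxn (pprod (A :\: B)) (pprod (B :\: A)).

Lemma hgt_gt0 A B : (0 < hgt A B)%N.
Proof. by rewrite leq_max pprod_gt0. Qed.

Lemma sum_rprod_sqr : \sum_A rprod A ^+ 2 = \prod_i (1 + r i ^+ 2).
Proof.
under [RHS]eq_bigr => i _ do rewrite addrC.
rewrite bigA_distr; apply: eq_bigr => A _.
by rewrite /rprod -prodrXl big_mkcond.
Qed.

(** Complementation in [E] turns the sum into one over divisors; dropping the inclusion leaves an
    Euler product. *)
Lemma sum_inv_pprod_le E :
  \sum_(D : {set I} | D \subset E) ((pprod (E :\: D))%:R)^-1 <= expR (\sum_i ((p i)%:R)^-1) :> R.
Proof.
have -> : \sum_(D : {set I} | D \subset E) ((pprod (E :\: D))%:R)^-1 =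
          \sum_(D : {set I} | D \subset E) ((pprod D)%:R)^-1 :> R.
  have K (D : {set I}) : D \subset E -> E :\: (E :\: D) = D.
    by move=> /finset.setIidPr e; rewrite finset.setDDr finset.setDv finset.set0U.
  rewrite (reindex_onto (fun D => E :\: D) (fun D => E :\: D)) /= => [|D /K //].
  apply: eq_big => [D|D /andP[_ /eqP ->] //].
  rewrite finset.subsetDl /=; apply/eqP/idP => [<-|/K //]; exact: finset.subsetDl.
apply: (@le_trans _ _ (\sum_D ((pprod D)%:R)^-1)).
  by rewrite big_mkcond; apply: ler_sum => D _; case: ifP => // _; rewrite invr_ge0.
have -> : \sum_D ((pprod D)%:R)^-1 = \prod_i (1 + ((p i)%:R)^-1) :> R.
  under [RHS]eq_bigr => i _ do rewrite addrC.
  rewrite bigA_distr; apply: eq_bigr => A _.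
  rewrite /pprod natr_prod -prodfV big_mkcond.
  by apply: eq_bigr => i _; case: ifP => //; rewrite invr1.
rewrite expR_sum; apply: ler_prod => i _; rewrite expR_ge1Dx andbT.
by rewrite addr_ge0 // invr_ge0.
Qed.

Variables (x M0 : R) (J : nat).
Hypothesis xJ : x < (2 ^ J)%:R.

(** Dyadic by [trunc_log]; as x < 2^J, each n <= x lies in exactly one of the [J] windows. *)
Definition window (j : 'I_J) : {set {set I}} :=
  [set A | ((pprod A)%:R <= x) && (trunc_log 2 (pprod A) == j :> nat)].

(** Two members of a window differ by a factor less than 2, and the common factor cancels. *)
Lemma window_pprod_lt j A B : A \in window j -> B \in window j ->
  (pprod (A :\: B) < 2 * pprod (B :\: A))%N.
Proof.
rewrite !inE => /andP[_ /eqP hA] /andP[_ /eqP hB].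
have := trunc_log_bounds (erefl : 1 < 2)%N (pprod_gt0 A); rewrite hA => /andP[_ h1].
have := trunc_log_bounds (erefl : 1 < 2)%N (pprod_gt0 B); rewrite hB => /andP[h2 _].
have : (pprod A < 2 * pprod B)%N.
  by apply: leq_trans h1 _; rewrite expnS leq_mul2l h2.
rewrite (pprodID A B) (pprodID B A) finset.setIC mulnCA ltn_mul2l => /andP[] //.
Qed.

Lemma window_inv_sqrt_le j A B : A \in window j -> B \in window j ->
  (Num.sqrt (pprod (A :\: B))%:R * Num.sqrt (pprod (B :\: A))%:R)^-1 <=
  2 * ((hgt A B)%:R)^-1 :> R.
Proof.
move=> hA hB; have h1 := window_pprod_lt hA hB; have h2 := window_pprod_lt hB hA.
set a := pprod (A :\: B) in h1 h2 *; set b := pprod (B :\: A) in h1 h2 *.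
have a0 : 0 < (a%:R : R) by rewrite ltr0n pprod_gt0.
have b0 : 0 < (b%:R : R) by rewrite ltr0n pprod_gt0.
have m0 : 0 < ((hgt A B)%:R : R) by rewrite ltr0n hgt_gt0.
rewrite -[2]invrK -invfM lef_pV2 ?posrE ?mulr_gt0 ?invr_gt0 ?sqrtr_gt0 //.
rewrite -sqrtrM ?(ltW a0) // -[leLHS]ger0_norm; last by rewrite mulr_ge0 ?invr_ge0 ?(ltW m0).
rewrite -sqrtr_sqr ler_wsqrtr // exprMn exprVn ler_pdivrMl ?exprn_gt0 //.
rewrite -natrX -!natrM -natrX -natrM ler_nat /hgt -/a -/b /maxn; case: ifP; nia.
Qed.

Definition Vsum j : R :=
  \sum_(A in window j) \sum_(B in window j | (hgt A B)%:R <= M0) rprod A * rprod B / (hgt A B)%:R.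

(** The inner part of the linear sum at k = [pprod D], restricted to one window. Its square expands
    into pairs A, B containing D. *)
Let T j D : R :=
  \sum_(A in window j | (D \subset A) && ((pprod (A :\: D))%:R <= M0)) rprod A / Num.sqrt (pprod (A :\: D))%:R.

(** For D inside A and B, both quotients by D contain [pprod ((A :&: B) :\: D)], so the weight is 1
    / sqrt(ab) times the inverse of that integer, and the sum over D costs a constant. In a window 1
    / sqrt(ab) is at most twice the inverse of the height. *)
Lemma sum_T_sqr_le j :
  \sum_D T j D ^+ 2 <= 2 * expR (\sum_i ((p i)%:R)^-1) * Vsum j.
Proof.
set C := expR _.
have E : \sum_D T j D ^+ 2 = \sum_(A in window j) \sum_(B in window j) rprod A * rprod B *
   \sum_(D : {set I} | [&& D \subset A, (pprod (A :\: D))%:R <= M0, D \subset B & (pprod (B :\: D))%:R <= M0])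
     (Num.sqrt (pprod (A :\: D))%:R * Num.sqrt (pprod (B :\: D))%:R)^-1.
  pose t (D A : {set I}) : R := if (D \subset A) && ((pprod (A :\: D))%:R <= M0)
     then rprod A / Num.sqrt (pprod (A :\: D))%:R else 0.
  transitivity (\sum_D \sum_(A in window j) \sum_(B in window j) t D A * t D B).
    apply: eq_bigr => D _; rewrite /T expr2 big_mkcondr /= mulr_suml.
    by apply: eq_bigr => A _; rewrite mulr_sumr.
  rewrite /t exchange_big /=; apply: eq_bigr => A _.
  rewrite exchange_big /=; apply: eq_bigr => B _.
  rewrite mulr_sumr [RHS]big_mkcond /=; apply: eq_bigr => D _.
  case: (D \subset A) => /=; rewrite ?mul0r //.
  case: (_ <= M0) => /=; rewrite ?mul0r //.
  case: ifP => _; rewrite ?mulr0 //.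
  by rewrite invfM mulrACA.
rewrite E /Vsum mulr_sumr; apply: ler_sum => A hA.
rewrite mulr_sumr [leRHS]big_mkcondr; apply: ler_sum => B hB.
have r0 : 0 <= rprod A * rprod B by rewrite mulr_ge0 ?rprod_ge0.
(* The two truncations at [M0] force the height below [M0], so that higher pairs do not occur. *)
case: ifP => hM; last first.
  rewrite big1 ?mulr0 // => D /and4P[DA hA' DB hB'].
  suff : ((hgt A B)%:R <= M0) by rewrite hM.
  rewrite /hgt /maxn; case: ifP => _.
    by apply: le_trans hB'; rewrite ler_nat pprod_subset // finset.setDS.
  by apply: le_trans hA'; rewrite ler_nat pprod_subset // finset.setDS.
rewrite [leRHS]mulrC -!mulrA ler_wpM2l //; first by rewrite rprod_ge0.
rewrite ler_wpM2l //; first by rewrite rprod_ge0.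
rewrite mulrA [_^-1 * 2]mulrC.
apply: le_trans (_ : (Num.sqrt (pprod (A :\: B))%:R * Num.sqrt (pprod (B :\: A))%:R)^-1 * C <= _); last first.
  by rewrite ler_wpM2r ?expR_ge0 // (window_inv_sqrt_le hA hB).
apply: le_trans (ler_wpM2l _ (sum_inv_pprod_le (A :&: B))); last first.
  by rewrite invr_ge0 mulr_ge0 ?sqrtr_ge0.
rewrite mulr_sumr big_mkcond [leRHS]big_mkcond; apply: ler_sum => D _.
case: ifP => [/and4P[DA _ DB _]|_]; last first.
  by case: ifP => // _; rewrite mulr_ge0 ?invr_ge0 ?mulr_ge0 ?sqrtr_ge0.
have DAB : D \subset A :&: B by rewrite finset.subsetI DA.
rewrite DAB -invfM.
have eA : pprod (A :\: D) = (pprod (A :\: B) * pprod ((A :&: B) :\: D))%N.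
  rewrite (pprodID (A :\: D) B) mulnC; congr (pprod _ * pprod _)%N.
    apply/finset.setP => i; rewrite !inE; case iD : (i \in D) => //=; rewrite ?andbF //.
    by rewrite (fintype.subsetP DB i iD).
  by apply/finset.setP => i; rewrite !inE andbA.
have eB : pprod (B :\: D) = (pprod (B :\: A) * pprod ((A :&: B) :\: D))%N.
  rewrite (pprodID (B :\: D) A) mulnC; congr (pprod _ * pprod _)%N.
    apply/finset.setP => i; rewrite !inE; case iD : (i \in D) => //=; rewrite ?andbF //.
    by rewrite (fintype.subsetP DA i iD).
  by apply/finset.setP => i; rewrite !inE -andbA [(i \in B) && _]andbC.
rewrite eA eB !natrM !sqrtrM ?ler0n //.
set u := Num.sqrt (pprod ((A :&: B) :\: D))%:R.
have -> : ((pprod ((A :&: B) :\: D))%:R : R) = u * u by rewrite -expr2 sqr_sqrtr.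
by rewrite mulrACA.
Qed.

(* With k = pprod D and m = pprod (A :\: D), the sum of r(k) r(k m) / sqrt m over
   k m <= x and m <= M0. *)
Definition linsum : R :=
  \sum_(D : {set I}) \sum_(A : {set I} | [&& D \subset A, (pprod A)%:R <= x & (pprod (A :\: D))%:R <= M0])
     rprod D * rprod A / Num.sqrt (pprod (A :\: D))%:R.

(** Cauchy-Schwarz is used twice: over D, which produces the norm of r, and over the [J] windows. *)
Lemma linsum_sqr_le :
  linsum ^+ 2 <= \prod_i (1 + r i ^+ 2) *
     (J%:R * (2 * expR (\sum_i ((p i)%:R)^-1) * \sum_j Vsum j)).
Proof.
have -> : linsum = \sum_D rprod D * \sum_j T j D.
  apply: eq_bigr => D _; rewrite mulr_sumr.
  have hw A : (pprod A)%:R <= x -> (trunc_log 2 (pprod A) < J)%N.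
    move=> hA; have := trunc_log_bounds (erefl : 1 < 2)%N (pprod_gt0 A) => /andP[h1 _].
    rewrite -(@ltn_exp2l 2) //; apply: leq_ltn_trans h1 _.
    by rewrite -(ltr_nat R); apply: le_lt_trans hA xJ.
  under [RHS]eq_bigr => j _.
    rewrite /T mulr_sumr big_mkcond /=.
    over.
  rewrite exchange_big /= big_mkcond; apply: eq_bigr => A _ /=.
  case: ifP => [/and3P[DA hA hD]|h].
    rewrite (bigD1 (Ordinal (hw A hA))) //= big1 ?addr0.
      by rewrite inE hA eqxx DA hD /= mulrA.
    move=> j jn; rewrite inE hA /=; case: ifP => // /andP[/eqP e _].
    by move: jn; rewrite -val_eqE /= e eqxx.
  apply/esym; apply: big1 => j _; rewrite inE; case: ifP => // /andP[/andP[hA _] /andP[DA hD]].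
  by rewrite DA hA hD in h.
apply: le_trans (sum_cauchy_schwarz _ _) _.
rewrite sum_rprod_sqr ler_wpM2l //.
  by apply: prodr_ge0 => i _; rewrite addr_ge0 ?sqr_ge0.
apply: le_trans (_ : \sum_D J%:R * \sum_j T j D ^+ 2 <= _).
  by apply: ler_sum => D _; exact: sum_sqr_le.
rewrite -mulr_sumr ler_wpM2l // exchange_big /= mulr_sumr.
by apply: ler_sum => j _; exact: sum_T_sqr_le.
Qed.

End Resonator.

(** Each i lies outside A, in D, or in A minus D, with weights 1, [a i], [b i]. *)
Lemma sum_nested_prod (R : comPzRingType) (I : finType) (a b : I -> R) :
  \sum_(D : {set I}) \sum_(A : {set I} | D \subset A)
     (\prod_(i in D) a i * \prod_(i in A :\: D) b i) = \prod_i (1 + a i + b i).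
Proof.
pose w i (d e : bool) := if e then (if d then a i else b i) else (if d then 0 else 1).
have -> : \prod_i (1 + a i + b i) = \prod_i (w i true true + w i true false + (w i false true + w i false false)).
  by apply: eq_bigr => i _; rewrite /w /= addr0 [b i + 1]addrC addrCA addrA.
rewrite -sum_set2_prod; apply: eq_bigr => D _.
rewrite big_mkcond; apply: eq_bigr => A _; case: ifP => [DA|/negP DA].
  rewrite big_mkcond [X in _ * X]big_mkcond -big_split /=; apply: eq_bigr => i _.
  rewrite /w inE; case iD : (i \in D) => /=.
    by rewrite (fintype.subsetP DA i iD) mulr1.
  by case: (i \in A); rewrite mul1r.
have /subsetPn [i iD iA] := introN idP DA.
by rewrite (bigD1 i) //= /w iD (negPf iA) mul0r.
Qed.

(** * Rankin's trick for the truncations *)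

Section Rankin.
Variables (R : realType) (I : finType) (p : I -> nat) (r : I -> R).
Hypothesis p_prime : forall i, prime (p i).
Hypothesis r_ge0 : forall i, 0 <= r i.
Implicit Types A B D : {set I}.

Let v i : R := r i / Num.sqrt (p i)%:R.
Let lp i : R := ln ((p i)%:R : R).

Let v_ge0 i : 0 <= v i.
Proof. by rewrite divr_ge0 ?sqrtr_ge0. Qed.

Let lp_ge0 i : 0 <= lp i.
Proof. by rewrite ln_ge0 // ler1n prime_gt0. Qed.

Lemma sqrt_pprod A : Num.sqrt (pprod p A)%:R = \prod_(i in A) Num.sqrt ((p i)%:R : R).
Proof.
apply: (big_ind2 (fun (x : nat) (y : R) => Num.sqrt x%:R = y)) => [|x1 x2 y1 y2 <- <-|//].
  by rewrite sqrtr1.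
by rewrite natrM sqrtrM.
Qed.

Lemma linsum_termE D A : D \subset A ->
  rprod r D * rprod r A / Num.sqrt (pprod p (A :\: D))%:R =
  \prod_(i in D) (r i ^+ 2) * \prod_(i in A :\: D) v i.
Proof.
move=> DA; have -> : rprod r A = rprod r D * rprod r (A :\: D).
  by rewrite /rprod (big_setID D) /= (finset.setIidPr DA).
rewrite mulrA -mulrA prodrXl expr2; congr (_ * _).
by rewrite sqrt_pprod -prodf_div.
Qed.

Lemma expR_ln_pprod (al : R) A :
  \prod_(i in A) expR (al * lp i) = expR (al * ln ((pprod p A)%:R : R)).
Proof. by rewrite ln_pprod // mulr_sumr expR_sum. Qed.

Variables (x M0 al : R).
Hypotheses (x0 : 0 < x) (M00 : 0 < M0) (al0 : 0 <= al).
Let y i := expR (al * lp i).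

Let y_ge1 i : 1 <= y i.
Proof. by rewrite -expR0 ler_expR mulr_ge0. Qed.

(** The indicator of n > z is at most (n / z)^al. *)
Lemma rankin_indicator z A : 0 < z ->
  (~~ ((pprod p A)%:R <= z))%:R <= expR (- al * ln z) * \prod_(i in A) y i.
Proof.
move=> z0; rewrite expR_ln_pprod -expRD.
case: (leP (pprod p A)%:R z) => h; rewrite /= ?expR_ge0 //.
apply: (@le_trans _ _ (expR 0)); [by rewrite expR0|rewrite ler_expR]; rewrite mulNr addrC -mulrBr mulr_ge0 // subr_ge0.
have n0 : 0 < ((pprod p A)%:R : R) by rewrite ltr0n pprod_gt0.
by rewrite ler_ln ?posrE //; exact: ltW.
Qed.

(** Without truncation the linear sum is the Euler product [Tot]; the terms with k m > x and those
    with m > M0 are subtracted separately, which at worst removes some of them twice. *)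
Lemma linsum_ge :
  let Tot := \prod_i (1 + r i ^+ 2 + v i) in
  Tot * (1 - expR (\sum_i (y i - 1) * (r i ^+ 2 + v i) - al * ln x)
           - expR (\sum_i (y i - 1) * v i - al * ln M0)) <= linsum p r x M0.
Proof.
set Tot := \prod_i _; cbv zeta.
pose F D A := \prod_(i in D) (r i ^+ 2) * \prod_(i in A :\: D) v i.
have F0 D A : 0 <= F D A.
  by rewrite mulr_ge0 //; apply: prodr_ge0 => i _; rewrite ?sqr_ge0.
have TotE : Tot = \sum_(D : {set I}) \sum_(A : {set I} | D \subset A) F D A.
  by rewrite sum_nested_prod.
have TotE' : Tot = \prod_i (1 + (r i ^+ 2 + v i)) by apply: eq_bigr => i _; rewrite addrA.
have p1 i : 0 <= (y i - 1) * (r i ^+ 2 + v i).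
  by rewrite mulr_ge0 ?subr_ge0 ?addr_ge0 ?sqr_ge0.
have p2 i : 0 <= (y i - 1) * v i by rewrite mulr_ge0 ?subr_ge0.
have T1 : \sum_(D : {set I}) \sum_(A : {set I} | D \subset A) F D A * (~~ ((pprod p A)%:R <= x))%:R
   <= Tot * expR (\sum_i (y i - 1) * (r i ^+ 2 + v i) - al * ln x).
  apply: le_trans (_ : expR (- al * ln x) * \prod_i (1 + r i ^+ 2 * y i + v i * y i) <= _).
    rewrite -sum_nested_prod mulr_sumr; apply: ler_sum => D _.
    rewrite mulr_sumr; apply: ler_sum => A DA.
    have -> : \prod_(i in D) (r i ^+ 2 * y i) * \prod_(i in A :\: D) (v i * y i) = F D A * \prod_(i in A) y i.
      by rewrite big_split [X in _ * X = _]big_split /= mulrACA [\prod_(i in A) y i](big_setID D) /= (finset.setIidPr DA).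
    by rewrite mulrCA ler_wpM2l // rankin_indicator.
  set S := \sum_i _; have -> : expR (S - al * ln x) = expR (- al * ln x) * expR S.
    by rewrite -expRD mulNr addrC.
  rewrite mulrCA ler_wpM2l ?expR_ge0 // TotE'.
  apply: le_trans (prod1D_le_exp _ p1) => [|i]; last by rewrite addr_ge0 ?sqr_ge0.
  rewrite le_eqVlt; apply/orP; left; apply/eqP; apply: eq_bigr => i _; ring.
have T2 : \sum_(D : {set I}) \sum_(A : {set I} | D \subset A) F D A * (~~ ((pprod p (A :\: D))%:R <= M0))%:R
   <= Tot * expR (\sum_i (y i - 1) * v i - al * ln M0).
  apply: le_trans (_ : expR (- al * ln M0) * \prod_i (1 + r i ^+ 2 + v i * y i) <= _).
    rewrite -sum_nested_prod mulr_sumr; apply: ler_sum => D _.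
    rewrite mulr_sumr; apply: ler_sum => A DA.
    have -> : \prod_(i in D) (r i ^+ 2) * \prod_(i in A :\: D) (v i * y i) = F D A * \prod_(i in A :\: D) y i.
      by rewrite [X in _ * X = _]big_split /= mulrA.
    by rewrite mulrCA ler_wpM2l // rankin_indicator.
  set S := \sum_i _; have -> : expR (S - al * ln M0) = expR (- al * ln M0) * expR S.
    by rewrite -expRD mulNr addrC.
  rewrite mulrCA ler_wpM2l ?expR_ge0 // TotE'.
  apply: le_trans (prod1D_le_exp _ p2) => [|i]; last by rewrite addr_ge0 ?sqr_ge0.
  rewrite le_eqVlt; apply/orP; left; apply/eqP; apply: eq_bigr => i _; ring.
rewrite mulrBr mulrBr mulr1 -addrA -opprD lerBlDr.
apply: le_trans (lerD (lexx _) (lerD T1 T2)).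
rewrite -big_split /= /linsum -big_split /= {1}TotE; apply: ler_sum => D _.
rewrite -big_split /= [X in _ <= X + _]big_mkcondr -big_split /=; apply: ler_sum => A DA.
rewrite linsum_termE // -/(F D A) -mulrDr.
have := F0 D A.
by case: ((pprod p A)%:R <= x); case: ((pprod p (A :\: D))%:R <= M0) => /=; lra.
Qed.

(* For hgt > M0, hgt^-1 <= M0^-al * hgt^(al - 1), and hgt is at least the
   geometric mean of pprod (A :\: B) and pprod (B :\: A). *)
Lemma hgt_tail_le : al <= 1 ->
  \sum_(A : {set I}) \sum_(B : {set I} | M0 < (hgt p A B)%:R) rprod r A * rprod r B / (hgt p A B)%:R <=
  \prod_i (1 + r i ^+ 2) * expR (2 * \sum_i v i * expR (al / 2 * lp i) - al * ln M0).
Proof.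
move=> al1.
(* Each prime of the symmetric difference carries p^(-(1 - al) / 2), which bounds hgt^(al - 1) by a
   multiplicative weight. *)
pose u i := expR (- ((1 - al) / 2) * lp i).
have uE i : r i * u i = v i * expR (al / 2 * lp i).
  rewrite /v -mulrA; congr (_ * _).
  have -> : Num.sqrt (p i)%:R = expR (lp i / 2).
    have p0 : 0 < ((p i)%:R : R) by rewrite ltr0n prime_gt0.
    rewrite -{1}[(p i)%:R]lnK ?posrE // -/(lp i) -[X in expR X](_ : lp i / 2 * 2%:R = _); last by field.
    by rewrite expRM_natr sqrtr_sqr ger0_norm ?expR_ge0.
  by rewrite -expRN -expRD; congr expR; field.
apply: le_trans (_ : expR (- al * ln M0) * \prod_i (1 + r i ^+ 2 + 2 * (v i * expR (al / 2 * lp i))) <= _); last first.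
  rewrite addrC expRD mulrCA mulNr ler_wpM2l ?expR_ge0 //.
  rewrite mulr_sumr; apply: prod1D_le_exp => i; rewrite ?sqr_ge0 //.
  by rewrite !mulr_ge0 ?expR_ge0.
pose w i (a b : bool) := if a then (if b then r i ^+ 2 else r i * u i) else (if b then r i * u i else 1).
have -> : \prod_i (1 + r i ^+ 2 + 2 * (v i * expR (al / 2 * lp i))) =
   \prod_i (w i true true + w i true false + (w i false true + w i false false)).
  by apply: eq_bigr => i _; rewrite /w -uE; ring.
rewrite -sum_set2_prod mulr_sumr; apply: ler_sum => A _.
have wE B : \prod_i w i (i \in A) (i \in B) =
   rprod r A * rprod r B * (\prod_(i in A :\: B) u i * \prod_(i in B :\: A) u i).
  rewrite /rprod [\prod_(i in A) _]big_mkcond [\prod_(i in B) _]big_mkcond.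
  rewrite [\prod_(i in A :\: B) _]big_mkcond [\prod_(i in B :\: A) _]big_mkcond.
  rewrite -!big_split /=; apply: eq_bigr => i _.
  rewrite /w !inE; case: (i \in A); case: (i \in B) => /=; rewrite ?mulr1 ?mul1r ?expr2 //.
rewrite mulr_sumr big_mkcond; apply: ler_sum => B _; rewrite wE.
have rr0 : 0 <= rprod r A * rprod r B by rewrite mulr_ge0 // rprod_ge0.
have pg := pprod_gt0 p_prime.
have u1 (X : {set I}) : \prod_(i in X) u i = expR (- ((1 - al) / 2) * ln ((pprod p X)%:R : R)).
  exact: expR_ln_pprod.
rewrite !u1 -expRD.
case: ifP => [hM|_]; last by rewrite !mulr_ge0 ?expR_ge0 // rprod_ge0.
rewrite mulrCA ler_wpM2l // -expRD.
have h0 : 0 < ((hgt p A B)%:R : R) by rewrite ltr0n hgt_gt0.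
rewrite -[(hgt p A B)%:R in leLHS]lnK ?posrE // -expRN ler_expR.
have h1 : ln M0 <= ln ((hgt p A B)%:R : R) by rewrite ler_ln ?posrE // ltW.
have h2 : ln ((pprod p (A :\: B))%:R : R) <= ln ((hgt p A B)%:R : R).
  by rewrite ler_ln ?posrE ?ltr0n ?hgt_gt0 // ler_nat leq_maxl.
have h3 : ln ((pprod p (B :\: A))%:R : R) <= ln ((hgt p A B)%:R : R).
  by rewrite ler_ln ?posrE ?ltr0n ?hgt_gt0 // ler_nat leq_maxr.
have := ler_wpM2l al0 h1.
have al1' : 0 <= 1 - al by rewrite subr_ge0.
have := ler_wpM2l al1' h2; have := ler_wpM2l al1' h3; lra.
Qed.

End Rankin.

(** * The resonance inequalities *)

Section Windows.
Variables (R : realType) (I : finType) (p : I -> nat) (r : I -> R).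
Hypothesis p_prime : forall i, prime (p i).
Hypothesis p_inj : injective p.
Hypothesis r_ge0 : forall i, 0 <= r i.
Implicit Types A B D : {set I}.
Variable q : nat.
Hypothesis q_gt1 : (1 < q)%N.
Hypothesis p_ndvd : forall i, ~~ (p i %| q)%N.
Variables (x : R) (J : nat).
Hypothesis x_lt_q : x < q%:R.

Local Notation window := (@window R I p x J).
Local Notation pprod := (pprod p).
Local Notation rprod := (rprod r).
Local Notation hgt := (hgt p).

Lemma coprime_pprod_q A : coprime (pprod A) q.
Proof.
apply: (big_ind (fun k => coprime k q)) => [|j k cj ck|i iA].
- exact: coprime1n.
- by rewrite coprimeMl cj.
- by rewrite prime_coprime.
Qed.

Lemma window_lt_q j A : A \in window j -> (pprod A < q)%N.
Proof. by rewrite inE -(ltr_nat R) => /andP[h _]; exact: le_lt_trans h x_lt_q. Qed.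

Definition solutions (K : nat) (A B : {set I}) : {set 'I_K * 'I_K} :=
  [set u : 'I_K * 'I_K | [&& coprime u.1.+1 q, coprime u.2.+1 q &
       u.1.+1 * pprod A == u.2.+1 * pprod B %[mod q]]].

Lemma Delta_window (N : R) j :
  (totient q)%:R * (\sum_(A in window j) \sum_(B in window j) rprod A * rprod B *
    #|solutions (Num.truncn N) A B|%:R)
  - (#|[set k : 'I_(Num.truncn N) | coprime k.+1 q]|%:R * \sum_(A in window j) rprod A) ^+ 2
  <= Delta N q ^+ 2 * ((totient q)%:R * \sum_(A in window j) rprod A ^+ 2).
Proof.
pose T : finType := {A : {set I} | A \in window j}.
have cop (t : T) : coprime (pprod (val t)) q by exact: coprime_pprod_q.
have inj (t t' : T) : pprod (val t) = pprod (val t') %[mod q] -> t = t'.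
  rewrite !modn_small; first by move=> /(pprod_inj p_prime p_inj) /val_inj.
    exact: window_lt_q (valP t').
  exact: window_lt_q (valP t).
have := Delta_resonance N (fun t : T => rprod (val t)) q_gt1 cop inj.
have eS (F : {set I} -> R) : \sum_(A in window j) F A = \sum_(t : T) F (val t).
  exact: big_sub.
rewrite !eS; congr (_ * _ - _ <= _).
by apply: eq_bigr => t _; rewrite eS.
Qed.

Lemma card_window_le j : 0 <= x -> #|window j|%:R <= x.
Proof.
move=> x0; apply: le_trans (_ : (Num.truncn x)%:R <= _); last first.
  by have /andP[] := truncn_itv x0.
rewrite ler_nat.
have h A : A \in window j -> ((pprod A).-1 < Num.truncn x)%N.
  rewrite inE => /andP[hA _]; rewrite prednK ?pprod_gt0 //.
  by rewrite truncn_ge_nat.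
case E : (Num.truncn x) => [|m].
  rewrite leqn0 cards_eq0 -finset.subset0; apply/fintype.subsetP => A /h; by rewrite E.
pose f A : 'I_m.+1 := inord (pprod A).-1.
have inj : {in window j &, injective f}.
  move=> A B hA hB /(congr1 val) /=; rewrite !inordK -?E ?h // => /(congr1 S).
  by rewrite !prednK ?pprod_gt0 //; exact: pprod_inj.
by rewrite -(card_in_imset inj) (leq_trans (max_card _)) // card_ord.
Qed.

(** This bounds the contribution of the principal character; a window has at most x members because
    [pprod] is injective. *)
Lemma sum_window_sqr_le j : 0 <= x ->
  (\sum_(A in window j) rprod A) ^+ 2 <= x * \sum_(A in window j) rprod A ^+ 2.
Proof.
move=> x0.
have := sum_cauchy_schwarz (fun A => (A \in window j)%:R : R) (fun A => (A \in window j)%:R * rprod A).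
have e1 : \sum_A (A \in window j)%:R * ((A \in window j)%:R * rprod A) = \sum_(A in window j) rprod A.
  by rewrite [RHS]big_mkcond; apply: eq_bigr => A _; case: ifP => _; rewrite ?mul0r // !mul1r.
have e2 : \sum_A ((A \in window j)%:R * rprod A) ^+ 2 = \sum_(A in window j) rprod A ^+ 2.
  rewrite [RHS]big_mkcond; apply: eq_bigr => A _.
  by case: ifP => _; rewrite ?mul0r ?expr0n // mul1r.
have e3 : \sum_A ((A \in window j)%:R : R) ^+ 2 = #|window j|%:R.
  rewrite -sum1_card natr_sum [RHS]big_mkcond; apply: eq_bigr => A _.
  by case: ifP => _; rewrite ?expr0n ?expr1n.
rewrite e1 e2 e3 => h; apply: le_trans h _; rewrite ler_wpM2r ?card_window_le //.
by apply: sumr_ge0 => A _; exact: sqr_ge0.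
Qed.

Lemma sum_windows_le (F : {set I} -> R) : (forall A, 0 <= F A) ->
  \sum_j \sum_(A in window j) F A <= \sum_A F A.
Proof.
move=> F0; rewrite (exchange_big_dep predT) //=; apply: ler_sum => A _.
case: (boolP (trunc_log 2 (pprod A) < J)%N) => h.
  rewrite big_mkcond (bigD1 (Ordinal h)) //= big1 ?addr0.
    by case: ifP.
  move=> j jn; case: ifP => //; rewrite inE => /andP[_ /eqP e].
  by move: jn; rewrite -val_eqE /= e eqxx.
rewrite big1 // => j; rewrite inE => /andP[_ /eqP e].
by move: h; rewrite e ltn_ord.
Qed.

Lemma sum_windows_sqr_le :
  \sum_j \sum_(A in window j) rprod A ^+ 2 <= \prod_i (1 + r i ^+ 2).
Proof. by rewrite -sum_rprod_sqr; apply: sum_windows_le => A; exact: sqr_ge0. Qed.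

(** The solutions used are the multiples (k b, k a) with k prime to [q], which solve the equation
    without reduction mod [q]. *)
Lemma card_solutions_ge K A B :
  (#|[set k : 'I_(K %/ hgt A B) | coprime k.+1 q]| <= #|solutions K A B|)%N.
Proof.
set a := pprod (A :\: B); set b := pprod (B :\: A).
have a0 : (0 < a)%N := pprod_gt0 p_prime _.
have b0 : (0 < b)%N := pprod_gt0 p_prime _.
have h0 : (0 < hgt A B)%N := hgt_gt0 p_prime _ _.
have lt c (k : 'I_(K %/ hgt A B)) : (0 < c)%N -> (c <= hgt A B)%N -> ((k.+1 * c).-1 < K)%N.
  move=> c0 ch; rewrite prednK ?muln_gt0 //.
  apply: leq_trans (leq_trunc_div K (hgt A B)).
  by apply: leq_mul.
have ah : (a <= hgt A B)%N by exact: leq_maxl.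
have bh : (b <= hgt A B)%N by exact: leq_maxr.
pose f k : 'I_K * 'I_K := (Ordinal (lt b k b0 bh), Ordinal (lt a k a0 ah)).
have finj : injective f.
  move=> k k' /(congr1 (fun u => (val u.1).+1)) /=; rewrite !prednK ?muln_gt0 ?b0 //.
  by move=> /eqP; rewrite eqn_mul2r (gtn_eqF b0) /= eqSS => /eqP; exact: val_inj.
rewrite -(card_imset _ finj); apply: subset_leq_card.
apply/fintype.subsetP => _ /imsetP [k + ->]; rewrite !inE /= => ck.
rewrite !prednK ?muln_gt0 ?a0 ?b0 //.
rewrite !coprimeMl ck !coprime_pprod_q /=.
rewrite (pprodID p A B) (pprodID p B A) finset.setIC -/a -/b.
by apply/eqP; congr (_ %% _)%N; ring.
Qed.

Variables (M0 : R).
Hypothesis x_ge0 : 0 <= x.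

Local Notation V := (\sum_j @Vsum R I p r x M0 J j).
Local Notation Z := (\prod_i (1 + r i ^+ 2)).

Lemma Vsum_pairs (G : {set I} -> {set I} -> R) (k : R) j :
  (forall A B, A \in window j -> B \in window j -> (hgt A B)%:R <= M0 -> k / (hgt A B)%:R <= G A B) ->
  (forall A B, 0 <= G A B) ->
  k * @Vsum R I p r x M0 J j <= \sum_(A in window j) \sum_(B in window j) rprod A * rprod B * G A B.
Proof.
move=> hG G0; rewrite /Vsum mulr_sumr; apply: ler_sum => A hA.
rewrite mulr_sumr big_mkcondr /=; apply: ler_sum => B hB.
have rr0 : 0 <= rprod A * rprod B by rewrite mulr_ge0 // rprod_ge0.
case: ifP => [hM|_]; last by rewrite mulr_ge0.
by rewrite mulrCA ler_wpM2l // hG.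
Qed.

Lemma Delta_lower (N k : R) : 0 <= N ->
  (forall A B, (hgt A B)%:R <= M0 ->
     k / (hgt A B)%:R <= #|[set k : 'I_(Num.truncn N %/ hgt A B) | coprime k.+1 q]|%:R) ->
  (totient q)%:R * k * V <= (Delta N q ^+ 2 * (totient q)%:R + N ^+ 2 * x) * Z.
Proof.
move=> N0 hk.
apply: le_trans (_ : \sum_j (Delta N q ^+ 2 * (totient q)%:R + N ^+ 2 * x) * \sum_(A in window j) rprod A ^+ 2 <= _); last first.
  rewrite -mulr_sumr ler_wpM2l ?sum_windows_sqr_le //.
  by rewrite addr_ge0 // mulr_ge0 ?sqr_ge0.
rewrite mulr_sumr; apply: ler_sum => j _.
have h1 := Delta_window N j.
have h2 : k * @Vsum R I p r x M0 J j <= \sum_(A in window j) \sum_(B in window j) rprod A * rprod B *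
    #|solutions (Num.truncn N) A B|%:R.
  apply: Vsum_pairs => // A B _ _ hM; apply: le_trans (hk A B hM) _.
  by rewrite ler_nat card_solutions_ge.
have h3 : (#|[set k : 'I_(Num.truncn N) | coprime k.+1 q]|%:R * \sum_(A in window j) rprod A) ^+ 2 <=
   N ^+ 2 * (x * \sum_(A in window j) rprod A ^+ 2).
  rewrite exprMn; apply: ler_pM; rewrite ?sqr_ge0 ?sum_window_sqr_le //.
  rewrite lerXn2r ?nnegrE //.
  apply: le_trans (_ : (Num.truncn N)%:R <= _); last by have /andP[] := truncn_itv N0.
  by rewrite ler_nat (leq_trans (max_card _)) // card_ord.
rewrite -mulrA; apply: le_trans (ler_wpM2l _ h2) _; first by [].
move: h1 h3; set X := (_ * _)^+2; set Y := _ * \sum_(A in window j) _; set S := \sum_(A in _) _ ^+ 2.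
by move=> h1 h3; lra.
Qed.

End Windows.

(** * Prime modulus: the sum of length q / N *)

Section WindowsPrime.
Variables (R : realType) (I : finType) (p : I -> nat) (r : I -> R).
Hypothesis p_prime : forall i, prime (p i).
Hypothesis p_inj : injective p.
Hypothesis r_ge0 : forall i, 0 <= r i.
Implicit Types A B D : {set I}.
Variable q : nat.
Hypothesis q_prime : prime q.
Hypothesis p_ndvd : forall i, ~~ (p i %| q)%N.
Variables (x M0 N : R) (J : nat).
Let M : R := q%:R / N.
Hypothesis (N_gt1 : 1 < N) (q_ge3 : (3 <= q)%N) (x_ge0 : 0 <= x)
  (xM : 8 * x <= M) (M0N : 4 * M0 <= N).

Local Notation window := (@window R I p x J).
Local Notation pprod := (pprod p).
Local Notation rprod := (rprod r).
Local Notation hgt := (hgt p).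
Local Notation solutions := (@solutions I p q).
Local Notation K := (Num.truncn M).

Let q0 : 0 < (q%:R : R).
Proof. by rewrite ltr0n prime_gt0. Qed.

Let N0 : 0 < N. Proof. exact: lt_trans N_gt1. Qed.

Let M_gt0 : 0 < M. Proof. by rewrite divr_gt0. Qed.

Let Mq : M < q%:R.
Proof. by rewrite /M ltr_pdivrMr // ltr_pMr. Qed.

Let K_lt_q : (K < q)%N.
Proof. by rewrite -(ltr_nat R); apply: le_lt_trans Mq; have /andP[] := truncn_itv (ltW M_gt0). Qed.

Let KM : (K%:R : R) <= M.
Proof. by have /andP[] := truncn_itv (ltW M_gt0). Qed.

Lemma coprime_lt_prime k : (k < K)%N -> coprime k.+1 q.
Proof.
move=> kK; rewrite coprime_sym prime_coprime //; apply/negP => /dvdn_leq -/(_ isT).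
by rewrite leqNgt (leq_ltn_trans kK K_lt_q).
Qed.

Lemma card_solutions_prime_ge A B :
  (K ^ 2 <= q * (#|solutions K A B| + K %/ hgt A B
                 + (pprod (A :\: B) * K) %/ q + (pprod (B :\: A) * K) %/ q + 2))%N.
Proof.
have a0 := pprod_gt0 p_prime (B :\: A); have b0 := pprod_gt0 p_prime (A :\: B).
have cab : coprime (pprod (B :\: A)) (pprod (A :\: B)).
  apply: coprime_pprod => //; rewrite -setI_eq0; apply/eqP/finset.setP => i.
  by rewrite !inE; case: (i \in A); rewrite ?andbF.
have := congruence_count_ge K a0 b0 cab (prime_gt0 q_prime).
have -> : #|[set u : 'I_K * 'I_K | u.1.+1 * pprod (A :\: B) == u.2.+1 * pprod (B :\: A) %[mod q]]|
   = #|solutions K A B|.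
  apply: eq_card => u; rewrite !inE !coprime_lt_prime //=.
  rewrite (pprodID p A B) (pprodID p B A) finset.setIC !(mulnCA _.+1).
  (* The common factor is prime to [q] and cancels from the congruence; the [wlog] below orders the
     two sides so that their natural-number difference is exact. *)
  have cop : coprime (pprod (B :&: A)) q by exact: coprime_pprod_q.
  set c := pprod (B :&: A) in cop *.
  set m := (_ * _)%N; set m' := (_ * _)%N.
  wlog mm' : m m' / (m <= m')%N.
    by move=> H; case/orP: (leq_total m m') => /H // e; rewrite eq_sym e eq_sym.
  rewrite [LHS]eq_sym [RHS]eq_sym !eqn_mod_dvd ?leq_mul2l ?mm' ?orbT //.
  by rewrite -mulnBr Gauss_dvdr // coprime_sym.
by rewrite maxnC.
Qed.

Lemma hgt_le_x j A B : A \in window j -> B \in window j ->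
  [/\ (pprod (A :\: B))%:R <= x, (pprod (B :\: A))%:R <= x & (hgt A B)%:R <= x].
Proof.
rewrite !inE => /andP[hA _] /andP[hB _].
have h1 : (pprod (A :\: B))%:R <= x.
  by apply: le_trans hA; rewrite ler_nat pprod_subset // subsetDl.
have h2 : (pprod (B :\: A))%:R <= x.
  by apply: le_trans hB; rewrite ler_nat pprod_subset // subsetDl.
by split => //; rewrite /hgt /maxn; case: ifP.
Qed.

Let C A B : R := #|solutions K A B|%:R.

(** The entry is about M / h, while the principal part satisfies K^2 <= M^2 = q M / N <= q M / (4
    h), because 4 h <= 4 M0 <= N. *)
Lemma discrepancy_small j A B : A \in window j -> B \in window j -> (hgt A B)%:R <= M0 ->
  q%:R * M / 4 / (hgt A B)%:R <= (q%:R - 1) * C A B - K%:R ^+ 2.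
Proof.
move=> hA hB hM; have [_ _ hx] := hgt_le_x hA hB.
have h0 : (0 < hgt A B)%N := hgt_gt0 p_prime _ _.
have h0' : 0 < ((hgt A B)%:R : R) by rewrite ltr0n.
have CK : (K %/ hgt A B)%:R <= C A B.
  rewrite ler_nat; apply: leq_trans (card_solutions_ge p_prime p_ndvd K A B).
  rewrite -[X in (X <= _)%N]card_ord -cardsT; apply: subset_leq_card.
  apply/fintype.subsetP => k _; rewrite inE coprime_lt_prime //.
  by apply: leq_trans (ltn_ord k) _; rewrite leq_div.
have h1 : M / (hgt A B)%:R - 2 <= C A B.
  apply: le_trans CK; rewrite lerBlDr ler_pdivrMr //.
  have /andP[_ t1] := truncn_itv (ltW M_gt0); apply: ltW; apply: lt_le_trans t1 _.
  rewrite -[2](@natrD _ 1 1) -natrD -natrM ler_nat.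
  apply: leq_trans (ltn_ceil K h0) _; rewrite leq_mul2r addnA !addn1.
  by rewrite leqnSn orbT.
set h := (hgt A B)%:R in h0' hx hM h1 *.
have K2 : K%:R ^+ 2 <= q%:R * M / 4 / h.
  apply: le_trans (_ : M ^+ 2 <= _); first by rewrite lerXn2r ?nnegrE // ltW.
  rewrite expr2 {1}/M mulrAC -[leRHS]mulrA -invfM ler_pM2l ?mulr_gt0 ?invr_gt0 //.
  rewrite lef_pV2 ?posrE ?mulr_gt0 ?invr_gt0 //.
  by apply: le_trans M0N; rewrite ler_pM2l.
have q3 : 3 <= (q%:R : R) by rewrite ler_nat.
have Mh : 8 <= M / h.
  rewrite ler_pdivlMr //; apply: le_trans xM; rewrite ler_pM2l //.
have -> : q%:R * M / 4 / h = q%:R * (M / h) / 4 by ring.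
have eM : q%:R * M / 4 / h = q%:R * (M / h) / 4 by ring.
rewrite eM in K2; move: K2 Mh h1; set X := M / h => K2 Mh h1.
have : (q%:R - 1) * (X - 2) <= (q%:R - 1) * C A B by rewrite ler_wpM2l //; lra.
(* 2/3 comes from q >= 3 and 3/4 from M / h >= 8. The product leaves q X / 2, of which K^2 takes at
   most half. *)
have : (2 / 3 * q%:R) * (3 / 4 * X) <= (q%:R - 1) * (X - 2) by apply: ler_pM; lra.
lra.
Qed.

Lemma discrepancy_ge j A B : A \in window j -> B \in window j ->
  - (q%:R * (M / (hgt A B)%:R + (2 * x / N + 3))) <= (q%:R - 1) * C A B - K%:R ^+ 2.
Proof.
move=> hA hB; have [ax bx _] := hgt_le_x hA hB.
have := card_solutions_prime_ge A B.
rewrite -(ler_nat R) natrX natrM !natrD -/(C A B).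
have fl (m d : nat) (y : R) : (0 < d)%N -> m%:R <= y * d%:R -> ((m %/ d)%N%:R : R) <= y.
  move=> d0 h; rewrite -(@ler_pM2r _ d%:R) ?ltr0n // -natrM; apply: le_trans h.
  by rewrite ler_nat leq_trunc_div.
have h0 : (0 < hgt A B)%N := hgt_gt0 p_prime _ _.
have h0' : 0 < ((hgt A B)%:R : R) by rewrite ltr0n.
have f1 : (K %/ hgt A B)%:R <= M / (hgt A B)%:R.
  by apply: fl => //; rewrite divfK // gt_eqF.
have fx m : (m%:R : R) <= x -> ((m * K) %/ q)%:R <= x / N.
  move=> mx; apply: fl; first exact: prime_gt0.
  have -> : x / N * q%:R = x * M by rewrite /M; ring.
  by rewrite natrM ler_pM.
have := fx _ ax; have := fx _ bx; move: f1.
set c1 := (K %/ _)%:R; set c2 := (_ %/ q)%:R; set c3 := (_ %/ q)%:R.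
set Cc := C A B; set h := (hgt A B)%:R; move=> f1 f2 f3 H.
have q3 : 3 <= (q%:R : R) by rewrite ler_nat.
have Kq : K%:R ^+ 2 <= q%:R * q%:R :> R.
  by rewrite -expr2 lerXn2r ?nnegrE // ltW // (le_lt_trans KM).
pose E := M / h + 2 * (x / N) + 2.
have H2 : K%:R ^+ 2 <= q%:R * (Cc + E).
  apply: le_trans H _; rewrite ler_pM2l // /E; lra.
have H3 : K%:R ^+ 2 / q%:R - E <= Cc by rewrite lerBlDr ler_pdivrMr // mulrC.
have H4 : K%:R ^+ 2 / q%:R <= q%:R :> R by rewrite ler_pdivrMr.
have q1 : 0 <= (q%:R - 1 : R) by lra.
have E0 : 0 <= E by rewrite /E !addr_ge0 ?mulr_ge0 ?invr_ge0 ?(ltW M_gt0) ?(ltW N0) ?(ltW h0').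
have := ler_wpM2l q1 H3.
have -> : (q%:R - 1) * (K%:R ^+ 2 / q%:R - E) = K%:R ^+ 2 - K%:R ^+ 2 / q%:R - q%:R * E + E.
  by field; rewrite gt_eqF.
have -> : q%:R * (M / h + (2 * x / N + 3)) = q%:R * E + q%:R by rewrite /E; ring.
lra.
Qed.

Local Notation V := (\sum_j @Vsum R I p r x M0 J j).
Local Notation Z := (\prod_i (1 + r i ^+ 2)).

(** Pairs of height at most [M0] supply the main term. The others may be negative by at most about q
    M / h, collected in the tail, plus a constant that multiplies the square of the sum of r over
    the window. *)
Lemma Delta_lower_prime :
  M / 4 * V <= (Delta M q ^+ 2 + (2 * x / N + 3) * x) * Z +
   M * (\sum_(A : {set I}) \sum_(B : {set I} | M0 < (hgt A B)%:R) rprod A * rprod B / (hgt A B)%:R).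
Proof.
set tail := \sum_(A : {set I}) _.
have x_lt_q : x < q%:R by apply: le_lt_trans Mq; apply: le_trans xM; rewrite ler_peMl // ler1n.
pose S j := \sum_(A in window j) rprod A ^+ 2.
pose tl j := \sum_(A in window j) \sum_(B in window j | M0 < (hgt A B)%:R) rprod A * rprod B / (hgt A B)%:R.
have rr0 A B : 0 <= rprod A * rprod B by rewrite mulr_ge0 // rprod_ge0.
have rrh0 A B : 0 <= rprod A * rprod B / (hgt A B)%:R by rewrite divr_ge0.
have c0 : 0 <= (2 * x / N + 3) by rewrite addr_ge0 // divr_ge0 ?(ltW N0) // mulr_ge0.
suff H j : M / 4 * @Vsum R I p r x M0 J j <= (Delta M q ^+ 2 + (2 * x / N + 3) * x) * S j + M * tl j.
  rewrite mulr_sumr; apply: le_trans (ler_sum _ (fun j _ => H j)) _.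
  rewrite big_split /= -!mulr_sumr; apply: lerD.
    by rewrite ler_wpM2l ?sum_windows_sqr_le // addr_ge0 ?sqr_ge0 // mulr_ge0.
  rewrite ler_wpM2l ?(ltW M_gt0) //.
  pose G A := \sum_(B : {set I} | M0 < (hgt A B)%:R) rprod A * rprod B / (hgt A B)%:R.
  apply: (@le_trans _ _ (\sum_j \sum_(A in window j) G A)); last first.
    by apply: sum_windows_le => A; apply: sumr_ge0.
  apply: ler_sum => j _; apply: ler_sum => A _; rewrite big_mkcond [leRHS]big_mkcond.
  by apply: ler_sum => B _; case: (B \in window j) => //=; case: ifP.
have h1 := @Delta_window R I p r p_prime p_inj q (prime_gt1 q_prime) p_ndvd x J x_lt_q M j.
have K2 : #|[set k : 'I_K | coprime k.+1 q]| = K.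
  rewrite -[RHS]card_ord -[RHS]cardsT; apply: eq_card => k; rewrite !inE.
  by rewrite coprime_lt_prime.
rewrite K2 totient_prime // in h1.
have eq1 : (q.-1%:R : R) = q%:R - 1 by rewrite -subn1 natrB // prime_gt0.
rewrite eq1 in h1.
pose sr := \sum_(A in window j) rprod A.
(* The square of the window sum is a full double sum, so the principal term can be subtracted entry
   by entry. *)
have E : \sum_(A in window j) \sum_(B in window j) rprod A * rprod B * ((q%:R - 1) * C A B - K%:R ^+ 2) =
   (q%:R - 1) * (\sum_(A in window j) \sum_(B in window j) rprod A * rprod B * C A B) - (K%:R * sr) ^+ 2.
  rewrite exprMn [sr ^+ 2]expr2 /sr mulr_suml !mulr_sumr -sumrB; apply: eq_bigr => A _.
  rewrite !mulr_sumr -sumrB; apply: eq_bigr => B _; ring.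
rewrite -E in h1.
have cc A B : A \in window j -> B \in window j ->
  [/\ - (q%:R * M / (hgt A B)%:R + q%:R * (2 * x / N + 3)) <= (q%:R - 1) * C A B - K%:R ^+ 2,
      (hgt A B)%:R <= M0 -> q%:R * M / 4 / (hgt A B)%:R <= (q%:R - 1) * C A B - K%:R ^+ 2
      & 0 <= q%:R * (2 * x / N + 3)].
  move=> hA hB; split; [|exact: discrepancy_small hA hB|by rewrite mulr_ge0 // ltW].
  by have := discrepancy_ge hA hB; rewrite mulrDr mulrA.
have lower : q%:R * M / 4 * @Vsum R I p r x M0 J j - q%:R * M * tl j - q%:R * (2 * x / N + 3) * sr ^+ 2 <=
   \sum_(A in window j) \sum_(B in window j) rprod A * rprod B * ((q%:R - 1) * C A B - K%:R ^+ 2).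
  rewrite [sr ^+ 2]expr2 {1}/sr /Vsum /tl mulr_suml !mulr_sumr -!sumrB; apply: ler_sum => A hA.
  have -> : rprod A * sr = \sum_(B in window j) rprod A * rprod B by rewrite mulr_sumr.
  move: (q%:R * M / 4) (q%:R * M) (q%:R * (2 * x / N + 3)) cc => c1 c2 c3 cc; rewrite !mulr_sumr.
  rewrite big_mkcondr [X in _ - X - _]big_mkcondr -!sumrB; apply: ler_sum => B hB /=.
  have [dge dsm cc3] := cc A B hA hB.
  case: (leP (hgt A B)%:R M0) => hM.
    have := ler_wpM2l (rr0 A B) (dsm hM); apply: le_trans; rewrite subr0 [leRHS]mulrCA mulrA.
    have := mulr_ge0 cc3 (rr0 A B).
    lra.
  have := ler_wpM2l (rr0 A B) dge; apply: le_trans.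
  by rewrite le_eqVlt; apply/orP; left; apply/eqP; ring.
have := le_trans lower h1.
have h2 := @sum_window_sqr_le R I p r p_prime p_inj x J j x_ge0.
have h3 : q%:R * (2 * x / N + 3) * sr ^+ 2 <= q%:R * (2 * x / N + 3) * (x * S j).
  by rewrite ler_wpM2l // mulr_ge0 // ltW.
rewrite -/(S j) => h4.
have h5 : Delta M q ^+ 2 * ((q%:R - 1) * S j) <= Delta M q ^+ 2 * (q%:R * S j).
  rewrite ler_wpM2l ?sqr_ge0 // ler_wpM2r //; last by lra.
  by apply: sumr_ge0 => A _; exact: sqr_ge0.
rewrite -(@ler_pM2l _ q%:R) //.
lra.
Qed.

End WindowsPrime.

(** * Choice of the resonator *)

(** All later requirements that q be large are reduced to a single threshold [T]. The last bound
    uses the quartic term of exp(ln L). *)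
Lemma ln_ln_large (R : realType) (T : R) : exists L0 : R, forall L, L0 <= L ->
  [/\ T <= ln (ln L), T <= ln L, T <= L & T * ln L ^+ 3 <= L].
Proof.
pose t := Num.max 1 T; have t1 : 1 <= t by rewrite le_max lexx.
have tT : T <= t by rewrite le_max lexx orbT.
pose l0 := Num.max (expR t) (24 * t).
exists (expR l0) => L hL.
have L0 : 0 < L by apply: lt_le_trans hL; exact: expR_gt0.
have hl : l0 <= ln L by rewrite -[l0]expRK ler_ln ?posrE ?expR_gt0.
have h1 : expR t <= ln L by apply: le_trans hl; rewrite le_max lexx.
have h2 : 24 * t <= ln L by apply: le_trans hl; rewrite le_max lexx orbT.
have l0' : 0 < ln L by apply: lt_le_trans h1; exact: expR_gt0.
have h3 : t <= ln (ln L) by rewrite -[t]expRK ler_ln ?posrE ?expR_gt0.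
have h4 : t <= ln L by lra.
have h5 : t * ln L ^+ 3 <= L.
  have := @expR_ge1Dxn R (ln L) 3 (ltW l0'); rewrite lnK ?posrE //.
  have -> : (4`!%:R : R) = 24 by [].
  move=> h; apply: le_trans (_ : ln L ^+ 4 / 24 <= _); last by lra.
  rewrite ler_pdivlMr // [_ ^+ 4]exprS mulrAC ler_pM2r ?exprn_gt0 //; lra.
split; [exact: le_trans h3|exact: le_trans h4| |].
- apply: le_trans tT _; apply: le_trans h5; rewrite ler_peMr //; first lra.
  by rewrite exprn_ege1 //; lra.
- by apply: le_trans h5; rewrite ler_wpM2r // exprn_ge0 // ltW.
Qed.

Section ResonatorExists.
Variables (R : realType).

(* Used with l = ln (ln q), so that the primes lie in (ln q, (ln q) ^ K]. *)
Variables (q : nat) (l K d lam : R).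
Hypotheses (l1 : 1 <= l) (K1 : 1 < K) (d01 : 0 < d <= 8^-1) (lam0 : 0 <= lam).

Let d0 : 0 < d. Proof. by case/andP: d01. Qed.
Let d1 : d <= 8^-1. Proof. by case/andP: d01. Qed.

(** Ordinals below [q] serve to make the type finite: the range ends at exp(K l), which is below [q]
    in the application. *)
Definition is_resonator_prime (i : 'I_q) : bool :=
  [&& prime i, l < ln (i%:R : R) <= K * l & ~~ (i %| q)%N].

Definition rprime : finType := {i : 'I_q | is_resonator_prime i}.

Definition rprime_val (i : rprime) : nat := val (val i).

Definition rcoef (i : rprime) : R :=
  lam / (Num.sqrt (rprime_val i)%:R * ln (rprime_val i)%:R).

Local Notation p := rprime_val.
Local Notation r := rcoef.

Lemma rprimeP (i : rprime) : [/\ prime (p i), l < ln ((p i)%:R : R), ln ((p i)%:R : R) <= K * l & ~~ (p i %| q)%N].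
Proof. by have /and3P[h1 /andP[h2 h3] h4] := valP i. Qed.

Lemma rprime_prime i : prime (p i). Proof. by have [] := rprimeP i. Qed.

Lemma rprime_inj : injective p.
Proof. by move=> i j /val_inj /val_inj. Qed.

Lemma rprime_ndvd i : ~~ (p i %| q)%N. Proof. by have [] := rprimeP i. Qed.

Let p0 i : 0 < ((p i)%:R : R). Proof. by rewrite ltr0n prime_gt0 // rprime_prime. Qed.

Let lp0 i : 0 < ln ((p i)%:R : R).
Proof. by have [_ h _ _] := rprimeP i; apply: lt_trans h; exact: lt_le_trans l1. Qed.

Lemma rcoef_ge0 i : 0 <= r i.
Proof. by rewrite divr_ge0 // mulr_ge0 ?sqrtr_ge0 // ltW. Qed.

Let v i : R := r i / Num.sqrt (p i)%:R.

Let vE i : v i = lam * ((p i)%:R * ln ((p i)%:R : R))^-1.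
Proof.
rewrite /v /rcoef; move: (p0 i) (lp0 i); set P := (p i)%:R; set W := ln P => P0 W0.
have S0 : 0 < Num.sqrt P by rewrite sqrtr_gt0.
have PS : P = Num.sqrt P ^+ 2 by rewrite sqr_sqrtr // ltW.
move: S0 PS; set S := Num.sqrt P => S0 PS; rewrite [in RHS]PS.
by field; rewrite !gt_eqF.
Qed.

Let r2E i : r i ^+ 2 = lam * v i / ln ((p i)%:R : R).
Proof.
rewrite vE /rcoef; move: (p0 i) (lp0 i); set P := (p i)%:R; set W := ln P => P0 W0.
have S0 : 0 < Num.sqrt P by rewrite sqrtr_gt0.
have PS : P = Num.sqrt P ^+ 2 by rewrite sqr_sqrtr // ltW.
move: S0 PS; set S := Num.sqrt P => S0 PS; rewrite [in RHS]PS.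
by field; rewrite !gt_eqF.
Qed.

Let s : R := \sum_i ((p i)%:R * ln ((p i)%:R : R))^-1.

Lemma sum_rprime (F : nat -> R) : \sum_(i : rprime) F (p i) =
  \sum_(0 <= k < q | prime k && (l < ln (k%:R : R) <= K * l) && ~~ (k %| q)%N) F k.
Proof.
rewrite big_mkord /rprime_val.
have := @big_sub R 0 +%R 'I_q is_resonator_prime (fun i => F i) => <-.
by apply: eq_bigl => i; rewrite unfold_in /is_resonator_prime andbA.
Qed.

Hypothesis q_gt1 : (1 < q)%N.
Hypothesis expl : expR l = ln (q%:R : R).
Hypothesis l_large : d^-1 <= l.
Hypothesis sum_all : (1 - d) / l <=
   \sum_(0 <= k < q | prime k && (l < ln (k%:R : R) <= K * l)) (k%:R * ln (k%:R : R))^-1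
  <= (1 + d) / l.

Let l0 : 0 < l. Proof. exact: lt_le_trans l1. Qed.

Let s_bounds : (1 - 2 * d) / l <= s <= (1 + d) / l.
Proof.
have hd0 := d0; have hd1 := d1; have hK1 := K1; have hl0 := l0.
rewrite /s (sum_rprime (fun k => (k%:R * ln (k%:R : R))^-1)).
have /andP[] := sum_all; rewrite (bigID (fun k => k %| q)%N) /=.
set s1 := \sum_(_ <= _ < _ | _) _; set s2 := \sum_(_ <= _ < _ | _) _.
have q0 : (0 < q)%N by rewrite ltnW.
have h1 : s1 <= ln (q%:R : R) / (expR l * l ^+ 2).
  exact: sum_inv_p_lnp_divisors.
have h0 : 0 <= s1.
  by apply: sumr_ge0 => k _; rewrite invr_ge0 mulr_ge0 // ln_natr_ge0.
have h2 : s1 <= d / l.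
  apply: le_trans h1 _; rewrite expl invfM mulrA divff; last by rewrite -expl gt_eqF ?expR_gt0.
  rewrite mul1r expr2 invfM ler_pM2r ?invr_gt0 //.
  by rewrite -[leRHS]invrK lef_pV2 ?posrE ?invr_gt0.
move=> h3 h4; apply/andP; split; last by apply: le_trans h4; lra.
have -> : (1 - 2 * d) / l = (1 - d) / l - d / l by ring.
lra.
Qed.

(** ln p <= K l converts the sum of 1 / (p ln p) into one of 1 / p; this is where the upper end of
    the range matters. *)
Lemma sum_inv_rprime_le : \sum_i ((p i)%:R)^-1 <= K * (1 + d) :> R.
Proof.
have hd0 := d0; have hd1 := d1; have hK1 := K1; have hl0 := l0.
apply: le_trans (_ : \sum_i (K * l) * ((p i)%:R * ln ((p i)%:R : R))^-1 <= _).
  apply: ler_sum => i _; have [_ _ h _] := rprimeP i.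
  rewrite invfM mulrCA ler_peMr ?invr_ge0 ?(ltW (p0 i)) //.
  by rewrite ler_pdivlMr ?lp0 // mul1r.
rewrite -mulr_sumr -/s -mulrA ler_pM2l; last by lra.
by have /andP[_] := s_bounds; rewrite ler_pdivlMr // mulrC.
Qed.

Variables (X L : R).
Hypotheses (eL : L = expR l) (X0 : 0 < X) (XL : X <= L).
(** Nearly the largest admissible value: the sum of r^2 ln p is lam^2 times the sum of 1 / (p ln p),
    thus close to (1 - 5d) X, and Rankin's trick needs it below X. *)
Hypothesis lamE : lam ^+ 2 = (1 - 5 * d) * X * l.
Hypotheses (Ll_large : 4 / d ^+ 2 <= L * l) (l_large2 : 2 / d <= l).
Hypothesis lX : 4 * K ^+ 2 * l <= d ^+ 2 * X.

Let L0 : 0 < L. Proof. by rewrite eL expR_gt0. Qed.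

Let Lp i : L <= (p i)%:R.
Proof.
have hd0 := d0; have hd1 := d1; have hK1 := K1; have hl0 := l0.
have [_ h _ _] := rprimeP i.
by rewrite eL -[leRHS]lnK ?posrE // ler_expR ltW.
Qed.

Let lam2 : lam ^+ 2 <= X * l.
Proof.
have hd0 := d0; have hd1 := d1; have hK1 := K1; have hl0 := l0.
rewrite lamE -mulrA ler_piMl //; first by rewrite mulr_ge0 ?(ltW X0) ?(ltW l0).
lra.
Qed.

Let v_ge0 i : 0 <= v i.
Proof. by rewrite divr_ge0 ?sqrtr_ge0 ?rcoef_ge0. Qed.

(** p >= L and ln p >= l give v <= lam / (L l) <= (L l)^(-1/2). Together with [r2_le] this is the
    smallness condition of [prod_ge_exp]. *)
Let v_le i : v i <= d / 2.
Proof.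
have hd0 := d0; have hd1 := d1; have hK1 := K1; have hl0 := l0.
have [_ h _ _] := rprimeP i.
have h1 : v i <= lam / (L * l).
  rewrite vE ler_wpM2l // lef_pV2 ?posrE ?mulr_gt0 ?lp0 //.
  by apply: ler_pM => //; exact: ltW.
apply: le_trans h1 _; rewrite ler_pdivrMr ?mulr_gt0 //.
have nn : 0 <= d / 2 * (L * l) by rewrite !mulr_ge0 ?invr_ge0 ?(ltW hd0) ?(ltW hl0) ?(ltW L0).
rewrite -ler_sqr ?nnegrE //.
apply: le_trans (_ : L * l <= _); first by apply: le_trans lam2 _; rewrite ler_pM2r.
have Ll : 0 < L * l by rewrite mulr_gt0.
have : (4 / d ^+ 2) * (d ^+ 2 / 4 * (L * l)) <= L * l * (d ^+ 2 / 4 * (L * l)).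
  by rewrite ler_wpM2r // !mulr_ge0 // ?sqr_ge0 // ltW.
have -> : (4 / d ^+ 2) * (d ^+ 2 / 4 * (L * l)) = L * l by field; rewrite gt_eqF.
have -> // : L * l * (d ^+ 2 / 4 * (L * l)) = (d / 2 * (L * l)) ^+ 2 by field.
Qed.

Let r2_le i : r i ^+ 2 <= d / 2.
Proof.
have hd0 := d0; have hd1 := d1; have hK1 := K1; have hl0 := l0.
have [_ h _ _] := rprimeP i.
have h1 : v i <= lam / (L * l).
  rewrite vE ler_wpM2l // lef_pV2 ?posrE ?mulr_gt0 ?lp0 //.
  by apply: ler_pM => //; exact: ltW.
rewrite r2E.
apply: le_trans (_ : lam * (lam / (L * l)) / l <= _).
  apply: ler_pM.
  - by rewrite mulr_ge0 // v_ge0.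
  - by rewrite invr_ge0 ltW // lp0.
  - by rewrite ler_wpM2l.
  - by rewrite lef_pV2 ?posrE ?lp0 // ltW.
rewrite mulrA -expr2 ler_pdivrMr // ler_pdivrMr ?mulr_gt0 //.
apply: le_trans lam2 _; have -> : d / 2 * l * (L * l) = (d * l / 2) * (L * l) by ring.
apply: le_trans (_ : 1 * (L * l) <= _); first by rewrite mul1r ler_pM2r.
rewrite ler_pM2r ?mulr_gt0 //; move: l_large2; rewrite ler_pdivrMr //; lra.
Qed.

Local Notation Z := (\prod_i (1 + r i ^+ 2)).
Local Notation Tot := (\prod_i (1 + r i ^+ 2 + v i)).

Lemma sum_vE : \sum_i v i = lam * s.
Proof. by rewrite /s mulr_sumr; apply: eq_bigr => i _; rewrite vE. Qed.

(** The losses are 5d from [lam], 2d from the prime sum and d from the passage to exponentials;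
    together they are at most 8d. *)
Lemma Tot_ge : Z * expR ((1 - 8 * d) * Num.sqrt (X / l)) <= Tot.
Proof.
have hd0 := d0; have hd1 := d1; have hK1 := K1; have hl0 := l0.
apply: le_trans (prod_ge_exp (d := d) _ v_ge0 _).
- rewrite ler_wpM2l //; first by apply: prodr_ge0 => i _; rewrite addr_ge0 ?sqr_ge0.
  rewrite ler_expR sum_vE ler_pdivlMr; last by lra.
  have /andP[hs _] := s_bounds.
  apply: le_trans (ler_wpM2l lam0 hs).
  have h1 : (1 - 5 * d) * Num.sqrt (X * l) <= lam.
    have k0 : 0 <= 1 - 5 * d by lra.
    rewrite -ler_sqr ?nnegrE ?mulr_ge0 ?sqrtr_ge0 //.
    rewrite exprMn sqr_sqrtr ?mulr_ge0 ?(ltW X0) ?(ltW l0) // lamE -mulrA ler_wpM2r ?mulr_ge0 ?(ltW X0) ?(ltW l0) //.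
    by rewrite expr2; nra.
  have e1 : Num.sqrt (X / l) = Num.sqrt (X * l) / l.
    have -> : X / l = X * l / l ^+ 2 by field; rewrite gt_eqF.
    by rewrite sqrtrM ?mulr_ge0 ?(ltW l0) ?(ltW X0) // sqrtrV ?sqr_ge0 // sqrtr_sqr ger0_norm // ltW.
  rewrite e1; set S := Num.sqrt (X * l) in h1 *.
  have S0 : 0 <= S by exact: sqrtr_ge0.
  have -> : (1 - 8 * d) * (S / l) * (1 + d) = (1 - 8 * d) * (1 + d) * S / l by ring.
  have -> : lam * ((1 - 2 * d) / l) = lam * (1 - 2 * d) / l by ring.
  rewrite ler_pM2r ?invr_gt0 //.
  apply: le_trans (_ : (1 - 5 * d) * S * (1 - 2 * d) <= _); last by rewrite ler_wpM2r //; lra.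
  have -> : (1 - 5 * d) * S * (1 - 2 * d) = (1 - 5 * d) * (1 - 2 * d) * S by ring.
  rewrite ler_wpM2r //; nra.
- by move=> i; exact: sqr_ge0.
- by move=> i; have := r2_le i; have := v_le i; lra.
Qed.

Variable c : R.
Hypotheses (c0 : 0 < c) (c1 : c <= 1) (cK : expR (c * K) = 1 + d).
(** Rankin's exponent: p^al <= exp(c K) = 1 + d on the whole range, so p^al - 1 is at most (1 + d)
    al ln p. *)
Let al := c / l.
Let y i := expR (al * ln ((p i)%:R : R)).

Let al0 : 0 < al. Proof. by rewrite divr_gt0. Qed.

Let y_le i : y i <= 1 + d.
Proof.
have hd0 := d0; have hd1 := d1; have hK1 := K1; have hl0 := l0.
rewrite -cK ler_expR /al; have [_ _ h _] := rprimeP i.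
apply: le_trans (_ : c / l * (K * l) <= _); first by rewrite ler_pM2l.
by rewrite le_eqVlt; apply/orP; left; apply/eqP; field; rewrite gt_eqF.
Qed.

Let y_sub1 i : y i - 1 <= al * (1 + d) * ln ((p i)%:R : R).
Proof.
have hd0 := d0; have hd1 := d1; have hK1 := K1; have hl0 := l0.
have h := expR_ge1Dx (- (al * ln ((p i)%:R : R))); rewrite expRN -/(y i) in h.
have y0 : 0 < y i := expR_gt0 _.
have : (1 - al * ln ((p i)%:R : R)) * y i <= 1 by rewrite -ler_pdivlMr // div1r.
have := y_le i; have := mulr_gt0 al0 (lp0 i).
by move: (y i) (ln _) => Y W; nra.
Qed.

Lemma rankin_sum_v : \sum_i (y i - 1) * v i <= al * (1 + d) * (lam * (K * (1 + d))).
Proof.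
have hd0 := d0; have hd1 := d1; have hK1 := K1; have hl0 := l0.
apply: le_trans (_ : \sum_i al * (1 + d) * (lam * ((p i)%:R)^-1) <= _).
  apply: ler_sum => i _; apply: le_trans (ler_wpM2r (v_ge0 i) (y_sub1 i)) _.
  rewrite vE le_eqVlt; apply/orP; left; apply/eqP; field.
  by rewrite !gt_eqF ?p0 ?lp0.
have h : 0 <= al * (1 + d) by rewrite mulr_ge0 ?(ltW al0) //; lra.
by rewrite -!mulr_sumr ler_wpM2l // ler_wpM2l // sum_inv_rprime_le.
Qed.

(** The factor ln p turns r^2 into [lam * v], whose sum is about (1 - 5d) X. The part with v is of
    order lam, about sqrt(X l), and is at most d X by [lX]. *)
Lemma rankin_sum_rv : \sum_i (y i - 1) * (r i ^+ 2 + v i) <= al * ((1 - 2 * d) * X).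
Proof.
have hd0 := d0; have hd1 := d1; have hK1 := K1; have hl0 := l0.
have h : 0 <= al * (1 + d) by rewrite mulr_ge0 ?(ltW al0) //; lra.
have h1 : \sum_i (y i - 1) * r i ^+ 2 <= al * (1 + d) * ((1 - 5 * d) * (1 + d) * X).
  apply: le_trans (_ : \sum_i al * (1 + d) * (lam * v i) <= _).
    apply: ler_sum => i _; apply: le_trans (ler_wpM2r (sqr_ge0 _) (y_sub1 i)) _.
    rewrite r2E le_eqVlt; apply/orP; left; apply/eqP; field.
    by rewrite gt_eqF ?lp0.
  rewrite -!mulr_sumr ler_wpM2l // sum_vE mulrA -expr2 lamE.
  have /andP[_ hs] := s_bounds.
  apply: le_trans (ler_wpM2l _ hs) _; first by rewrite !mulr_ge0 ?(ltW X0) ?(ltW l0) //; lra.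
  by rewrite le_eqVlt; apply/orP; left; apply/eqP; field; rewrite gt_eqF.
have h2 : lam * (K * (1 + d)) <= d * X.
  rewrite -ler_sqr ?nnegrE ?mulr_ge0 ?(ltW d0) ?(ltW X0) //; try lra.
  apply: le_trans (_ : lam ^+ 2 * (4 * K ^+ 2) <= _).
    rewrite exprMn ler_wpM2l ?sqr_ge0 // exprMn mulrC ler_wpM2r ?sqr_ge0 //.
    by rewrite expr2; nra.
  apply: le_trans (_ : X * l * (4 * K ^+ 2) <= _).
    by rewrite ler_wpM2r // mulr_ge0 // sqr_ge0.
  have -> : X * l * (4 * K ^+ 2) = X * (4 * K ^+ 2 * l) by ring.
  have -> : (d * X) ^+ 2 = X * (d ^+ 2 * X) by ring.
  by rewrite ler_pM2l.
under eq_bigr => i _ do rewrite mulrDr.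
rewrite big_split /=; apply: le_trans (lerD h1 rankin_sum_v) _.
have h3 := ler_wpM2l h h2.
apply: le_trans (lerD (lexx _) h3) _.
have -> : al * (1 + d) * ((1 - 5 * d) * (1 + d) * X) + al * (1 + d) * (d * X) =
   al * ((1 + d) * ((1 - 5 * d) * (1 + d) + d) * X) by ring.
rewrite ler_pM2l // ler_pM2r //; nra.
Qed.

Variables (M0 : R).
Hypotheses (M00 : 0 < M0) (aX : 3 <= 2 * d * (al * X)) (lM1 : 16 * K * lam <= 2 * ln M0)
  (aM : 6 <= al * ln M0) (lM2 : 8 * lam <= c * ln M0).

Let exp_le4 (t : R) : t <= -3 -> expR t <= 4^-1.
Proof.
have hd0 := d0; have hd1 := d1; have hK1 := K1; have hl0 := l0; have h_aX := aX; have h_lM1 := lM1; have h_aM := aM; have h_lM2 := lM2.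
move=> ht; apply: le_trans (_ : expR (-3) <= _); first by rewrite ler_expR.
rewrite expRN lef_pV2 ?posrE ?expR_gt0 //.
by have := @expR_ge1Dx R 3; lra.
Qed.

(** Both Rankin tails are at most 1/4 of the Euler product, so half of it survives. *)
Lemma linsum_resonator_ge :
  Z * expR ((1 - 8 * d) * Num.sqrt (X / l)) / 2 <= linsum p r (expR X) M0.
Proof.
have hd0 := d0; have hd1 := d1; have hK1 := K1; have hl0 := l0; have h_aX := aX; have h_lM1 := lM1; have h_aM := aM; have h_lM2 := lM2.
have h1 : expR (\sum_i (y i - 1) * (r i ^+ 2 + v i) - al * ln (expR X)) <= 4^-1.
  rewrite expRK; apply: exp_le4; apply: le_trans (lerB rankin_sum_rv (lexx _)) _.
  have -> : al * ((1 - 2 * d) * X) - al * X = - (2 * d * (al * X)) by ring.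
  by rewrite lerN2.
have h2 : expR (\sum_i (y i - 1) * v i - al * ln M0) <= 4^-1.
  apply: exp_le4; apply: le_trans (lerB rankin_sum_v (lexx _)) _.
  have h3 : (1 + d) * (lam * (K * (1 + d))) <= 4 * K * lam.
    have -> : (1 + d) * (lam * (K * (1 + d))) = ((1 + d) * (1 + d)) * (K * lam) by ring.
    have kl : 0 <= K * lam by rewrite mulr_ge0 //; lra.
    rewrite -[leRHS]mulrA ler_wpM2r //; nra.
  have h4 : (1 + d) * (lam * (K * (1 + d))) <= ln M0 / 2 by lra.
  have := ler_wpM2l (ltW al0) h4; rewrite -[al * (1 + d) * _]mulrA.
  by move: h_aM; set t := ln M0; set u := _ * (_ * _); lra.
apply: le_trans (linsum_ge rprime_prime rcoef_ge0 (expR_gt0 X) M00 (ltW al0)).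
apply: le_trans (_ : Tot / 2 <= _); first by rewrite ler_pM2r ?Tot_ge.
rewrite ler_wpM2l //.
  by apply: prodr_ge0 => i _; rewrite !addr_ge0 ?sqr_ge0 ?v_ge0.
apply: le_trans (lerB (lerB (lexx 1) h1) h2); lra.
Qed.

(** On the range p^(al / 2) <= 2, so the exponent is at most 8 lam / l - c ln M0 / l, which is not
    positive. *)
Lemma tail_resonator_le :
  \sum_(A : {set rprime}) \sum_(B : {set rprime} | M0 < (hgt p A B)%:R)
    rprod r A * rprod r B / (hgt p A B)%:R <= Z.
Proof.
have hd0 := d0; have hd1 := d1; have hK1 := K1; have hl0 := l0; have h_aX := aX; have h_lM1 := lM1; have h_aM := aM; have h_lM2 := lM2.
have al1 : al <= 1 by rewrite ler_pdivrMr // mul1r (le_trans c1).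
apply: le_trans (hgt_tail_le rprime_prime rcoef_ge0 M00 (ltW al0) al1) _.
rewrite -[leRHS]mulr1 ler_wpM2l //.
  by apply: prodr_ge0 => i _; rewrite addr_ge0 ?sqr_ge0.
rewrite expR_le1 subr_le0.
apply: le_trans (_ : 2 * \sum_i v i * 2 <= _).
  rewrite ler_wpM2l //; apply: ler_sum => i _; rewrite ler_wpM2l ?v_ge0 //.
  apply: le_trans (_ : y i <= _); last by have := y_le i; lra.
  rewrite ler_expR ler_wpM2r ?(ltW (lp0 i)) //; have h := al0; lra.
rewrite -mulr_suml sum_vE.
have /andP[_ hs] := s_bounds.
have h1 : lam * s <= lam * (2 / l).
  by rewrite ler_wpM2l //; apply: le_trans hs _; rewrite ler_pM2r ?invr_gt0 //; lra.
apply: le_trans (_ : 8 * lam / l <= _); first by rewrite mulrA in h1; lra.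
have -> : al * ln M0 = c * ln M0 / l by rewrite /al mulrAC.
by rewrite ler_pM2r ?invr_gt0.
Qed.

End ResonatorExists.

Lemma resonator_exists (R : realType) (d e0 : R) : 0 < d <= 8^-1 -> 0 < e0 ->
  exists C L0 : R, 0 < C /\ forall q : nat, (1 < q)%N -> L0 <= ln (q%:R : R) ->
  forall X M0 : R, e0 * ln q%:R <= X <= ln q%:R -> 0 < M0 ->
  2 * Num.sqrt (ln (q%:R : R) * ln (ln (q%:R : R))) * ln (ln (ln (q%:R : R))) <= ln M0 ->
  exists (I : finType) (p : I -> nat) (r : I -> R),
  [/\ forall i, prime (p i), injective p, forall i, ~~ (p i %| q)%N & forall i, 0 <= r i] /\
  [/\ (\prod_i (1 + r i ^+ 2)) * expR ((1 - 8 * d) * Num.sqrt (X / ln (ln (q%:R : R)))) / 2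
        <= linsum p r (expR X) M0,
      expR (\sum_i ((p i)%:R)^-1) <= C &
      \sum_(A : {set I}) \sum_(B : {set I} | M0 < (hgt p A B)%:R)
        rprod r A * rprod r B / (hgt p A B)%:R <= \prod_i (1 + r i ^+ 2)].
Proof.
move=> d01 e00; have /andP[d0 d1] := d01.
have [K [l0 [K1 l00 Hsum]]] : exists K l0 : R, [/\ 1 < K, 0 < l0 & forall l B, l0 <= l -> expR (K * l) < B%:R ->
  (1 - d) / l <=
   \sum_(0 <= p < B | prime p && (l < ln (p%:R : R) <= K * l)) (p%:R * ln (p%:R : R))^-1
  <= (1 + d) / l] by apply: sum_inv_p_lnp; rewrite d0 /=; lra.
have K0 : 0 < K by lra.
have [c [c0 c1 cK]] : exists c : R, [/\ 0 < c, c <= 1 & expR (c * K) = 1 + d].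
  exists (ln (1 + d) / K); split.
  - by rewrite divr_gt0 // ln_gt0 //; lra.
  - by rewrite ler_pdivrMr // mul1r; have := @le_ln1Dx R d; lra.
  - by rewrite divfK ?gt_eqF // lnK ?posrE //; lra.
pose t1 := 2 / d; pose t2 := 4 / d ^+ 2; pose t3 := 4 * K ^+ 2 / (d ^+ 2 * e0).
pose t4 := 3 / (2 * d * c * e0); pose t5 := 4 / c.
have t10 : 0 < t1 by rewrite divr_gt0.
have t20 : 0 < t2 by rewrite divr_gt0 ?exprn_gt0.
have t30 : 0 < t3 by rewrite divr_gt0 ?mulr_gt0 ?exprn_gt0.
have t40 : 0 < t4 by rewrite divr_gt0 // !mulr_gt0.
have t50 : 0 < t5 by rewrite divr_gt0.
have [T [[T1 Tl0 Tt1 Tt2] [Tt3 Tt4 Tt5 TK TK4]]] : exists T : R,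
  [/\ 1 <= T, l0 <= T, t1 <= T & t2 <= T] /\ [/\ t3 <= T, t4 <= T, t5 <= T, K + 1 <= T & 4 * K <= T].
  by exists (1 + l0 + t1 + t2 + t3 + t4 + t5 + (K + 1) + 4 * K); clear - l00 t10 t20 t30 t40 t50 K0; split; split; lra.
have [L0 HL] := ln_ln_large T.
exists (expR (K * (1 + d))), L0; split; first exact: expR_gt0.
move=> q q1 /HL; set L := ln (q%:R : R); set l := ln L; set l3 := ln l.
move=> [Tl3 Tl TL TlL] X M0 /andP[eX XL] M00 hM0.
have l1 : 1 <= l by exact: le_trans Tl.
have L1 : 1 <= L by exact: le_trans TL.
have TlL' : T * l <= L.
  apply: le_trans TlL; rewrite ler_wpM2l ?(le_trans _ T1) //.
  by rewrite -[leLHS]expr1 ler_weXn2l.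
have tl t : t <= T -> t * l <= L by move=> h; apply: le_trans TlL'; rewrite ler_wpM2r ?(le_trans _ l1).
have X0 : 0 < X by apply: lt_le_trans eX; rewrite mulr_gt0 // (lt_le_trans _ L1).
have eL : L = expR l by rewrite lnK // posrE (lt_le_trans _ L1).
have expKl : expR (K * l) < q%:R.
  have q0 : 0 < (q%:R : R) by rewrite ltr0n ltnW.
  rewrite -[ltRHS]lnK ?posrE // ltr_expR -/L.
  have : (K + 1) * l <= L by exact: tl.
  by clear - l1; lra.
pose lam := Num.sqrt ((1 - 5 * d) * X * l).
have kX0 : 0 <= (1 - 5 * d) * X * l by rewrite mulr_ge0 ?(le_trans _ l1) // mulr_ge0 ?(ltW X0) //; clear - d1; lra.
have lam0 : 0 <= lam by exact: sqrtr_ge0.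
have lamE : lam ^+ 2 = (1 - 5 * d) * X * l by rewrite sqr_sqrtr.
pose S := Num.sqrt (L * l).
have lamS : lam <= S.
  rewrite ler_wsqrtr // ler_wpM2r ?(le_trans _ l1) //.
  apply: le_trans XL; rewrite ler_piMl ?(ltW X0) //; clear - d0; lra.
have lS : l <= S.
  have l0' : 0 <= l by exact: le_trans l1.
  rewrite -[leLHS]ger0_norm // -sqrtr_sqr ler_wsqrtr // expr2 ler_wpM2r //.
  by have := tl 1 T1; rewrite mul1r.
have l_large : d^-1 <= l.
  apply: le_trans (le_trans Tt1 Tl); rewrite /t1 ler_peMl ?invr_ge0 ?(ltW d0) //.
  by rewrite ler1n.
have l_large2 : 2 / d <= l by exact: le_trans Tt1 Tl.
have Ll_large : 4 / d ^+ 2 <= L * l.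
  apply: le_trans (_ : L <= _); last by rewrite ler_peMr // (le_trans _ L1).
  by apply: le_trans TL.
have lX : 4 * K ^+ 2 * l <= d ^+ 2 * X.
  apply: le_trans (_ : d ^+ 2 * (e0 * L) <= _); last by rewrite ler_pM2l ?exprn_gt0.
  rewrite mulrA -ler_pdivrMl ?mulr_gt0 ?exprn_gt0 //.
  have -> : (d ^+ 2 * e0)^-1 * (4 * K ^+ 2 * l) = t3 * l by rewrite /t3; ring.
  by exact: tl.
have lpos : 0 < l by exact: lt_le_trans l1.
have aX : 3 <= 2 * d * (c / l * X).
  apply: le_trans (_ : 2 * d * (c / l * (e0 * L)) <= _); last first.
    by rewrite ler_pM2l ?mulr_gt0 // ler_pM2l ?divr_gt0.
  have -> : 2 * d * (c / l * (e0 * L)) = (2 * d * c * e0) * L / l by ring.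
  rewrite ler_pdivlMr // -ler_pdivrMl ?mulr_gt0 //.
  have -> : (2 * d * c * e0)^-1 * (3 * l) = t4 * l by rewrite /t4; ring.
  by exact: tl.
have S0 : 0 <= S by exact: sqrtr_ge0.
(* Here the factor ln ln ln q of the hypothesis is spent: it exceeds the constants depending on
   [d]. *)
have hK3 : 4 * K <= l3 by apply: le_trans Tl3.
have hc3 : t5 <= l3 by apply: le_trans Tl3.
have hc3' : 4 <= c * l3 by move: hc3; rewrite /t5 ler_pdivrMr // mulrC.
rewrite -/S in hM0.
have lM1 : 16 * K * lam <= 2 * ln M0.
  apply: le_trans (_ : 4 * (4 * K) * S <= _); last first.
    apply: le_trans (_ : 4 * l3 * S <= _); last by clear - hM0; lra.
    by rewrite ler_wpM2r // ler_pM2l.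
  have -> : 4 * (4 * K) * S = 16 * K * S by ring.
  by rewrite ler_wpM2l // mulr_ge0 // ltW.
have cM : 8 * S <= c * ln M0.
  apply: le_trans (_ : c * (2 * S * l3) <= _); last by rewrite ler_pM2l.
  have -> : c * (2 * S * l3) = 2 * S * (c * l3) by ring.
  have -> : 8 * S = 2 * S * 4 by ring.
  by rewrite ler_wpM2l // mulr_ge0.
have aM : 6 <= c / l * ln M0.
  rewrite mulrAC ler_pdivlMr //; apply: le_trans cM; clear - lS S0; lra.
have lM2 : 8 * lam <= c * ln M0 by apply: le_trans cM; rewrite ler_pM2l.
have sumall (h : l0 <= l) := Hsum l q h expKl.
have {}sumall : (1 - d) / l <=
   \sum_(0 <= k < q | prime k && (l < ln (k%:R : R) <= K * l)) (k%:R * ln (k%:R : R))^-1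
  <= (1 + d) / l by apply: sumall; apply: le_trans Tl.
exists (rprime q l K), (@rprime_val R q l K), (@rcoef R q l K lam).
have eL' : expR l = ln (q%:R : R) by rewrite -eL.
split; split.
- exact: rprime_prime.
- exact: rprime_inj.
- exact: rprime_ndvd.
- exact: rcoef_ge0.
- exact: (linsum_resonator_ge l1 K1 d01 lam0 q1 eL' l_large sumall eL X0 XL lamE Ll_large l_large2 lX c0 cK M00 aX lM1 aM lM2).
- by rewrite ler_expR; apply: sum_inv_rprime_le.
- exact: (tail_resonator_le l1 K1 d01 lam0 q1 eL' l_large sumall c0 c1 cK M00 aX lM1 aM lM2).
Qed.

(** * The lower bounds *)

(** Without non-principal characters, as for q = 2, the supremum is over the empty set and equals
    0. *)
Lemma Delta_ge0 (R : realType) (N : R) q : (0 < q)%N -> 0 <= Delta N q.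
Proof.
move=> q0.
have [[chi [d1 d2]]|h] := pselect (exists chi : nat -> R[i], is_dirichlet_char q chi /\ ~ is_principal_char q chi).
  apply: le_trans (char_sum_le_Delta N q0 d1 d2).
  by rewrite -ler0c normc_norm normr_ge0.
rewrite /Delta (_ : image _ _ = set0) ?sup0 //.
by apply/seteqP; split => // z [chi [d1 d2] _]; exfalso; apply: h; exists chi.
Qed.

(** The ranges 1..q and 0..q-1 differ in q and 0, neither of which is prime to [q]. *)
Lemma card_coprime_totient q : (1 < q)%N -> #|[set k : 'I_q | coprime k.+1 q]| = totient q.
Proof.
move=> q1; rewrite totient_count_coprime.
have -> : #|[set k : 'I_q | coprime k.+1 q]| = (\sum_(0 <= d < q) coprime q d.+1)%N.
  by rewrite big_mkord -sum1_card big_mkcond; apply: eq_bigr => k _; rewrite inE coprime_sym; case: ifP.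
case: q q1 => [|[|q]] // _.
rewrite big_nat_recr // [RHS]big_nat_recl //=.
have -> : coprime q.+2 q.+2 = false by rewrite /coprime gcdnn.
by rewrite addn0 ?add0n.
Qed.

Lemma totient_ge (R : realType) : exists2 c : nat, (0 < c)%N & forall q : nat, (1 < q)%N ->
  4 * c%:R * ln (q%:R : R) ^+ 2 <= q%:R ->
  (q%:R : R) / (2 * c%:R * ln q%:R) <= (totient q)%:R /\
  forall (N : R) (h : nat), 0 < N <= q%:R -> (0 < h)%N -> h%:R <= N / ln q%:R ^+ 3 ->
   4 <= ln (q%:R : R) -> 8 * c%:R <= ln (q%:R : R) ->
   N / (4 * c%:R * ln (q%:R : R)) / h%:R <= #|[set k : 'I_(Num.truncn N %/ h) | coprime k.+1 q]|%:R.
Proof.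
have [c c0 H] := card_coprime_ge R; exists c => // q q1 hq; split.
  by rewrite -(card_coprime_totient q1); apply: H.
set L := ln (q%:R : R) in hq *.
move=> N h /andP[N0 Nq] h0 hN L4 Lc.
have h0' : 0 < (h%:R : R) by rewrite ltr0n.
have c0' : 0 < (c%:R : R) by rewrite ltr0n.
have L0 : 0 < L by lra.
have /andP[t1 t2] := truncn_itv (ltW N0).
set m := (Num.truncn N %/ h)%N.
have Nh : L ^+ 3 <= N / h%:R.
  by rewrite ler_pdivlMr // mulrC -ler_pdivlMr ?exprn_gt0.
have L3 : 4 <= L ^+ 3.
  have L1 : 1 <= L by lra.
  by apply: le_trans L4 _; rewrite -[leLHS]expr1 ler_weXn2l.
have hm : N / h%:R - 2 <= m%:R.
  rewrite lerBlDr ler_pdivrMr //; apply: ltW; apply: lt_le_trans t2 _.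
  rewrite -[2](@natrD _ 1 1) -natrD -natrM ler_nat.
  apply: leq_trans (ltn_ceil _ h0) _; rewrite leq_mul2r addnA !addn1.
  by rewrite leqnSn orbT.
have hm2 : N / h%:R / 2 <= m%:R by lra.
have mq : (m <= q)%N.
  rewrite (leq_trans (leq_div _ _)) //; rewrite -(ler_nat R); exact: le_trans Nq.
have hc : 4 * c%:R * L ^+ 2 <= m%:R.
  apply: le_trans hm2; apply: le_trans (_ : L ^+ 3 / 2 <= _); last by rewrite ler_pM2r.
  have -> : L ^+ 3 / 2 = L / 2 * L ^+ 2 by ring.
  by rewrite ler_pM2r ?exprn_gt0 //; lra.
apply: le_trans (H q m q1 mq hc); rewrite -/L.
have -> : N / (4 * c%:R * L) / h%:R = (N / h%:R / 2) / (2 * c%:R * L).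
  by field; rewrite !gt_eqF.
by rewrite ler_pM2r // invr_gt0 !mulr_gt0.
Qed.

(** The surplus L^2 of G over H pays for the division by C1 L^2 and for the additive C2. *)
Lemma gain_bound (R : realFieldType) (C1 C2 L H G : R) :
  0 < C1 -> 0 < C2 -> 1 <= L -> C1 * (1 + C2) <= L -> 1 <= H -> H * L ^+ 2 <= G ->
  H ^+ 2 + C2 <= G ^+ 2 / (C1 * L ^+ 2).
Proof.
move=> c1 c2 L1 LC H1 HG.
have L0 : 0 < L by lra.
have H0 : 0 < H by lra.
have LL : L <= L ^+ 2 by rewrite expr2 ler_peMr //; lra.
have HH : 1 <= H ^+ 2 by rewrite exprn_ege1.
rewrite ler_pdivlMr ?mulr_gt0 ?exprn_gt0 //.
apply: le_trans (_ : (H * L ^+ 2) ^+ 2 <= _); last first.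
  by rewrite ler_sqr ?nnegrE ?(le_trans _ HG) // mulr_ge0 ?sqr_ge0 // ltW.
have -> : (H * L ^+ 2) ^+ 2 = H ^+ 2 * L ^+ 2 * L ^+ 2 by ring.
rewrite mulrA ler_pM2r ?exprn_gt0 //.
apply: le_trans (_ : H ^+ 2 * (1 + C2) * C1 <= _).
  rewrite ler_pM2r // mulrDr mulr1 lerD2l ler_peMl //; exact: ltW.
rewrite -mulrA ler_wpM2l ?(le_trans _ HH) // mulrC; lra.
Qed.

Lemma sqrtr_mul_le_self (R : rcfType) (k Y : R) : 0 <= k <= 1 -> 0 <= Y ->
  k * Num.sqrt Y <= Num.sqrt (k * Y).
Proof.
move=> /andP[k0 k1] Y0; rewrite sqrtrM // ler_wpM2r ?sqrtr_ge0 //.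
by rewrite -{1}[k]ger0_norm // -sqrtr_sqr ler_wsqrtr // expr2 ler_piMl.
Qed.

(** The slack between [de] and 8d pays for L^2 = exp(2 l), as 2 l <= d W, and for replacing Y by
    X. *)
Lemma gain_exp (R : realType) (de d e0 L l X Y : R) :
  0 < d -> 16 * d <= de -> de <= 1 -> 0 < e0 -> 0 < L -> 1 <= l -> L = expR l ->
  4 / (d ^+ 2 * e0) * l ^+ 3 <= L -> e0 * L <= Y -> (1 - d) * Y <= X ->
  expR ((1 - de) * Num.sqrt (Y / l)) * L ^+ 2 <= expR ((1 - 8 * d) * Num.sqrt (X / l)).
Proof.
move=> d0 dde de1 e00 L0 l1 eL hL hY hX.
have l0 : 0 < l by lra.
have Y0 : 0 < Y by apply: lt_le_trans hY; rewrite mulr_gt0.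
rewrite eL -expRM_natl -expRD ler_expR.
set W := Num.sqrt (Y / l).
have W0 : 0 <= W by exact: sqrtr_ge0.
have hW : 2 * l <= d * W.
  rewrite -ler_pdivrMl //.
  have p0 : 0 <= d^-1 * (2 * l) by rewrite !mulr_ge0 ?invr_ge0 ?(ltW d0) ?(ltW l0).
  rewrite -[leLHS]ger0_norm // -sqrtr_sqr ler_wsqrtr //.
  rewrite ler_pdivlMr //; apply: le_trans hY.
  rewrite -ler_pdivrMl //; apply: le_trans hL; rewrite le_eqVlt; apply/orP; left; apply/eqP; field.
  by rewrite !gt_eqF.
have hs : (1 - d) * W <= Num.sqrt (X / l).
  apply: le_trans (sqrtr_mul_le_self _ _) _.
  - by apply/andP; split; lra.
  - by rewrite divr_ge0 ?ltW.
  - by rewrite ler_wsqrtr // mulrA ler_pM2r ?invr_gt0.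
have k0 : 0 <= 1 - 8 * d by lra.
apply: le_trans (ler_wpM2l k0 hs).
apply: le_trans (_ : (1 - 9 * d) * W <= _); last first.
  by rewrite mulrA ler_wpM2r //; nra.
apply: le_trans (_ : (1 - 10 * d) * W + 2 * l <= _); last by lra.
by rewrite lerD2r ler_wpM2r //; lra.
Qed.

(** 24 = 4 * 3 * 2: the squared 1/2, the bound J <= 3 ln q, and the 2 from comparing heights within
    a window. *)
Lemma Vsum_lower (R : realType) (I : finType) (p : I -> nat) (r : I -> R) (q : nat) (x M0 C G : R) :
  (forall i, prime (p i)) -> (forall i, 0 <= r i) -> (1 < q)%N -> 0 < C -> 0 <= G ->
  x < q%:R -> 1 <= ln (q%:R : R) ->
  (\prod_i (1 + r i ^+ 2)) * G / 2 <= linsum p r x M0 ->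
  expR (\sum_i ((p i)%:R)^-1) <= C ->
  let J := (trunc_log 2 q).+1 in
  (\prod_i (1 + r i ^+ 2)) * G ^+ 2 <= 24 * C * ln q%:R * \sum_j @Vsum R I p r x M0 J j.
Proof.
move=> pp r0 q1 C0 G0 xq L1 hlin hC; set J := (_.+1)%N; cbv zeta.
have /andP[q2 q3] := trunc_log_bounds (erefl : 1 < 2)%N (ltnW q1).
have xJ : x < (2 ^ J)%:R by apply: lt_trans xq _; rewrite ltr_nat.
have := linsum_sqr_le pp r0 M0 xJ.
set Z := \prod_i _ in hlin *; set V := (\sum_j @Vsum R I p r x M0 J j); set L := ln _ in L1 *.
have Z0 : 0 < Z by apply: prodr_gt0 => i _; have := sqr_ge0 (r i); lra.
have V0 : 0 <= V.
  apply: sumr_ge0 => j _; apply: sumr_ge0 => A _; apply: sumr_ge0 => B _.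
  by rewrite divr_ge0 ?mulr_ge0 ?rprod_ge0.
have JL : (J%:R : R) <= 3 * L.
  have : (trunc_log 2 q)%:R * ln (2 : R) <= L.
    rewrite mulr_natl -lnXn // ler_ln ?posrE ?exprn_gt0 ?ltr0n ?(ltnW q1) //.
    by rewrite -natrX ler_nat.
  have h2 := ln2_ge R.
  have : (trunc_log 2 q)%:R * 2^-1 <= (trunc_log 2 q)%:R * ln (2 : R) by rewrite ler_wpM2l.
  have -> : (J%:R : R) = (trunc_log 2 q)%:R + 1 by rewrite natr1.
  by move=> a b; lra.
move=> h.
have h1 : (Z * G / 2) ^+ 2 <= Z * (3 * L * (2 * C * V)).
  apply: le_trans (_ : linsum p r x M0 ^+ 2 <= _).
    rewrite ler_sqr ?nnegrE //; first by rewrite !mulr_ge0 ?invr_ge0 ?(ltW Z0).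
    by apply: le_trans hlin; rewrite !mulr_ge0 ?invr_ge0 ?(ltW Z0).
  apply: le_trans h _; rewrite ler_pM2l //.
  have s0 : 0 <= 2 * expR (\sum_i ((p i)%:R)^-1) * V by rewrite !mulr_ge0 ?expR_ge0.
  apply: le_trans (ler_wpM2r s0 JL) _; rewrite ler_wpM2l //; first by lra.
  by rewrite ler_wpM2r // ler_pM2l.
rewrite -(ler_pM2l Z0).
have -> : Z * (Z * G ^+ 2) = 4 * (Z * G / 2) ^+ 2 by field.
have -> : Z * (24 * C * L * V) = 4 * (Z * (3 * L * (2 * C * V))) by ring.
by rewrite ler_pM2l.
Qed.

Lemma le_sqrtr_mul (R : rcfType) (M H D : R) :
  0 <= M -> 0 <= H -> 0 <= D -> M * H ^+ 2 <= D ^+ 2 -> Num.sqrt M * H <= D.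
Proof.
move=> M0 H0 D0 h; rewrite -ler_sqr ?nnegrE ?mulr_ge0 ?sqrtr_ge0 //.
by rewrite exprMn sqr_sqrtr.
Qed.

Lemma mul_gain_le (R : realFieldType) (M k Y Z D G C1 C2 L H : R) :
  0 < Z -> 0 <= M -> H ^+ 2 + C2 <= G ^+ 2 / (C1 * L ^+ 2) ->
  M * (G ^+ 2 / (C1 * L ^+ 2)) * Z <= k * Y -> k * Y <= (D ^+ 2 + M * C2) * Z ->
  M * H ^+ 2 <= D ^+ 2.
Proof.
move=> Z0 M0 h1 h2 h3.
have h4 : M * (G ^+ 2 / (C1 * L ^+ 2)) <= D ^+ 2 + M * C2.
  by rewrite -(ler_pM2r Z0); exact: le_trans h3.
have h5 := ler_wpM2l M0 h1.
by have := le_trans h5 h4; rewrite mulrDr lerD2r.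
Qed.

Section Final.
Variables (R : realType) (eps delta d : R).

Lemma Delta_first : 0 < eps -> 0 < d -> 16 * d <= delta -> delta <= 1 ->
  exists Q0 : R, forall q : nat, (1 < q)%N -> Q0 <= ln (q%:R : R) ->
  forall theta : R, theta < 1 - eps ->
  4 * Num.sqrt (ln (q%:R : R) * ln (ln (q%:R : R))) * ln (ln (ln (q%:R : R))) < theta * ln q%:R ->
  let N := expR (theta * ln (q%:R : R)) in
  Num.sqrt N * expR ((1 - delta) *
      Num.sqrt ((1 - theta) * ln (q%:R : R) / ln (ln (q%:R : R)))) <= Delta N q.
Proof.
move=> eps0 d0 dd delta1.
have d01 : 0 < d <= 8^-1 by rewrite d0 /=; lra.
have e40 : 0 < eps / 4 by rewrite divr_gt0.
have [C [L0 [C0 Hres]]] := resonator_exists d01 e40.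
have [c c0 Hc] := totient_ge R.
have c0' : 0 < (c%:R : R) by rewrite ltr0n.
(* 96 is 24 times the 4 in [k]; [C2] comes from phi(q) >= q / (2 c L). *)
pose C1 := 96 * c%:R * C; pose C2 : R := 2 * c%:R.
have C10 : 0 < C1 by rewrite !mulr_gt0.
have C20 : 0 < C2 by rewrite mulr_gt0.
pose t1 := 4 / (d ^+ 2 * (eps / 2)); pose t2 := (d * eps)^-1; pose t3 := C1 * (1 + C2).
have t10 : 0 < t1 by rewrite divr_gt0 // mulr_gt0 ?exprn_gt0 // divr_gt0.
have t20 : 0 < t2 by rewrite invr_gt0 mulr_gt0.
have t30 : 0 < t3 by rewrite mulr_gt0 // addr_gt0.
have [T [[Tt1 Tt2 Tt3 T4] [T8c TL0]]] : exists T : R, [/\ t1 <= T, t2 <= T, t3 <= T & 4 <= T] /\ (24 * c%:R <= T /\ L0 <= T).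
  have a0 : 0 <= `|L0| := normr_ge0 _; have a1 : L0 <= `|L0| := ler_norm _.
  by exists (t1 + t2 + t3 + 4 + 24 * c%:R + `|L0|); clear - a0 a1 t10 t20 t30 c0'; split; split; lra.
have [Q0 HQ] := ln_ln_large T.
exists Q0 => q q1 /HQ; set L := ln (q%:R : R); set l := ln L; set l3 := ln l.
move=> [Tl3 Tl TL TlL] theta hth hN; set N := expR (theta * L).
have l1 : 1 <= l by clear - T4 Tl; lra.
have Lpos : 0 < L by clear - T4 TL; lra.
have L1 : 1 <= L by clear - T4 TL; lra.
have L4 : 4 <= L by exact: le_trans TL.
have q0 : 0 < (q%:R : R) by rewrite ltr0n ltnW.
have eL : L = expR l by rewrite lnK.
have eq : (q%:R : R) = expR L by rewrite lnK.
have tl t : t <= T -> 0 <= t -> t * l <= L.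
  move=> h h0; apply: le_trans TlL; apply: ler_pM => //; first by clear - l1; lra.
  by rewrite -[leLHS]expr1 ler_weXn2l.
have th0 : 0 < theta.
  rewrite -(pmulr_lgt0 _ Lpos); apply: le_lt_trans hN.
  have l30 : 0 <= l3 by clear - T4 Tl3; lra.
  by rewrite !mulr_ge0 ?sqrtr_ge0.
pose Y := (1 - theta) * L.
have hY : eps * L <= Y by rewrite ler_pM2r //; clear - hth; lra.
have YL : Y < L by rewrite /Y mulrBl mul1r gtrBl mulr_gt0.
(* So exp X = q / (N L): the extra 1 / L compensates for the lower bound on phi(q), and the
   principal character costs O(N). *)
pose X := Y - l.
have hX : (1 - d) * Y <= X.
  have h : t2 * l <= L by apply: tl => //; exact: ltW.
  have : l <= d * Y.
    apply: le_trans (_ : d * (eps * L) <= _); last by rewrite ler_pM2l.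
    by rewrite mulrA -ler_pdivrMl ?mulr_gt0.
  by move=> hl; rewrite /X mulrBl mul1r lerD2l lerN2.
have Ye2 : eps / 2 * L <= Y by apply: le_trans hY; rewrite ler_pM2r //; clear - eps0; lra.
have Y0 : 0 < Y by apply: lt_le_trans hY; rewrite mulr_gt0.
have XlL : X < L by rewrite /X; clear - YL l1; lra.
have XL := ltW XlL.
have eX : eps / 4 * L <= X.
  apply: le_trans hX; apply: le_trans (_ : 2^-1 * Y <= _); last by rewrite ler_pM2r //; clear - d01; lra.
  apply: le_trans (_ : 2^-1 * (eps / 2 * L) <= _); last by rewrite ler_pM2l.
  by rewrite le_eqVlt; apply/orP; left; apply/eqP; field.
set S := Num.sqrt _ in hN.
have lS : l <= S.
  have l0' : 0 <= l by exact: le_trans l1.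
  rewrite -[leLHS]ger0_norm // -sqrtr_sqr ler_wsqrtr // expr2 ler_wpM2r //.
  by have := tl 1 _ ler01; rewrite mul1r; apply; clear - T4; lra.
have S0 : 0 <= S by exact: sqrtr_ge0.
(* A height at most [M0] leaves N / h >= L^3, long enough to count integers prime to [q]. *)
pose M0 := N / L ^+ 3.
have M00 : 0 < M0 by rewrite divr_gt0 ?expR_gt0 ?exprn_gt0.
have lnM0 : ln M0 = theta * L - 3 * l.
  by rewrite ln_div ?posrE ?expR_gt0 ?exprn_gt0 // expRK lnXn // -/l mulr_natl.
have hM0 : 2 * S * l3 <= ln M0.
  rewrite lnM0.
  have : 2 * S * 4 <= 2 * S * l3 by rewrite ler_wpM2l ?mulr_ge0 //; exact: le_trans Tl3.
  by clear - lS hN S0; lra.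
have [I [p [r [[pp pinj pq r0] [hlin hC htail]]]]] := Hres q q1 (le_trans TL0 TL) X M0 (introT andP (conj eX XL)) M00 hM0.
set G := expR _ in hlin.
have G0 : 0 <= G := expR_ge0 _.
have xq : expR X < q%:R by rewrite eq ltr_expR.
have hV := Vsum_lower pp r0 q1 C0 G0 xq L1 hlin hC.
have Lq : 4 * c%:R * L ^+ 2 <= q%:R.
  have := @expR_ge1Dxn R L 2 (ltW Lpos); rewrite -eq.
  have -> : (3`!%:R : R) = 6 by [].
  have : 24 * c%:R * L ^+ 2 <= L * L ^+ 2 by rewrite ler_pM2r ?exprn_gt0 // (le_trans T8c).
  rewrite -exprS; set a := L ^+ 3; set b := L ^+ 2 => h h'.
  by clear - h h'; lra.
have [hphi hcop] := Hc q q1 Lq; rewrite -/L in hphi hcop.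
have Nq : N <= q%:R by rewrite eq ler_expR /Y in YL *; rewrite ler_piMl ?(ltW Lpos) //; clear - hth eps0; lra.
have Npos : 0 < N := expR_gt0 _.
pose k := N / (4 * c%:R * L).
have hk (A B : {set I}) : (hgt p A B)%:R <= M0 ->
   k / (hgt p A B)%:R <= #|[set k : 'I_(Num.truncn N %/ hgt p A B) | coprime k.+1 q]|%:R.
  move=> hM; apply: hcop => //; first by rewrite Npos.
    exact: hgt_gt0.
  by apply: le_trans TL; clear - T8c c0'; lra.
have hD := @Delta_lower R I p r pp pinj r0 q q1 pq (expR X) (trunc_log 2 q).+1 xq M0 (expR_ge0 X) N k (ltW Npos) hk.
set V := \sum_j _ in hV hD; set Z := \prod_i _ in hV hD.
have Z0 : 0 < Z by apply: prodr_gt0 => i _; rewrite ltr_pwDl ?sqr_ge0.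
set phi : R := (totient q)%:R in hphi hD.
have phi0 : 0 < phi by apply: lt_le_trans hphi; rewrite divr_gt0 // !mulr_gt0.
set H := expR _.
have H1 : 1 <= H.
  by rewrite -(expR0 R) ler_expR mulr_ge0 ?sqrtr_ge0 // subr_ge0.
have HG : H * L ^+ 2 <= G.
  apply: (@gain_exp R delta d (eps / 2)) => //; first by rewrite divr_gt0.
  by apply: le_trans TlL; rewrite ler_wpM2r // exprn_ge0 // (le_trans _ l1).
have hg : H ^+ 2 + C2 <= G ^+ 2 / (C1 * L ^+ 2).
  by apply: gain_bound => //; exact: le_trans Tt3 TL.
apply: le_sqrtr_mul; rewrite ?(ltW Npos) ?expR_ge0 ?Delta_ge0 ?(ltnW q1) //.
apply: (@mul_gain_le R N k V Z (Delta N q) G C1 C2 L H Z0 (ltW Npos) hg).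
  rewrite /k /C1; have -> : N * (G ^+ 2 / (96 * c%:R * C * L ^+ 2)) * Z =
     N / (4 * c%:R * L) * (Z * G ^+ 2 / (24 * C * L)) by field; rewrite !gt_eqF.
  rewrite ler_pM2l; last by rewrite divr_gt0 // !mulr_gt0.
  by rewrite ler_pdivrMr ?mulr_gt0 // [V * _]mulrC.
rewrite -(ler_pM2l phi0) mulrA; apply: le_trans hD _.
have -> : phi * ((Delta N q ^+ 2 + N * C2) * Z) = (Delta N q ^+ 2 * phi + N * (C2 * phi)) * Z by ring.
rewrite ler_pM2r // lerD2l expr2 -mulrA ler_pM2l //.
have -> : N * expR X = q%:R / L.
  have -> : q%:R / L = expR (L - l) by rewrite expRB -eq -eL.
  by rewrite -expRD; congr expR; rewrite /X /Y; ring.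
move: hphi; rewrite ler_pdivrMr ?mulr_gt0 // ler_pdivrMr // /C2 => h.
by apply: le_trans h _; rewrite le_eqVlt; apply/orP; left; apply/eqP; ring.
Qed.

Lemma Delta_second : 0 < eps -> 0 < d -> 16 * d <= delta -> delta <= 1 ->
  exists Q0 : R, forall q : nat, (1 < q)%N -> Q0 <= ln (q%:R : R) ->
  forall theta : R, theta < 1 - eps ->
  4 * Num.sqrt (ln (q%:R : R) * ln (ln (q%:R : R))) * ln (ln (ln (q%:R : R))) < theta * ln q%:R ->
  prime q ->
  let N := expR (theta * ln (q%:R : R)) in
  Num.sqrt (q%:R / N) * expR ((1 - delta) *
      Num.sqrt ((1 - theta) * ln (q%:R : R) / (2 * ln (ln (q%:R : R))))) <= Delta (q%:R / N) q.
Proof.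
move=> eps0 d0 dd delta1.
have d01 : 0 < d <= 8^-1 by rewrite d0 /=; lra.
have e20 : 0 < eps / 2 by rewrite divr_gt0.
have [C [L0 [C0 Hres]]] := resonator_exists d01 e20.
(* 96 is 24 times the 4 of M / 4; 6 = 5 + 1, with 5 M from the counting errors and M from the
   tail. *)
pose C1 := 96 * C; pose C2 : R := 6.
have C10 : 0 < C1 by rewrite !mulr_gt0.
have C20 : 0 < C2 by [].
pose t1 := 4 / (d ^+ 2 * (eps / 2)); pose t2 := 16 / eps; pose t3 := C1 * (1 + C2).
have t10 : 0 < t1 by rewrite divr_gt0 // mulr_gt0 ?exprn_gt0 // divr_gt0.
have t20 : 0 < t2 by rewrite divr_gt0.
have t30 : 0 < t3 by rewrite mulr_gt0 // addr_gt0.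
have [T [[Tt1 Tt2 Tt3 T4] TL0]] : exists T : R, [/\ t1 <= T, t2 <= T, t3 <= T & 4 <= T] /\ L0 <= T.
  have a0 : 0 <= `|L0| := normr_ge0 _; have a1 : L0 <= `|L0| := ler_norm _.
  by exists (t1 + t2 + t3 + 4 + `|L0|); clear - a0 a1 t10 t20 t30; split; [split|]; lra.
have [Q0 HQ] := ln_ln_large T.
exists Q0 => q q1 /HQ; set L := ln (q%:R : R); set l := ln L; set l3 := ln l.
move=> [Tl3 Tl TL TlL] theta hth hN q_prime; set N := expR (theta * L).
have l1 : 1 <= l by clear - T4 Tl; lra.
have l0 : 0 < l by clear - l1; lra.
have Lpos : 0 < L by clear - T4 TL; lra.
have L1 : 1 <= L by clear - T4 TL; lra.
have L4 : 4 <= L by exact: le_trans TL.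
have q0 : 0 < (q%:R : R) by rewrite ltr0n ltnW.
have eL : L = expR l by rewrite lnK.
have eq : (q%:R : R) = expR L by rewrite lnK.
have lL : l <= L.
  apply: le_trans TlL; apply: le_trans (_ : 1 * l ^+ 3 <= _).
    by rewrite mul1r -[leLHS]expr1 ler_weXn2l.
  by rewrite ler_wpM2r ?exprn_ge0 ?(ltW l0) //; clear - T4; lra.
have th0 : 0 < theta.
  rewrite -(pmulr_lgt0 _ Lpos); apply: le_lt_trans hN.
  have l30 : 0 <= l3 by clear - T4 Tl3; lra.
  by rewrite !mulr_ge0 ?sqrtr_ge0.
(* exp X is the square root of M = q / N. *)
pose X := (1 - theta) * L / 2.
have hX : eps / 2 * L <= X.
  by rewrite /X [leRHS]mulrAC ler_pM2r // ler_pM2r //; clear - hth; lra.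
have X0 : 0 < X by apply: lt_le_trans hX; rewrite mulr_gt0.
have XlL : X < L.
  rewrite /X ltr_pdivrMr // mulrBl mul1r; have : 0 < theta * L by rewrite mulr_gt0.
  by clear - Lpos; lra.
have eX : eps / 2 * L <= X <= L by rewrite hX ltW.
set S := Num.sqrt _ in hN.
have lS : l <= S.
  rewrite -[leLHS]ger0_norm ?(ltW l0) // -sqrtr_sqr ler_wsqrtr // expr2 ler_wpM2r //.
  exact: ltW.
have S0 : 0 <= S by exact: sqrtr_ge0.
pose M0 := N / L ^+ 3.
have M00 : 0 < M0 by rewrite divr_gt0 ?expR_gt0 ?exprn_gt0.
have lnM0 : ln M0 = theta * L - 3 * l.
  by rewrite ln_div ?posrE ?expR_gt0 ?exprn_gt0 // expRK lnXn // -/l mulr_natl.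
have hM0 : 2 * S * l3 <= ln M0.
  rewrite lnM0.
  have : 2 * S * 4 <= 2 * S * l3 by rewrite ler_wpM2l ?mulr_ge0 //; exact: le_trans Tl3.
  by clear - lS hN S0; lra.
have [I [p [r [[pp pinj pq r0] [hlin hC htail]]]]] := Hres q q1 (le_trans TL0 TL) X M0 eX M00 hM0.
set G := expR _ in hlin.
have G0 : 0 <= G := expR_ge0 _.
have xq : expR X < q%:R by rewrite eq ltr_expR.
have hV := Vsum_lower pp r0 q1 C0 G0 xq L1 hlin hC.
have Npos : 0 < N := expR_gt0 _.
have N1 : 1 < N by rewrite expR_gt1 mulr_gt0.
set M := q%:R / N.
have eM : M = expR X * expR X.
  by rewrite /M eq -expRB -expRD; congr expR; rewrite /X; field.
have Mpos : 0 < M by rewrite divr_gt0.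
have x8 : 8 <= expR X.
  apply: le_trans (expR_ge1Dx X).
  have h : 16 <= eps * L by rewrite mulrC -ler_pdivrMr // (le_trans Tt2).
  by clear - h hX; lra.
have xM : 8 * expR X <= M by rewrite eM ler_pM2r ?expR_gt0.
have M0N : 4 * M0 <= N.
  rewrite /M0 mulrCA ler_piMr ?(ltW Npos) // ler_pdivrMr ?exprn_gt0 // mul1r.
  by apply: le_trans L4 _; rewrite -[leLHS]expr1 ler_weXn2l.
have q3 : (3 <= q)%N.
  by rewrite -(ler_nat R) eq; apply: le_trans (expR_ge1Dx L); clear - L4; lra.
have hD := @Delta_lower_prime R I p r pp pinj r0 q q_prime pq (expR X) M0 N (trunc_log 2 q).+1
   N1 q3 (expR_ge0 X) xM M0N.
rewrite -/M in hD.
set V := \sum_j _ in hV hD; set Z := \prod_i _ in hV hD htail.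
have Z0 : 0 < Z by apply: prodr_gt0 => i _; rewrite ltr_pwDl ?sqr_ge0.
set tail := \sum_A _ in hD htail.
set H := expR _.
have H1 : 1 <= H.
  by rewrite -(expR0 R) ler_expR mulr_ge0 ?sqrtr_ge0 // subr_ge0.
have HG : H * L ^+ 2 <= G.
  have -> : H = expR ((1 - delta) * Num.sqrt (X / l)).
    rewrite /H; congr (expR (_ * Num.sqrt _)); rewrite /X; field.
    by rewrite gt_eqF.
  apply: (@gain_exp R delta d (eps / 2)) => //.
    by apply: le_trans TlL; rewrite ler_wpM2r // exprn_ge0 // (le_trans _ l1).
  by rewrite ler_piMl ?(ltW X0) //; clear - d0; lra.
have hg : H ^+ 2 + C2 <= G ^+ 2 / (C1 * L ^+ 2).
  by apply: gain_bound => //; exact: le_trans Tt3 TL.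
apply: le_sqrtr_mul; rewrite ?(ltW Mpos) ?expR_ge0 ?Delta_ge0 ?(ltnW q1) //.
apply: (@mul_gain_le R M (M / 4) V Z (Delta M q) G C1 C2 L H Z0 (ltW Mpos) hg).
  apply: le_trans (_ : M * (G ^+ 2 / (C1 * L)) * Z <= _).
    rewrite ler_pM2r // ler_pM2l // ler_wpM2l ?sqr_ge0 //.
    rewrite lef_pV2 ?posrE ?mulr_gt0 ?exprn_gt0 // ler_pM2l // expr2 ler_peMr //; exact: ltW.
  rewrite /C1; have -> : M * (G ^+ 2 / (96 * C * L)) * Z = M / 4 * (Z * G ^+ 2 / (24 * C * L)).
    by field; rewrite !gt_eqF.
  rewrite ler_pM2l; last by rewrite divr_gt0.
  by rewrite ler_pdivrMr ?mulr_gt0 // [V * _]mulrC.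
apply: le_trans hD _.
have hx : (2 * expR X / N + 3) * expR X <= 5 * M.
  have h1 : expR X * expR X / N <= M by rewrite -eM ler_pdivrMr // ler_peMr ?(ltW N1) ?(ltW Mpos).
  have h2 : expR X <= M by rewrite eM ler_peMr ?expR_ge0 //; clear - x8; lra.
  have -> : (2 * expR X / N + 3) * expR X = 2 * (expR X * expR X / N) + 3 * expR X by ring.
  by clear - h1 h2; lra.
apply: le_trans (_ : (Delta M q ^+ 2 + 5 * M) * Z + M * Z <= _).
  apply: lerD; first by rewrite ler_pM2r // lerD2l.
  by rewrite ler_pM2l.
by rewrite le_eqVlt; apply/orP; left; apply/eqP; rewrite /C2; ring.
Qed.

End Final.

(* (1 + o(1)) in a lower bound, o(1) -> 0 as q -> oo (uniformly in the
   admissible N, for fixed eps): for every delta > 0, for all large q. *)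
Theorem theorem4 (R : realType) (eps : R) (heps : 0 < eps) :
  forall delta : R, 0 < delta ->
  exists Q0 : nat, forall q : nat, (Q0 <= q)%N ->
  forall theta : R, theta < 1 - eps ->
  let N := (q%:R : R) `^ theta in
  4 * Num.sqrt (ln (q%:R : R) * ln (ln (q%:R : R))) * ln (ln (ln (q%:R : R))) < ln N ->
  (Num.sqrt N * expR ((1 - delta) *
      Num.sqrt ((1 - theta) * ln (q%:R : R) / ln (ln (q%:R : R)))) <= Delta N q)
  /\
  (prime q ->
   Num.sqrt (q%:R / N) * expR ((1 - delta) *
      Num.sqrt ((1 - theta) * ln (q%:R : R) / (2 * ln (ln (q%:R : R)))))
   <= Delta (q%:R / N) q).
Proof.
move=> delta delta0.
(* Capping at 1 strengthens the claim and makes [1 - de] nonnegative. *)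
pose de := Num.min delta 1.
have de0 : 0 < de by rewrite lt_min delta0 ltr01.
have de1 : de <= 1 by rewrite ge_min lexx orbT.
have ded : de <= delta by rewrite ge_min lexx.
pose d := de / 16.
have d0 : 0 < d by rewrite divr_gt0.
have dd : 16 * d <= de by rewrite /d mulrC divfK.
have [Q1 H1] := @Delta_first R eps de d heps d0 dd de1.
have [Q2 H2] := @Delta_second R eps de d heps d0 dd de1.
exists (maxn 2 (Num.truncn (expR (Num.max Q1 Q2))).+1) => q.
rewrite geq_max => /andP[q1 hq] theta hth N.
have q0 : 0 < (q%:R : R) by rewrite ltr0n ltnW.
have lnq : Num.max Q1 Q2 <= ln (q%:R : R).
  rewrite -[leLHS]expRK ler_ln ?posrE ?expR_gt0 // ltW //.
  have /andP[_ h] := truncn_itv (expR_ge0 (Num.max Q1 Q2)).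
  by apply: lt_le_trans h _; rewrite ler_nat.
have NE : N = expR (theta * ln (q%:R : R)) by rewrite /N /powR gt_eqF.
rewrite NE expRK => hN.
have mono (Y : R) : expR ((1 - delta) * Num.sqrt Y) <= expR ((1 - de) * Num.sqrt Y).
  by rewrite ler_expR ler_wpM2r ?sqrtr_ge0 // lerB.
move: lnq; rewrite ge_max => /andP[lq1 lq2]; split.
  apply: le_trans (H1 q q1 lq1 theta hth hN).
  by rewrite ler_wpM2l ?sqrtr_ge0.
move=> qp; apply: le_trans (H2 q q1 lq2 theta hth hN qp).
by rewrite ler_wpM2l ?sqrtr_ge0.
Qed.
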